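(* Let $n\ge 2$, let $K_1=\mathbb{Q}(q)$ and let $\overline{K}_1$ be its algebraic closure. For a $2$-tuple $\lambda=(\lambda^{(1)},\lambda^{(2)})$ of Young diagrams of total size $n$, let $\lambda^*=(\lambda^{(2)},\lambda^{(1)})$ and let $\pi_{\lambda,\sharp}$ be the restriction of the seminormal representation $\pi_\lambda$ of $\mathscr{H}_{K_1,B_n}(1,q)$ to the fixed subalgebra $\mathscr{H}_{K_1,B_n}(1,q)^{\sharp}$. (1) $\pi_{\lambda^*,\sharp}\cong\pi_{\lambda,\sharp}$. (2) If $\lambda^*=\lambda$, then over $\overline{K}_1$ the representation $\pi_{\lambda,\sharp}$ decomposes into two inequivalent subrepresentations $\pi_{\lambda,\sharp}^+$ and $\pi_{\lambda,\sharp}^-$, and $\deg\pi_{\lambda,\sharp}^+=\deg\pi_{\lambda,\sharp}^-=\deg\pi_{\lambda,\sharp}/2$. (3) Let $\{\lambda_i,\lambda_i^*,\mu_j\}_{i,j}$ be the set of all $2$-tuples of Young diagrams of total size $n$, listed so that $\lambda_i^*\neq\lambda_i$ and $\mu_j^*=\mu_j$ (so one $\lambda_i$ is chosen from each pair $\{\lambda,\lambda^*\}$ with $\lambda\ne\lambda^*$). Then $$\{\pi_{\lambda_i,\sharp},\ \pi_{\mu_j,\sharp}^+,\ \pi_{\mu_j,\sharp}^-\}_{i,j}$$ is a basic set of irreducible representations of $\mathscr{H}_{\overline{K}_1,B_n}(1,q)^{\sharp}$, and $\mathscr{H}_{\overline{K}_1,B_n}(1,q)^{\sharp}$ is semisi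mple.
   Context: For a field $K\supseteq\mathbb{Q}(q)$ ($q$ an indeterminate) and $n\ge2$, $\mathscr{H}_{K,B_n}(1,q)$ is the $K$-algebra with generators $a_1,\dots,a_n$ and relations $a_1^2=1$; $a_i^2=(q-1)a_i+q$ ($2\le i\le n$); $a_1a_2a_1a_2=a_2a_1a_2a_1$; $a_ia_{i+1}a_i=a_{i+1}a_ia_{i+1}$ ($2\le i\le n-1$); $a_ia_j=a_ja_i$ ($|i-j|>1$). The algebra automorphism $\sharp$ of order $2$ is given by $a_1^\sharp=-a_1$, $a_i^\sharp=a_i$ ($i\ge2$), and $\mathscr{H}_{K,B_n}(1,q)^{\sharp}=\{h: h^\sharp=h\}$. A tableau $T=(T^{(1)},T^{(2)})$ of shape $\lambda=(\lambda^{(1)},\lambda^{(2)})$ (total size $n$; a diagram may be empty) is a filling of the boxes with $1,\dots,n$, each used once; it is standard if entries increase along rows and columns of each diagram. $\mathrm{STab}(\lambda)$ is the set of standard tableaux of shape $\lambda$. $\rho_T(i)\in\{1,2\}$ is the index of the diagram containing $i$. If $k$ lies in row $i$, column $j$ and $l$ in row $i'$, column $j'$ (of their respective diagrams), the axial distance is $d_{T,k,l}=(j'-i')-(j-i)$. Put $u_1=1$, $u_2=-1$ and $$M(k,y)=\frac{1}{1-q^ky}\begin{bmatrix} q-1 & 1-q^{k+1}y\\ q(1-q^{k-1}y) & -q^ky(q-1)\end{bmatrix}.$$ The seminormal representation $\pi_\lambda$ acts on $V_\lambda=\bigoplus_{T\in\mathrm{STab}(\lambda)}Kv_T$ by: $a_1v_T=u_{\rho_T(1)}v_T$;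 for $i>1$, $a_iv_T=qv_T$ if $i-1,i$ are in the same row of the same diagram, $a_iv_T=-v_T$ if they are in the same column of the same diagram, and otherwise $a_i\langle v_T,v_{s_{i-1}T}\rangle=\langle v_T,v_{s_{i-1}T}\rangle M\big(d_{T,i,i-1},u_{\rho_T(i-1)}/u_{\rho_T(i)}\big)$, where $s_{i-1}T$ is the standard tableau obtained from $T$ by exchanging $i-1$ and $i$ and $\langle\cdot,\cdot\rangle$ is a row vector. The $\pi_\lambda$ form a complete set of representatives of the irreducible representations of $\mathscr{H}_{K,B_n}(1,q)$. A basic set of irreducible representations of an algebra is a complete set of pairwise inequivalent representatives of its irreducible representations. *)

(* Defs.v *)
From HB Require Import structures.
From mathcomp Require Import all_boot all_order all_fingroup all_algebra finmap.
From mathcomp Require Import generic_quotient ring_quotient.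
From mathcomp Require Import boolp.
From mathcomp.multinomials Require Import monalg.
From mathcomp Require Import zify ring lra.

Set Implicit Arguments.
Unset Strict Implicit.
Unset Printing Implicit Defensive.

Import GRing.Theory.
Local Open Scope ring_scope.
Local Open Scope quotient_scope.

(* The free associative algebra on I is the monoid algebra of the words over I. *)
Section FreeAlgebra.
Variables (K : fieldType) (I : choiceType).

Local Notation freealg := {malg K[{fmonom I}]}.

Definition freegen (i : I) : freealg := mkmalgU (fmu i) 1.

Fact freealg_scaleAr (c : K) (x y : freealg) : c *: (x * y) = x * (c *: y).
Proof.
apply/malgP => k.
have Ex := mcoeffMlw k (fsubset_refl (msupp x)) (fsubset_refl (msupp y)).
have Ey := mcoeffMlw k (fsubset_refl (msupp x)) (msuppZ_le c y).
apply: (etrans (mcoeffZ c (x * y) k)); apply: (etrans (congr1 ( *%R c) Ex)).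
apply: etrans (esym Ey); rewrite mulr_sumr; apply: eq_bigr => k1 _.
rewrite mulr_sumr; apply: eq_bigr => k2 _.
by rewrite mcoeffZ mulrnAr mulrCA.
Qed.
End FreeAlgebra.

(* The target W is a module with a bilinear unital associative product op instead
   of an algType, because 'End(V) is not an algType when V may be zero. *)
Section Evaluation.
Variables (K : fieldType) (I : choiceType) (W : lmodType K).
Variables (op : W -> W -> W) (e : W) (b : I -> W).

Definition wordeval (w : {fmonom I}) : W := foldr (fun i x => op (b i) x) e w.

Definition freeeval (g : {malg K[{fmonom I}]}) : W :=
  \sum_(w <- msupp g) g@_w *: wordeval w.

Lemma freeevalEw (d : {fset {fmonom I}}) g : (msupp g `<=` d)%fset ->
  freeeval g = \sum_(w <- d) g@_w *: wordeval w.
Proof.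
move=> le; rewrite [LHS](big_fset_incl _ le) => //= x xd /mcoeff_outdom ->.
by rewrite scale0r.
Qed.

Lemma freeeval_is_linear : linear freeeval.
Proof.
move=> c g h; pose d := (msupp g `|` msupp h `|` msupp (c *: g + h))%fset.
rewrite !(@freeevalEw d); try by rewrite /d; apply/fsubsetP => x xin; rewrite !inE xin ?orbT.
rewrite scaler_sumr -big_split /=; apply: eq_bigr => w _.
by rewrite mcoeffD mcoeffZ scalerDl scalerA.
Qed.
HB.instance Definition _ := GRing.isLinear.Build K {malg K[{fmonom I}]} W _ freeeval
  freeeval_is_linear.

Hypotheses (opA : associative op) (op1 : left_id e op) (opr1 : right_id e op).
Hypotheses (opl : forall y, linear (op^~ y)) (opr : forall x, linear (op x)).

Lemma wordevalM (v w : {fmonom I}) : wordeval (fmmul v w) = op (wordeval v) (wordeval w).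
Proof.
rewrite /wordeval fmmulE /=.
by elim: (fmonom_val v) => [|i s IH] /=; rewrite ?op1 // IH opA.
Qed.

Lemma freeevalU c w : freeeval (mkmalgU w c) = c *: wordeval w.
Proof.
by rewrite (freeevalEw (msuppU_le (K:=_))) big_seq_fset1 mcoeffUU.
Qed.

Lemma freeeval1 : freeeval 1 = e.
Proof. by rewrite freeevalU scale1r /wordeval /mone /= fmoneE. Qed.

Lemma freeeval_gen i : freeeval (freegen K i) = b i.
Proof. by rewrite freeevalU scale1r /wordeval fmuE /= opr1. Qed.

Lemma freeevalM g h : freeeval (g * h) = op (freeeval g) (freeeval h).
Proof.
pose L y := HB.pack (op^~ y) (GRing.isLinear.Build K W W _ _ (opl y)) : {linear W -> W}.
pose R x := HB.pack (op x) (GRing.isLinear.Build K W W _ _ (opr x)) : {linear W -> W}.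
have suml (s : seq {fmonom I}) F y :
  op (\sum_(w <- s) F w) y = \sum_(w <- s) op (F w) y by exact: (raddf_sum (L y)).
have sumr (s : seq {fmonom I}) F x :
  op x (\sum_(w <- s) F w) = \sum_(w <- s) op x (F w) by exact: (raddf_sum (R x)).
have opZl c x y : op (c *: x) y = c *: op x y by exact: (linearZZ (L y) c x).
have opZr c x y : op x (c *: y) = c *: op x y by exact: (linearZZ (R x) c y).
rewrite malgME raddf_sum [in RHS]/freeeval suml; apply: eq_bigr => v _.
rewrite raddf_sum sumr; apply: eq_bigr => w _.
by rewrite [LHS]freeevalU wordevalM opZl opZr scalerA.
Qed.
End Evaluation.

(* The generators a_1, ..., a_n are indexed by 'I_n with a shift: a i stands for
   a_(i+1), so the index 0 is the generator of parameter 1. *)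
Inductive hecke_rel (K : fieldType) (q : K) (n : nat) (A : lalgType K)
    (a : 'I_n -> A) : A -> A -> Prop :=
| HeckeSq (i : 'I_n) of i = 0%N :> nat :
    hecke_rel q a (a i * a i) 1
| HeckeQuad (i : 'I_n) of (0 < i)%N :
    hecke_rel q a (a i * a i) ((q - 1) *: a i + q *: 1)
| HeckeBraid4 (i j : 'I_n) of i = 0%N :> nat & j = 1%N :> nat :
    hecke_rel q a (a i * a j * a i * a j) (a j * a i * a j * a i)
| HeckeBraid3 (i j : 'I_n) of (0 < i)%N & j = i.+1 :> nat :
    hecke_rel q a (a i * a j * a i) (a j * a i * a j)
| HeckeComm (i j : 'I_n) of (i.+1 < j)%N || (j.+1 < i)%N :
    hecke_rel q a (a i * a j) (a j * a i).

Definition two_sided_ideal (A : nzRingType) (J : A -> Prop) :=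
  [/\ J 0, forall x y, J x -> J y -> J (x - y),
      forall x y, J x -> J (y * x) & forall x y, J x -> J (x * y)].

Section HeckeIdeal.
Variables (K : fieldType) (q : K) (n : nat).
Local Notation F := {malg K[{fmonom 'I_n}]}.

Definition hecke_ideal_prop (x : F) : Prop :=
  forall J : F -> Prop, two_sided_ideal J ->
    (forall y z, hecke_rel q (@freegen K 'I_n) y z -> J (y - z)) -> J x.
Definition hecke_ideal : {pred F} := fun x => `[< hecke_ideal_prop x >].

Lemma hecke_idealP x : reflect (hecke_ideal_prop x) (x \in hecke_ideal).
Proof. exact: asboolP. Qed.

Fact hecke_ideal_zmod_closed : zmod_closed hecke_ideal.
Proof.
split; first by apply/hecke_idealP => J [].
move=> x y /hecke_idealP Jx /hecke_idealP Jy; apply/hecke_idealP => J idJ rJ.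
by case: (idJ) => _ JB _ _; apply: JB; [apply: Jx | apply: Jy].
Qed.
HB.instance Definition _ := GRing.isZmodClosed.Build F hecke_ideal
  hecke_ideal_zmod_closed.

Lemma hecke_idealMl x y : x \in hecke_ideal -> y * x \in hecke_ideal.
Proof.
move=> /hecke_idealP Jx; apply/hecke_idealP => J idJ rJ.
by case: (idJ) => _ _ Jl _; apply: (Jl x y); exact: Jx.
Qed.

Lemma hecke_idealMr x y : x \in hecke_ideal -> x * y \in hecke_ideal.
Proof.
move=> /hecke_idealP Jx; apply/hecke_idealP => J idJ rJ.
by case: (idJ) => _ _ _ Jr; apply: (Jr x y); exact: Jx.
Qed.

Lemma hecke_ideal_rel x y :
  hecke_rel q (@freegen K 'I_n) x y -> x - y \in hecke_ideal.
Proof. by move=> rxy; apply/hecke_idealP => J _; apply. Qed.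

Lemma hecke_ideal_ker (J : F -> Prop) x : two_sided_ideal J ->
    (forall y z, hecke_rel q (@freegen K 'I_n) y z -> J (y - z)) ->
  x \in hecke_ideal -> J x.
Proof. by move=> idJ rJ /hecke_idealP; apply. Qed.

End HeckeIdeal.
Arguments hecke_ideal {K} q n.

Section HeckeEvaluation.
Variables (K : fieldType) (q : K) (n : nat) (W : lmodType K).
Variables (op : W -> W -> W) (e : W) (b : 'I_n -> W).
Local Notation "x ** y" := (op x y) (at level 40, left associativity).

Record hecke_eqs : Prop := HeckeEqs {
  hecke_opA : associative op;
  hecke_op1l : left_id e op;
  hecke_op1r : right_id e op;
  hecke_opl : forall y, linear (op^~ y);
  hecke_opr : forall x, linear (op x);
  hecke_sq : forall i : 'I_n, i = 0%N :> nat -> b i ** b i = e;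
  hecke_quad : forall i : 'I_n, (0 < i)%N ->
    b i ** b i = (q - 1) *: b i + q *: e;
  hecke_braid4 : forall i j : 'I_n, i = 0%N :> nat -> j = 1%N :> nat ->
    b i ** b j ** b i ** b j = b j ** b i ** b j ** b i;
  hecke_braid3 : forall i j : 'I_n, (0 < i)%N -> j = i.+1 :> nat ->
    b i ** b j ** b i = b j ** b i ** b j;
  hecke_comm : forall i j : 'I_n, (i.+1 < j)%N || (j.+1 < i)%N ->
    b i ** b j = b j ** b i }.

Hypothesis bP : hecke_eqs.
Let ev := freeeval op e b.
Let evM x y : ev (x * y) = ev x ** ev y.
Proof. by case: bP => *; apply: freeevalM. Qed.
Let evg i : ev (freegen K i) = b i.
Proof. by case: bP => *; apply: freeeval_gen. Qed.
Let ev1 : ev 1 = e. Proof. exact: freeeval1. Qed.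
Let evB x y : ev (x - y) = ev x - ev y. Proof. exact: raddfB. Qed.
Let evD x y : ev (x + y) = ev x + ev y. Proof. exact: raddfD. Qed.
Let evZ c x : ev (c *: x) = c *: ev x. Proof. exact: linearZZ. Qed.
Let ev0 : ev 0 = 0. Proof. exact: raddf0. Qed.

Lemma hecke_op0l y : 0 ** y = 0.
Proof.
pose L := HB.pack (op^~ y) (GRing.isLinear.Build K W W _ _ (hecke_opl bP y)) : {linear W -> W}.
exact: (raddf0 L).
Qed.

Lemma hecke_op0r y : y ** 0 = 0.
Proof.
pose L := HB.pack (op y) (GRing.isLinear.Build K W W _ _ (hecke_opr bP y)) : {linear W -> W}.
exact: (raddf0 L).
Qed.

Lemma hecke_eqs_rel (A : lalgType K) (a : 'I_n -> A) (f : A -> W) :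
    (forall x y, f (x * y) = f x ** f y) -> f 1 = e ->
    (forall x y, f (x + y) = f x + f y) -> (forall c x, f (c *: x) = c *: f x) ->
    (forall i, f (a i) = b i) ->
  forall x y, hecke_rel q a x y -> f x = f y.
Proof.
move=> fM f1 fD fZ fa x y.
case=> [i i0|i i0|i j i0 j1|i j i0 ji|i j ij]; rewrite ?fD ?fZ !(fM, fa) ?f1.
- exact: hecke_sq.
- exact: hecke_quad.
- exact: hecke_braid4.
- exact: hecke_braid3.
- exact: hecke_comm.
Qed.

Lemma freeeval_hecke_ideal x : x \in hecke_ideal q n -> ev x = 0.
Proof.
apply: (@hecke_ideal_ker _ _ _ (fun x => ev x = 0)).
  split=> [|y z y0 z0|y z y0|y z y0]; first exact: ev0.
  - by rewrite evB y0 z0 subrr.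
  - by rewrite evM y0 hecke_op0r.
  - by rewrite evM y0 hecke_op0l.
move=> y z rel; rewrite evB (hecke_eqs_rel evM ev1 evD evZ evg rel).
exact: subrr.
Qed.
End HeckeEvaluation.

Lemma hecke_eqs_alg (K : fieldType) (q : K) (n : nat) (A : algType K)
    (a : 'I_n -> A) :
  (forall x y, hecke_rel q a x y -> x = y) -> hecke_eqs q *%R 1 a.
Proof.
move=> rel; split; try by move=> *; apply: rel; constructor.
- exact: mulrA.
- exact: mul1r.
- exact: mulr1.
- by move=> y c u v /=; rewrite mulrDl -scalerAl.
- by move=> y c u v /=; rewrite mulrDr -scalerAr.
Qed.

Section HeckeAlgebra.
Variables (K : fieldType) (q : K) (n : nat).
Local Notation F := {malg K[{fmonom 'I_n}]}.

Lemma hecke_ideal1 : 1 \notin hecke_ideal q n.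
Proof.
pose b (i : 'I_n) : K^o := if i == 0%N :> nat then 1 else - 1.
have /freeeval_hecke_ideal H : hecke_eqs q *%R 1 b.
  apply: hecke_eqs_alg => x y; case=> [i|i|i j|i j|i j]; rewrite /b.
  - by move=> ->; rewrite mulr1.
  - by rewrite lt0n => /negbTE->; rewrite mulrNN mulr1 scalerN /GRing.scale /= !mulr1 opprB subrK.
  - by move=> -> ->; rewrite !mul1r !mulr1.
  - by rewrite lt0n => /negbTE-> ->.
  - by move=> _; rewrite mulrC.
by apply/negP => /H; rewrite freeeval1 => /eqP; rewrite oner_eq0.
Qed.

Definition hecke : Type := Quotient.quot (hecke_ideal q n).
HB.instance Definition _ := ZmodQuotient.on hecke.

Definition hecke1 : hecke := lift_cst hecke 1.
Definition hecke_mul := lift_op2 hecke *%R.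
Definition hecke_scale (c : K) := lift_op1 hecke ( *:%R c).
Canonical pi_hecke1 := PiConst hecke1.

Lemma pi_hecke_mul : {morph \pi : x y / x * y >-> hecke_mul x y}.
Proof.
move=> x y; unlock hecke_mul; apply/eqP; rewrite piE Quotient.equivE.
pose y' := repr (\pi_hecke y); pose x' := repr (\pi_hecke x).
have yP : y - y' \in hecke_ideal q n by rewrite Quotient.idealrBE reprK.
have xP : x - x' \in hecke_ideal q n by rewrite Quotient.idealrBE reprK.
have -> : x * y - x' * y' = x * (y - y') + (x - x') * y'.
  by rewrite mulrBr mulrBl addrA subrK.
exact: rpredD (hecke_idealMl x yP) (hecke_idealMr y' xP).
Qed.
Canonical pi_hecke_mul_morph := PiMorph2 pi_hecke_mul.

Lemma pi_hecke_scale c : {morph \pi : x / c *: x >-> hecke_scale c x}.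
Proof.
move=> x; unlock hecke_scale; apply/eqP; rewrite piE Quotient.equivE.
rewrite -scalerBr -mul_malgC hecke_idealMl //.
by rewrite Quotient.idealrDE opprK reprK.
Qed.
Canonical pi_hecke_scale_morph c := PiMorph1 (pi_hecke_scale c).

Fact hecke_mulA : associative hecke_mul.
Proof. by move=> x y z; rewrite -[x]reprK -[y]reprK -[z]reprK !piE mulrA. Qed.
Fact hecke_mul1l : left_id hecke1 hecke_mul.
Proof. by move=> x; rewrite -[x]reprK !piE mul1r. Qed.
Fact hecke_mul1r : right_id hecke1 hecke_mul.
Proof. by move=> x; rewrite -[x]reprK !piE mulr1. Qed.
Fact hecke_mulDl : left_distributive hecke_mul +%R.
Proof.
by move=> x y z; rewrite -[x]reprK -[y]reprK -[z]reprK !piE mulrDl.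
Qed.
Fact hecke_mulDr : right_distributive hecke_mul +%R.
Proof.
by move=> x y z; rewrite -[x]reprK -[y]reprK -[z]reprK !piE mulrDr.
Qed.
Fact hecke1_neq0 : hecke1 != 0.
Proof. by rewrite piE Quotient.equivE subr0 hecke_ideal1. Qed.
HB.instance Definition _ := GRing.Zmodule_isNzRing.Build hecke
  hecke_mulA hecke_mul1l hecke_mul1r hecke_mulDl hecke_mulDr hecke1_neq0.

Fact hecke_scaleA c d x : hecke_scale c (hecke_scale d x) = hecke_scale (c * d) x.
Proof. by rewrite -[x]reprK !piE scalerA. Qed.
Fact hecke_scale1 : left_id 1 hecke_scale.
Proof. by move=> x; rewrite -[x]reprK !piE scale1r. Qed.
Fact hecke_scaleDr : right_distributive hecke_scale +%R.
Proof. by move=> c x y; rewrite -[x]reprK -[y]reprK !piE scalerDr. Qed.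
Fact hecke_scaleDl x : {morph hecke_scale^~ x : c d / c + d}.
Proof. by move=> c d; rewrite -[x]reprK !piE scalerDl. Qed.
HB.instance Definition _ := GRing.Zmodule_isLmodule.Build K hecke
  hecke_scaleA hecke_scale1 hecke_scaleDr hecke_scaleDl.

Fact hecke_scaleAl (c : K) (x y : hecke) : c *: (x * y) = c *: x * y.
Proof.
rewrite -[x]reprK -[y]reprK -[_ * _]pi_hecke_mul -[RHS]/(hecke_mul (hecke_scale c _) _).
by rewrite -[hecke_scale c _]pi_hecke_scale -pi_hecke_mul -scalerAl [RHS]pi_hecke_scale.
Qed.
HB.instance Definition _ := GRing.Lmodule_isLalgebra.Build K hecke hecke_scaleAl.
Fact hecke_scaleAr (c : K) (x y : hecke) : c *: (x * y) = x * (c *: y).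
Proof.
rewrite -[x]reprK -[y]reprK -[_ * _]pi_hecke_mul -[RHS]/(hecke_mul _ (hecke_scale c _)).
by rewrite -[hecke_scale c _]pi_hecke_scale -pi_hecke_mul -freealg_scaleAr [RHS]pi_hecke_scale.
Qed.
HB.instance Definition _ := GRing.Lalgebra_isAlgebra.Build K hecke hecke_scaleAr.

Definition hecke_gen (i : 'I_n) : hecke := \pi_hecke (freegen K i).

End HeckeAlgebra.

Section HeckeLift.
Variables (K : fieldType) (q : K) (n : nat).

Lemma pi_heckeM x y :
  \pi_(hecke q n) (x * y) = \pi_(hecke q n) x * \pi_(hecke q n) y.
Proof. exact: pi_hecke_mul. Qed.
Lemma pi_heckeZ c x : \pi_(hecke q n) (c *: x) = c *: \pi_(hecke q n) x.
Proof. exact: pi_hecke_scale. Qed.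
Lemma pi_heckeD x y :
  \pi_(hecke q n) (x + y) = \pi_(hecke q n) x + \pi_(hecke q n) y.
Proof. exact: raddfD. Qed.
Lemma pi_hecke1E : \pi_(hecke q n) 1 = 1.
Proof. by rewrite -[RHS]/(hecke1 q n) piE. Qed.

Lemma hecke_genP x y : hecke_rel q (@hecke_gen K q n) x y -> x = y.
Proof.
have E u v : hecke_rel q (@freegen K 'I_n) u v ->
    \pi_(hecke q n) u = \pi_(hecke q n) v.
  by move=> /hecke_ideal_rel; rewrite Quotient.idealrBE => /eqP.
have M := pi_heckeM.
case=> [i i0|i i0|i j i0 j1|i j i0 ji|i j ij];
  rewrite /hecke_gen -?pi_hecke1E -?(pi_heckeM, pi_heckeZ, pi_heckeD); apply: E.
- exact: HeckeSq.
- exact: HeckeQuad.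
- exact: HeckeBraid4.
- exact: HeckeBraid3.
- exact: HeckeComm.
Qed.

Variables (W : lmodType K) (op : W -> W -> W) (e : W) (b : 'I_n -> W).
Hypothesis bP : hecke_eqs q op e b.

Definition hecke_lift (x : hecke q n) : W := freeeval op e b (repr x).

Lemma hecke_lift_pi x : hecke_lift (\pi_(hecke q n) x) = freeeval op e b x.
Proof.
apply/eqP; rewrite -subr_eq0 /hecke_lift -raddfB; apply/eqP.
by apply: (freeeval_hecke_ideal bP); rewrite Quotient.idealrBE reprK.
Qed.

Lemma hecke_lift_is_linear : linear hecke_lift.
Proof.
move=> c x y; rewrite -[x]reprK -[y]reprK -pi_heckeZ -pi_heckeD !hecke_lift_pi.
by rewrite raddfD /= linearZZ.
Qed.

Lemma hecke_lift1 : hecke_lift 1 = e.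
Proof. by rewrite -pi_hecke1E hecke_lift_pi freeeval1. Qed.

Lemma hecke_liftM x y : hecke_lift (x * y) = op (hecke_lift x) (hecke_lift y).
Proof.
rewrite -[x]reprK -[y]reprK -pi_heckeM !hecke_lift_pi.
by case: bP => *; apply: freeevalM.
Qed.

Lemma hecke_lift_gen i : hecke_lift (hecke_gen q i) = b i.
Proof. by rewrite hecke_lift_pi; case: bP => *; apply: freeeval_gen. Qed.
End HeckeLift.
Arguments hecke_lift {K} q {n W}.

Section Sharp.
Variables (K : fieldType) (q : K) (n : nat).
Local Notation H := (hecke q n).

Definition sharp_gen (i : 'I_n) : H :=
  if i == 0%N :> nat then - hecke_gen q i else hecke_gen q i.

Lemma sharp_gen_eqs : hecke_eqs q *%R 1 sharp_gen.
Proof.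
have gP := @hecke_genP K q n.
have gt0F (i : 'I_n) : (0 < i)%N -> (val i == 0%N) = false.
  by rewrite lt0n => /negbTE.
apply: hecke_eqs_alg => x y; rewrite /sharp_gen.
case=> [i i0|i i0|i j i0 j1|i j i0 ji|i j ij].
- by rewrite i0 /= mulrNN; apply: gP; exact: HeckeSq.
- by rewrite gt0F //; apply: gP; exact: HeckeQuad.
- rewrite i0 j1 /= !(mulNr, mulrN, opprK); apply: gP; exact: HeckeBraid4.
- by rewrite (gt0F i) // (gt0F j) ?ji //; apply: gP; exact: HeckeBraid3.
- have E := gP _ _ (HeckeComm q (@hecke_gen K q n) ij).
  by do 2?case: ifP => _; rewrite ?(mulNr, mulrN) E.
Qed.

Definition hecke_sharp : H -> H := hecke_lift q *%R 1 sharp_gen.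
HB.instance Definition _ := GRing.isLinear.Build K H H _ hecke_sharp
  (hecke_lift_is_linear sharp_gen_eqs).
HB.instance Definition _ := GRing.isMonoidMorphism.Build H H hecke_sharp
  (hecke_lift1 sharp_gen_eqs, hecke_liftM sharp_gen_eqs).

Lemma hecke_sharp_gen i : hecke_sharp (hecke_gen q i) =
  if i == 0%N :> nat then - hecke_gen q i else hecke_gen q i.
Proof. exact: (hecke_lift_gen sharp_gen_eqs). Qed.

Lemma hecke_ext (W : lmodType K) (op : W -> W -> W) (f g : {linear H -> W}) :
  f 1 = g 1 -> (forall i, f (hecke_gen q i) = g (hecke_gen q i)) ->
  {morph f : x y / x * y >-> op x y} -> {morph g : x y / x * y >-> op x y} ->
  f =1 g.
Proof.
move=> fg1 fgg fM gM x; rewrite -[x]reprK; move: (repr x) => {}x.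
rewrite [x]monalgE !raddf_sum /=; apply: eq_bigr => w _.
have -> : << x@_w *g w >> = x@_w *: << w >> :> {malg K[{fmonom 'I_n}]}.
  by rewrite -mul_malgC malgM_def fgmulUU mulr1 mul1m.
rewrite !pi_heckeZ !linearZ /=; congr (_ *: _).
case: w => s; elim: s => [|i s IH].
  have -> : << FMonom [::] >> = 1 :> {malg K[{fmonom 'I_n}]} by rewrite -fmE.
  by rewrite pi_hecke1E.
have -> : << FMonom (i :: s) >> = freegen K i * << FMonom s >>.
  rewrite malgM_def fgmulUU mulr1; congr << _ *g _ >>.
  by rewrite /mmul /= fmmulE fmuE.
by rewrite !pi_heckeM fM gM IH -!/(hecke_gen q i) fgg.
Qed.

Lemma hecke_sharpK : involutive hecke_sharp.
Proof.
pose f : {linear H -> H} := hecke_sharp \o hecke_sharp.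
apply: (@hecke_ext H *%R f idfun); rewrite ?/f /=.
- by rewrite !rmorph1.
- move=> i; rewrite hecke_sharp_gen.
  by case: ifP => i0; rewrite ?raddfN /= hecke_sharp_gen i0 ?opprK.
- by move=> x y; rewrite /= !rmorphM.
- by [].
Qed.

Definition sharp_fixed : {pred H} := [pred h | hecke_sharp h == h].

Fact sharp_fixed_subalg_closed : subalg_closed sharp_fixed.
Proof.
split=> [|c x y|x y]; rewrite !inE; first by rewrite rmorph1.
  by move=> /eqP xE /eqP yE; rewrite linearP /= xE yE.
by move=> /eqP xE /eqP yE; rewrite rmorphM /= xE yE.
Qed.
HB.instance Definition _ := GRing.isSubalgClosed.Build K H sharp_fixed
  sharp_fixed_subalg_closed.

Record hecke_fixed : Type := HeckeFixed {
  hecke_fixed_val :> H;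
  hecke_fixedP : hecke_fixed_val \in sharp_fixed }.
HB.instance Definition _ := [isSub for hecke_fixed_val].
HB.instance Definition _ := [Choice of hecke_fixed by <:].
HB.instance Definition _ :=
  [SubChoice_isSubAlgebra of hecke_fixed by <:].

Fact hecke_fixed_val_linear : linear hecke_fixed_val.
Proof. by []. Qed.
Fact hecke_fixed_val_monoid : monoid_morphism hecke_fixed_val.
Proof. by []. Qed.
HB.instance Definition _ := GRing.isLinear.Build K hecke_fixed H _
  hecke_fixed_val hecke_fixed_val_linear.
HB.instance Definition _ := GRing.isMonoidMorphism.Build hecke_fixed H
  hecke_fixed_val hecke_fixed_val_monoid.
End Sharp.

(* Representations are finite-dimensional left modules; the action is valued in
   'End(V) with composition, which composes in the order of left modules. *)
Record algrep (K : fieldType) (A : algType K) := AlgRep {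
  rspace : vectType K;
  ract :> {linear A -> 'End(rspace)};
  ract1 : ract 1 = \1%VF;
  ractM : forall x y, ract (x * y) = (ract x \o ract y)%VF }.

Definition rdeg (K : fieldType) (A : algType K) (r : algrep A) : nat :=
  \dim {: rspace r}.

Definition requiv (K : fieldType) (A : algType K) (r s : algrep A) : Prop :=
  exists2 f : 'Hom(rspace r, rspace s), bijective f &
    forall x v, f (r x v) = s x (f v).

Definition rstable (K : fieldType) (A : algType K) (r : algrep A)
    (U : {vspace rspace r}) : Prop :=
  forall x, (r x @: U <= U)%VS.

Definition rirreducible (K : fieldType) (A : algType K) (r : algrep A) : Prop :=
  (0 < rdeg r)%N /\
  forall U : {vspace rspace r}, rstable U -> U = 0%VS \/ U = fullv.

Record subrep (K : fieldType) (A : algType K) (r : algrep A) := SubRep {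
  subrep_space :> {vspace rspace r};
  subrep_stable : rstable subrep_space }.

Section SubRep.
Variables (K : fieldType) (A : algType K) (r : algrep A) (U : subrep r).

Definition subrep_act (x : A) : 'End(subvs_of U) :=
  linfun (vsproj U \o r x \o vsval).

Fact subrep_actE x v : vsval (subrep_act x v) = r x (vsval v).
Proof.
rewrite lfunE /= vsprojK //.
exact: (subvP (subrep_stable U x)) (memv_img _ (subvsP v)).
Qed.

Fact subrep_act_linear : linear subrep_act.
Proof.
move=> c x y; apply/lfunP => v; apply: subvs_inj.
rewrite subrep_actE linearP !add_lfunE !scale_lfunE.
by rewrite [RHS]linearP; congr (_ *: _ + _); rewrite [RHS]subrep_actE.
Qed.
HB.instance Definition _ := GRing.isLinear.Build K A _ _ subrep_act
  subrep_act_linear.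

Fact subrep_act1 : subrep_act 1 = \1%VF.
Proof.
by apply/lfunP => v; apply: subvs_inj; rewrite /= subrep_actE ract1 !id_lfunE.
Qed.

Fact subrep_actM x y : subrep_act (x * y) = (subrep_act x \o subrep_act y)%VF.
Proof.
apply/lfunP => v; apply: subvs_inj.
by rewrite /= comp_lfunE !subrep_actE ractM comp_lfunE.
Qed.

Definition rep_of_sub : algrep A :=
  @AlgRep _ _ (subvs_of U) subrep_act subrep_act1 subrep_actM.
End SubRep.

Section Restriction.
Variables (K : fieldType) (A B : algType K) (f : {lrmorphism A -> B}).
Variable r : algrep B.

Definition res_act : {linear A -> 'End(rspace r)} := r \o f.
Fact res_act1 : res_act 1 = \1%VF.
Proof. by rewrite /= rmorph1 ract1. Qed.
Fact res_actM x y : res_act (x * y) = (res_act x \o res_act y)%VF.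
Proof. by rewrite /= rmorphM ractM. Qed.
Definition res_rep : algrep A := AlgRep res_act1 res_actM.
End Restriction.

(* Indexing by I makes the pairwise inequivalence part of the statement: two
   different indices give inequivalent representations. *)
Definition basic_set (K : fieldType) (A : algType K) (I : Type)
    (r : I -> algrep A) : Prop :=
  [/\ forall i, rirreducible (r i),
      forall i j, requiv (r i) (r j) -> i = j
    & forall s, rirreducible s -> exists i, requiv s (r i)].

Definition left_ideal (A : nzRingType) (J : A -> Prop) : Prop :=
  [/\ J 0, forall x y, J x -> J y -> J (x + y) & forall a x, J x -> J (a * x)].

(* The left regular module is semisimple: every left ideal is a direct summand. *)
Definition semisimple_ring (A : nzRingType) : Prop :=
  forall J : A -> Prop, left_ideal J ->
  exists J' : A -> Prop, [/\ left_ideal J',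
    forall x, exists2 y, J y & J' (x - y)
    & forall x, J x -> J' x -> x = 0].

Section HeckeRep.
Variables (K : fieldType) (q : K) (n : nat) (V : vectType K).
Variables (b : 'I_n -> 'End(V)).
Hypothesis bP : hecke_eqs q (@comp_lfun K V V V) \1%VF b.

Definition hecke_act (x : hecke q n) : 'End(V) :=
  hecke_lift q (@comp_lfun K V V V) \1%VF b x.
HB.instance Definition _ := GRing.isLinear.Build K (hecke q n) 'End(V) _ hecke_act
  (hecke_lift_is_linear bP).

Definition hecke_rep : algrep (hecke q n) :=
  @AlgRep _ _ V hecke_act (hecke_lift1 bP) (hecke_liftM bP).

Lemma hecke_rep_gen i : hecke_rep (hecke_gen q i) = b i.
Proof. exact: (hecke_lift_gen bP). Qed.
End HeckeRep.

Definition res_sharp (K : fieldType) (q : K) (n : nat) (r : algrep (hecke q n)) :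
  algrep (hecke_fixed q n) := res_rep (@hecke_fixed_val K q n) r.

Definition is_partition (s : seq nat) : bool := sorted geq s && (0 \notin s)%N.

Definition bipart (n : nat) := {l : seq nat * seq nat |
  [&& is_partition l.1, is_partition l.2 & sumn l.1 + sumn l.2 == n]%N}.

Fact bipart_swap_subproof n (l : bipart n) :
  [&& is_partition (val l).2, is_partition (val l).1
    & sumn (val l).2 + sumn (val l).1 == n]%N.
Proof. by case/and3P: (valP l) => -> ->; rewrite addnC. Qed.
Definition bipart_swap n (l : bipart n) : bipart n :=
  exist _ ((val l).2, (val l).1) (bipart_swap_subproof l).

(* (diagram, row, column), rows and columns counted from 0; false is the first
   diagram. Rows and columns of a diagram with at most n boxes are below n. *)
Definition box (n : nat) : Type := (bool * 'I_n * 'I_n)%type.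
HB.instance Definition _ n := Finite.on (box n).

Section Tableaux.
Variable n : nat.

Definition bdiag (b : box n) : bool := b.1.1.
Definition brow (b : box n) : nat := b.1.2.
Definition bcol (b : box n) : nat := b.2.

(* A filling is recorded by the position of each entry; the entry k + 1 of the
   usual convention is k : 'I_n. *)
Definition filling := {ffun 'I_n -> box n}.
Implicit Types (T : filling) (l : bipart n) (i j k : 'I_n).

Definition in_shape l (b : box n) : bool :=
  (bcol b < nth 0 (if bdiag b then (val l).2 else (val l).1) (brow b))%N.

Definition is_tableau l T : bool :=
  injectiveb T && [forall b, in_shape l b == (b \in codom T)].

Definition is_standard T : bool :=
  [forall i, forall j, (bdiag (T i) == bdiag (T j)) &&
    ((brow (T i) == brow (T j)) && (bcol (T i) < bcol (T j))%N
     || (bcol (T i) == bcol (T j)) && (brow (T i) < brow (T j))%N) ==> (i < j)%N].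

Definition stab l := {T : filling | is_tableau l T && is_standard T}.

(* d_(T,k,m) = (j' - i') - (j - i) for k in row i, column j and m in row i',
   column j'. *)
Definition axial_dist T k m : int :=
  ((bcol (T m))%:Z - (brow (T m))%:Z) - ((bcol (T k))%:Z - (brow (T k))%:Z).

Definition swap_entries T i j : filling := [ffun k => T (tperm i j k)].

Definition pred_entry i : 'I_n := Ordinal (leq_ltn_trans (leq_pred i) (ltn_ord i)).

Definition same_row T i j :=
  (bdiag (T i) == bdiag (T j)) && (brow (T i) == brow (T j)).
Definition same_col T i j :=
  (bdiag (T i) == bdiag (T j)) && (bcol (T i) == bcol (T j)).
End Tableaux.

Section Seminormal.
Variables (K : fieldType) (q : K) (n : nat) (l : bipart n).

Definition usign (d : bool) : K := if d then - 1 else 1.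

Definition Mmx (k : int) (y : K) : 'M[K]_2 :=
  (1 - q ^ k * y)^-1 *: \matrix_(i < 2, j < 2)
    (if i == 0
     then if j == 0 then q - 1 else 1 - q ^ (k + 1) * y
     else if j == 0 then q * (1 - q ^ (k - 1) * y) else - (q ^ k * y * (q - 1))).

Definition seminormal_space : vectType K := {ffun stab l -> K^o}.

(* v_T for T standard of shape l, and 0 for the other fillings. *)
Definition basis_vec (T : filling n) : seminormal_space :=
  [ffun t : stab l => (val t == T)%:R].

(* The action of a_(i+1) on v_T; pred_entry i, i are the entries called i - 1 and i
   when entries are counted from 1. In the last case only the first column of M
   is needed: seminormal_gen_pair recovers the action on v_(sT) by the second
   column. *)
Definition seminormal_basis_act (i : 'I_n) (T : filling n) : seminormal_space :=
  if i == 0%N :> nat then usign (bdiag (T i)) *: basis_vec T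
  else if same_row T (pred_entry i) i then q *: basis_vec T
  else if same_col T (pred_entry i) i then - basis_vec T
  else let M := Mmx (axial_dist T i (pred_entry i))
                    (usign (bdiag (T (pred_entry i))) / usign (bdiag (T i))) in
       M 0 0 *: basis_vec T + M 1 0 *: basis_vec (swap_entries T (pred_entry i) i).

Definition seminormal_gen (i : 'I_n) : 'End(seminormal_space) :=
  linfun (fun f : seminormal_space =>
    \sum_(t : stab l) (f t : K) *: seminormal_basis_act i (val t)).

End Seminormal.
Arguments basis_vec {K n} l T.
Arguments seminormal_gen {K} q {n} l i.

Section TableauTheory.
Variables (n : nat) (l : bipart n).
Implicit Types (T U : filling n) (i j k m : 'I_n) (b c : box n).

Definition std T := is_tableau l T && is_standard T.

Definition before b c := (bdiag b == bdiag c) &&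
    ((brow b == brow c) && (bcol b < bcol c)%N
     || (bcol b == bcol c) && (brow b < brow c)%N).
Definition blocked b c := (bdiag b == bdiag c) &&
    ((brow b == brow c) || (bcol b == bcol c)).

Lemma box_eqP b c : bdiag b = bdiag c -> brow b = brow c -> bcol b = bcol c -> b = c.
Proof.
case: b => [[d r] c1]; case: c => [[d' r'] c2]; rewrite /bdiag /brow /bcol /=.
by move=> -> /val_inj -> /val_inj ->.
Qed.

Lemma before_row b c : bdiag b = bdiag c -> brow b = brow c ->
  (bcol b < bcol c)%N -> before b c.
Proof. by move=> dE rE cl; rewrite /before dE rE cl !eqxx. Qed.

Lemma before_col b c : bdiag b = bdiag c -> bcol b = bcol c ->
  (brow b < brow c)%N -> before b c.
Proof. by move=> dE cE rl; rewrite /before dE cE rl !eqxx orbT. Qed.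

Lemma std_inj T : std T -> injective T.
Proof. by case/andP => /andP[/injectiveP]. Qed.

Lemma std_before T i j : std T -> before (T i) (T j) -> (i < j)%N.
Proof. by case/andP => _ /forallP/(_ i)/forallP/(_ j)/implyP. Qed.

Lemma std_shape T i : std T -> in_shape l (T i).
Proof.
by case/andP => /andP[_ /forallP/(_ (T i))/eqP ->] _; apply: codom_f.
Qed.

Lemma std_surj T b : std T -> in_shape l b -> exists i, T i = b.
Proof.
case/andP => /andP[_ /forallP/(_ b)/eqP ->] _ /codomP[i ->]; by exists i.
Qed.

Lemma shape_le b c : bdiag b = bdiag c -> (brow b <= brow c)%N ->
  (bcol b <= bcol c)%N -> in_shape l c -> in_shape l b.
Proof.
rewrite /in_shape => -> rle cle lt; apply: leq_ltn_trans cle (leq_trans lt _).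
set s := if _ then _ else _.
have : sorted geq s by rewrite /s; case/and3P: (valP l) => /andP[? _] /andP[? _] _; case: ifP.
move: (brow b) (brow c) rle {lt} => r r' rr' srt.
case: (ltnP r' (size s)) => [lt|ge]; last by rewrite (nth_default _ ge).
apply: (sorted_leq_nth _ _ _ srt) => //; rewrite ?inE //.
- by move=> x y z /= xy yz; apply: leq_trans yz xy.
- by move=> x /=.
- exact: leq_ltn_trans lt.
Qed.

Lemma std_mono T i j : std T -> bdiag (T i) = bdiag (T j) ->
  (brow (T i) <= brow (T j))%N -> (bcol (T i) <= bcol (T j))%N -> (i <= j)%N.
Proof.
move=> sT dE rle cle.
pose b : box n := (bdiag (T i), (T i).1.2, (T j).2).
have [m mE] : exists m, T m = b.
  by apply: std_surj => //; apply: shape_le (std_shape j sT).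
have im : (i <= m)%N.
  case: (ltngtP (bcol (T i)) (bcol (T j))) cle => // cl _.
    by apply: ltnW; apply: (std_before sT); rewrite mE; apply: before_row.
  suff -> : i = m by [].
  by apply: (std_inj sT); rewrite mE; apply: box_eqP.
apply: leq_trans im _.
case: (ltngtP (brow (T i)) (brow (T j))) rle => // rl _.
  by apply: ltnW; apply: (std_before sT); rewrite mE; apply: before_col.
suff -> : m = j by [].
by apply: (std_inj sT); rewrite mE; apply: box_eqP.
Qed.

Lemma blocked_before T i j : std T -> blocked (T i) (T j) -> (i < j)%N ->
  before (T i) (T j).
Proof.
move=> sT /andP[/eqP dE rc] ij; rewrite /before dE eqxx /=.
case/orP: rc => /eqP E; rewrite E eqxx /= ?orbT.
  case: (ltngtP (bcol (T i)) (bcol (T j))) => //= c.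
    suff : (j < i)%N by rewrite ltnNge ltnW.
    by apply: (std_before sT); rewrite /before dE E !eqxx c.
  by move: ij; rewrite (std_inj sT (box_eqP dE E c)) ltnn.
case: (ltngtP (brow (T i)) (brow (T j))) => //= c; rewrite ?orbT //.
  suff : (j < i)%N by rewrite ltnNge ltnW.
  by apply: (std_before sT); rewrite /before dE E !eqxx c orbT.
by move: ij; rewrite (std_inj sT (box_eqP dE c E)) ltnn.
Qed.

(* a blocked pair cannot be inverted *)
Lemma nonstd_inv T U i j i' j' : std T -> blocked (T i) (T j) -> (i < j)%N ->
  U i' = T i -> U j' = T j -> (j' < i')%N -> ~~ std U.
Proof.
move=> sT bl ij Ui Uj ji; apply/negP => sU.
have := blocked_before sT bl ij; rewrite -Ui -Uj => /(std_before sU).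
by rewrite ltnNge ltnW.
Qed.

Lemma swap_tableau T i j : is_tableau l T -> is_tableau l (swap_entries T i j).
Proof.
case/andP => /injectiveP Tinj /forallP Tsh; apply/andP; split.
  apply/injectiveP => k m; rewrite !ffunE => /Tinj; exact: perm_inj.
apply/forallP => b; rewrite (eqP (Tsh b)); apply/eqP.
apply/codomP/codomP => [[k ->]|[k ->]].
  by exists (tperm i j k); rewrite ffunE tpermK.
by exists (tperm i j k); rewrite ffunE.
Qed.

Lemma std_swap T j i : std T -> i = j.+1 :> nat ->
  std (swap_entries T j i) = ~~ blocked (T j) (T i).
Proof.
move=> sT ij; case bl: (blocked _ _) => /=.
  apply/negbTE; apply: (@nonstd_inv T _ j i i j sT bl); rewrite ?ij ?ffunE //.
  - by rewrite tpermR.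
  - by rewrite tpermL.
rewrite /std swap_tableau /=; last by case/andP: sT.
apply/forallP => k; apply/forallP => m; apply/implyP; rewrite !ffunE.
rewrite -/(before _ _) => bf; have := std_before sT bf.
move: bf; case: tpermP => [kj|ki|kj ki]; case: tpermP => [mj|mi|mj mi];
  rewrite ?kj ?ki ?mj ?mi ?ltnn //; try lia.
- move=> bf; suff : blocked (T j) (T i) by rewrite bl.
  case/andP: bf => /eqP d rc; rewrite /blocked d eqxx /=.
  by case/orP: rc => /andP[/eqP-> _]; rewrite eqxx ?orbT.
- by move=> _; move/eqP: mi; rewrite -val_eqE /=; lia.
- by move=> _; move/eqP: kj; rewrite -val_eqE /=; lia.
Qed.

Lemma std_row T j i : std T -> i = j.+1 :> nat -> same_row T j i ->
  bcol (T i) = (bcol (T j)).+1.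
Proof.
move=> sT ij /andP[/eqP dE /eqP rE].
have /blocked_before : blocked (T j) (T i) by rewrite /blocked dE rE !eqxx.
case/(_ sT _)/andP; rewrite ?ij // => _; rewrite rE ltnn andbF orbF.
case/andP => _ lt; apply/eqP; rewrite eqn_leq lt andbT leqNgt.
apply/negP => lt2.
have cn : ((bcol (T j)).+1 < n)%N by apply: ltn_trans lt2 (ltn_ord _).
pose b : box n := (bdiag (T i), (T i).1.2, Ordinal cn).
have [m mE] : exists m, T m = b.
  apply: std_surj => //; apply: shape_le (std_shape i sT) => //; exact: ltnW.
have jm : (j < m)%N.
  by apply: (std_before sT); rewrite mE; apply: before_row.
have mi : (m < i)%N.
  by apply: (std_before sT); rewrite mE; apply: before_row.
lia.
Qed.

Lemma std_col T j i : std T -> i = j.+1 :> nat -> same_col T j i ->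
  brow (T i) = (brow (T j)).+1.
Proof.
move=> sT ij /andP[/eqP dE /eqP rE].
have /blocked_before : blocked (T j) (T i) by rewrite /blocked dE rE !eqxx orbT.
case/(_ sT _)/andP; rewrite ?ij // => _; rewrite rE ltnn andbF /=.
case/andP => _ lt; apply/eqP; rewrite eqn_leq lt andbT leqNgt.
apply/negP => lt2.
have cn : ((brow (T j)).+1 < n)%N by apply: ltn_trans lt2 (ltn_ord _).
pose b : box n := (bdiag (T i), Ordinal cn, (T i).2).
have [m mE] : exists m, T m = b.
  apply: std_surj => //; apply: shape_le (std_shape i sT) => //; exact: ltnW.
have jm : (j < m)%N.
  by apply: (std_before sT); rewrite mE; apply: before_col.
have mi : (m < i)%N.
  by apply: (std_before sT); rewrite mE; apply: before_col.
lia.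
Qed.

Definition content T i : int := (bcol (T i))%:Z - (brow (T i))%:Z.

Lemma std_content T j i : std T -> i = j.+1 :> nat ->
  bdiag (T i) = bdiag (T j) -> content T i != content T j.
Proof.
move=> sT ij dE; apply/eqP; rewrite /content => E.
case: (leqP (brow (T i)) (brow (T j))) => r.
  have : (i <= j)%N by apply: (std_mono sT) => //; lia.
  by rewrite ij ltnn.
pose b : box n := (bdiag (T i), (T j).1.2, (T i).2).
have cE : (bcol (T j) < bcol (T i))%N by lia.
have [m mE] : exists m, T m = b.
  apply: std_surj => //; apply: shape_le (std_shape i sT) => //; exact: ltnW.
have jm : (j < m)%N.
  by apply: (std_before sT); rewrite mE; apply: before_row.
have mi : (m < i)%N.
  by apply: (std_before sT); rewrite mE; apply: before_col.
lia.
Qed.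

(* three consecutive entries cannot form a hook *)
Lemma std_hook T k j i : std T -> j = k.+1 :> nat -> i = j.+1 :> nat ->
  bdiag (T i) = bdiag (T k) -> brow (T i) = (brow (T k)).+1 ->
  bcol (T i) = (bcol (T k)).+1 -> False.
Proof.
move=> sT jk ij dE rE cE.
pose b : box n := (bdiag (T i), (T k).1.2, (T i).2).
pose c : box n := (bdiag (T i), (T i).1.2, (T k).2).
have [m mE] : exists m, T m = b.
  apply: std_surj => //; apply: shape_le (std_shape i sT) => //; by rewrite rE leqnSn.
have [p pE] : exists m, T m = c.
  apply: std_surj => //; apply: shape_le (std_shape i sT) => //; by rewrite cE leqnSn.
have rlt : (brow (T k) < brow (T i))%N by rewrite rE.
have clt : (bcol (T k) < bcol (T i))%N by rewrite cE.
have km : (k < m)%N.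
  by apply: (std_before sT); rewrite mE; apply: before_row; first exact: esym.
have mi : (m < i)%N.
  by apply: (std_before sT); rewrite mE; apply: before_col.
have kp : (k < p)%N.
  by apply: (std_before sT); rewrite pE; apply: before_col; first exact: esym.
have pi : (p < i)%N.
  by apply: (std_before sT); rewrite pE; apply: before_row.
have pm : p = m by apply: val_inj => /=; lia.
move: mE; rewrite -pm pE => /(congr1 (@bcol n)).
by rewrite -[bcol c]/(bcol (T k)) -[bcol b]/(bcol (T i)) cE; lia.
Qed.
End TableauTheory.

Section Coefficients.
Variables (K : fieldType) (q : K) (I : finType).
Local Notation W := {ffun I -> K^o}.
Variables (f g : {linear W -> W}).

Definition diag_coef (xi xj : K) : K := (q - 1) * xi / (xi - xj).
Definition off_coef (xi xj : K) : K := (q * xi - xj) / (xi - xj).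

Lemma coef_comm (u0 u1 u2 u3 : W) a b c d :
    f u0 = a *: u0 + b *: u1 -> g u0 = c *: u0 + d *: u2 ->
    g u1 = c *: u1 + d *: u3 -> f u2 = a *: u2 + b *: u3 ->
  f (g u0) = g (f u0).
Proof.
move=> f0 g0 g1 f2; rewrite f0 g0 !linearD !linearZ /= f0 f2 g0 g1.
by rewrite !scalerDr !scalerA [RHS]addrACA ![_ * c]mulrC ![_ * d]mulrC.
Qed.

Lemma coef_quad (u v : W) xi xj :
    f u = diag_coef xi xj *: u + off_coef xi xj *: v ->
    xi != xj /\ f v = diag_coef xj xi *: v + off_coef xj xi *: u \/
    v = 0 /\ (xi = q * xj \/ xj = q * xi) -> xi != xj ->
  f (f u) = (q - 1) *: f u + q *: u.
Proof.
rewrite -subr_eq0 => fu fv D0.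
have D1 : xj - xi != 0 by rewrite -opprB oppr_eq0.
rewrite fu linearD !linearZ /= fu.
case: fv => [[_ ->]|[-> H]].
  apply/ffunP => t; rewrite !ffunE /GRing.scale /= /diag_coef /off_coef; field.
  by rewrite D0 D1.
rewrite ?(linear0, scaler0, addr0); apply/ffunP => t.
rewrite !ffunE /GRing.scale /= /diag_coef.
by case: H => xE; move: D0 D1; rewrite xE => D0 D1; field.
Qed.

Lemma coef_braid4 (u0 u1 : W) s s' a b a' b' :
    f u0 = s *: u0 -> g u0 = a *: u0 + b *: u1 ->
    u1 = 0 \/ [/\ f u1 = s' *: u1, g u1 = a' *: u1 + b' *: u0
                & s' = s \/ s' = - s /\ a' = a] ->
  f (g (f (g u0))) = g (f (g (f u0))).
Proof.
move=> f0 g0 [z|[f1 g1 H]].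
  rewrite z scaler0 addr0 in g0.
  do 4![rewrite ?g0 ?f0 ?linearZ /=].
  by rewrite !scalerA; congr (_ *: _); ring.
rewrite f0 g0 !(linearD, linearZ) /= f0 f1 g0 !(linearD, linearZ) /= f0 f1 g0 g1.
rewrite !(linearD, linearZ) /= f0 f1 g0 g1.
apply/ffunP => t; rewrite !ffunE /GRing.scale /=.
by case: H => [->|[-> ->]]; ring.
Qed.

Lemma coef_braid3 (u0 u1 u2 u12 u21 u3 : W) x1 x2 x3 :
    q != 0 -> q - 1 != 0 -> x1 != 0 -> x2 != 0 -> x3 != 0 ->
    x2 != x1 -> x3 != x2 ->
    f u0 = diag_coef x2 x1 *: u0 + off_coef x2 x1 *: u1 ->
    g u0 = diag_coef x3 x2 *: u0 + off_coef x3 x2 *: u2 ->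
    g u1 = diag_coef x3 x1 *: u1 + off_coef x3 x1 *: u12 ->
    f u2 = diag_coef x3 x1 *: u2 + off_coef x3 x1 *: u21 ->
    f u12 = diag_coef x3 x2 *: u12 + off_coef x3 x2 *: u3 ->
    g u21 = diag_coef x2 x1 *: u21 + off_coef x2 x1 *: u3 ->
    [/\ x3 != x1 & f u1 = diag_coef x1 x2 *: u1 + off_coef x1 x2 *: u0] \/
      u1 = 0 /\ (x2 = q * x1 \/ x1 = q * x2) ->
    [/\ x3 != x1 & g u2 = diag_coef x2 x3 *: u2 + off_coef x2 x3 *: u0] \/
      u2 = 0 /\ (x3 = q * x2 \/ x2 = q * x3) ->
    (u1 = 0 -> u2 = 0 ->
      x2 = q * x1 /\ x3 = q * x2 \/ x1 = q * x2 /\ x2 = q * x3) ->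
  f (g (f u0)) = g (f (g u0)).
Proof.
move=> q0 q1 x10 x20 x30 D21 D32; rewrite -subr_eq0 in D21; rewrite -subr_eq0 in D32.
have D12 : x1 - x2 != 0 by rewrite -opprB oppr_eq0.
have D23 : x2 - x3 != 0 by rewrite -opprB oppr_eq0.
move=> f0 g0 g1 f2 f12 g21 H1 H2 H3.
rewrite f0 g0 !(linearD, linearZ) /= f0 g0 g1 f2.
rewrite !(linearD, linearZ) /= f0 g0 f12 g21 f2 g1.
case: H1 => [[D31 f1]|[z1 E1]]; case: H2 => [[D31' g2]|[z2 E2]];
  try (rewrite -subr_eq0 in D31); try (rewrite -subr_eq0 in D31').
- rewrite f1 g2; apply/ffunP => t; rewrite !ffunE /GRing.scale /= /diag_coef /off_coef; field.
  by rewrite D31 D21 D12 D32 D23.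
- rewrite f1 z2; apply/ffunP => t; rewrite ?linear0 !ffunE /GRing.scale /= /diag_coef /off_coef.
  by case: E2 => E; rewrite E in D31 D21 D12 D32 D23 *; field; rewrite ?D31 ?D21 ?D12 ?D32 ?D23.
- rewrite g2 z1; apply/ffunP => t; rewrite ?linear0 !ffunE /GRing.scale /= /diag_coef /off_coef.
  by case: E1 => E; rewrite E in D31' D21 D12 D32 D23 * ; field; rewrite ?D31' ?D21 ?D12 ?D32 ?D23.
case: (H3 z1 z2) => [[E E']|[E E']]; rewrite z1 z2 ?(linear0, scaler0, addr0);
  apply/ffunP => t; rewrite !ffunE /GRing.scale /=.
- have -> : diag_coef x2 x1 = diag_coef x3 x2.
    rewrite /diag_coef E' E in D21 D32 *; field; by rewrite D21 D32.
  ring.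
- have -> : diag_coef x2 x1 = diag_coef x3 x2.
    rewrite /diag_coef E E' in D21 D32 *; field; by rewrite D21 D32.
  ring.
Qed.
End Coefficients.

Section SeminormalRelations.
Variables (K : fieldType) (q : K) (n : nat) (l : bipart n).
Hypothesis q_neq0 : q != 0.
Hypothesis q_exp1 : forall k : int, k != 0 -> q ^ k != 1.
Hypothesis q_expN1 : forall k : int, q ^ k != -1.
Implicit Types (T U : filling n) (i j k : 'I_n).
Local Notation V := (seminormal_space K l).
Local Notation vv := (@basis_vec K n l).
Local Notation gen := (@seminormal_gen K q n l).
Local Notation act := (@seminormal_basis_act K q n l).

Lemma basis_vec_nonstd T : ~~ std l T -> vv T = 0.
Proof.
move=> nT; apply/ffunP => t; rewrite !ffunE; case: eqP => // E.
by case/negP: nT; rewrite -E; apply: (valP t).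
Qed.

Lemma seminormal_expand (f : V) : f = \sum_(t : stab l) (f t : K) *: vv (val t).
Proof.
apply/ffunP => t; rewrite sum_ffunE (bigD1 t) //= !ffunE eqxx /GRing.scale /= mulr1.
rewrite big1 ?addr0 // => u /negbTE ut; rewrite !ffunE /GRing.scale /=.
by rewrite val_eqE eq_sym ut mulr0.
Qed.

Fact seminormal_gen_linear i :
  linear (fun f : V => \sum_(t : stab l) (f t : K) *: act i (val t)).
Proof.
move=> c f g; rewrite scaler_sumr -big_split /=; apply: eq_bigr => t _.
by rewrite !ffunE scalerDl scalerA.
Qed.

Lemma seminormal_genE i (f : V) :
  gen i f = \sum_(t : stab l) (f t : K) *: act i (val t).
Proof.
pose L := HB.pack (fun f : V => \sum_(t : stab l) (f t : K) *: act i (val t))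
  (GRing.isLinear.Build K V V _ _ (seminormal_gen_linear i)) : {linear V -> V}.
exact: (lfunE L).
Qed.

Lemma gen_basis_vec i T : std l T -> gen i (vv T) = act i T.
Proof.
move=> sT; rewrite seminormal_genE.
rewrite (bigD1 (exist (fun U => is_tableau l U && is_standard U) T sT)) //=.
rewrite ffunE eqxx scale1r big1 ?addr0 // => u /negbTE ut.
by rewrite ffunE -[val u == T]/(u == exist _ T sT) ut scale0r.
Qed.

Lemma seminormal_endP (f g : 'End(V)) :
  (forall T, std l T -> f (vv T) = g (vv T)) -> f = g.
Proof.
move=> fg; apply/lfunP => v; rewrite (seminormal_expand v) !linear_sum.
by apply: eq_bigr => t _; rewrite !linearZ /= fg //; apply: (valP t).
Qed.

Definition tab_val T i : K := usign K (bdiag (T i)) * q ^ content T i.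

Lemma usign_neq0 d : usign K d != 0.
Proof. by case: d; rewrite /usign ?oppr_eq0 oner_eq0. Qed.

Lemma xval_neq0 T i : tab_val T i != 0.
Proof. by rewrite mulf_neq0 ?usign_neq0 // expfz_neq0. Qed.

Lemma xval_row T i j : std l T -> i = j.+1 :> nat -> same_row T j i ->
  tab_val T i = q * tab_val T j.
Proof.
move=> sT ij rw; have cE := std_row sT ij rw; case/andP: rw => /eqP dE /eqP rE.
rewrite /tab_val -dE mulrCA; congr (_ * _); rewrite -{2}[q]expr1z -expfzDr //.
by congr (q ^ _); rewrite /content cE rE; lia.
Qed.

Lemma xval_col T i j : std l T -> i = j.+1 :> nat -> same_col T j i ->
  tab_val T j = q * tab_val T i.
Proof.
move=> sT ij rw; have cE := std_col sT ij rw; case/andP: rw => /eqP dE /eqP rE.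
rewrite /tab_val -dE mulrCA; congr (_ * _); rewrite -{2}[q]expr1z -expfzDr //.
by congr (q ^ _); rewrite /content cE rE; lia.
Qed.

Lemma xval_eq T i j : std l T -> i = j.+1 :> nat -> tab_val T i != tab_val T j.
Proof.
move=> sT ij.
have qc : tab_val T i = tab_val T j -> usign K (bdiag (T i)) =
    usign K (bdiag (T j)) * q ^ (content T j - content T i).
  rewrite /tab_val expfzDr // -invr_expz mulrA => <-.
  by rewrite mulfK // expfz_neq0.
apply/eqP => /qc; case: (bdiag (T i) =P bdiag (T j)) => [dE|].
  move: (std_content sT ij dE) => cn; rewrite dE -[LHS]mulr1.
  move/(mulfI (usign_neq0 _)) => /esym/eqP; apply/negP/q_exp1.
  by rewrite subr_eq0 eq_sym.
have [N1 N2] := (q_expN1 (content T j - content T i), q_expN1 0).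
case: (bdiag (T i)); case: (bdiag (T j)) => // _; rewrite /usign.
  by rewrite mul1r => E; move: N1; rewrite -E eqxx.
by rewrite mulN1r => E; move: N1; rewrite -[q ^ _]opprK -E eqxx.
Qed.

Local Notation coefA := (diag_coef q).
Local Notation coefB := (off_coef q).
Local Notation sw := swap_entries.

Lemma Mmx_coef T i j : let M := Mmx q (axial_dist T i j)
      (usign K (bdiag (T j)) / usign K (bdiag (T i))) in
    tab_val T i != tab_val T j ->
  [/\ M 0 0 = coefA (tab_val T i) (tab_val T j), M 1 0 = coefB (tab_val T i) (tab_val T j),
      M 0 1 = coefB (tab_val T j) (tab_val T i) & M 1 1 = coefA (tab_val T j) (tab_val T i)].
Proof.
set u := _ / _; set d := axial_dist T i j => M xij.
have zE : q ^ d * u = tab_val T j / tab_val T i.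
  rewrite /d /axial_dist -/(content T j) -/(content T i) expfzDr // -invr_expz.
  rewrite /u /tab_val; move: (usign_neq0 (bdiag (T i))) (usign_neq0 (bdiag (T j))).
  move: (expfz_neq0 (content T i) q_neq0) => c0 ui uj; field.
  by rewrite c0 ui.
have zE1 : q ^ (d + 1) * u = q * (tab_val T j / tab_val T i).
  by rewrite expfzDr // expr1z -zE; ring.
have zEN : q ^ (d - 1) * u = q^-1 * (tab_val T j / tab_val T i).
  by rewrite expfzDr // -invr_expz expr1z -zE; ring.
have xi0 := xval_neq0 T i.
have D0 : tab_val T i - tab_val T j != 0 by rewrite subr_eq0.
have D1 : tab_val T j - tab_val T i != 0 by rewrite subr_eq0 eq_sym.
by split; rewrite /M /Mmx !mxE /= ?zE ?zE1 ?zEN /diag_coef /off_coef; field;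
  rewrite ?D0 ?D1 ?xi0 ?q_neq0.
Qed.

Lemma seminormal_act_std T i j : std l T -> i = j.+1 :> nat ->
  act i T = coefA (tab_val T i) (tab_val T j) *: vv T
          + coefB (tab_val T i) (tab_val T j) *: vv (sw T j i).
Proof.
move=> sT ij; have xij := xval_eq sT ij.
have jE : pred_entry i = j by apply: val_inj; rewrite /= ij.
rewrite /seminormal_basis_act jE [X in (X == _)%N]ij /=.
have q1 : q - 1 != 0 by rewrite subr_eq0 -[q]expr1z q_exp1.
have D0 : tab_val T i - tab_val T j != 0 by rewrite subr_eq0.
case: ifP => [rw|nrw].
  rewrite (_ : vv (sw T j i) = 0) ?scaler0 ?addr0; last first.
    apply: basis_vec_nonstd; rewrite std_swap // negbK.
    by case/andP: rw => d r; rewrite /blocked d r.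
  congr (_ *: _); move: D0; rewrite /diag_coef (xval_row sT ij rw) => D0.
  field; exact: D0.
case: ifP => [cl|ncl].
  rewrite (_ : vv (sw T j i) = 0) ?scaler0 ?addr0; last first.
    apply: basis_vec_nonstd; rewrite std_swap // negbK.
    by case/andP: cl => d r; rewrite /blocked d r orbT.
  rewrite -scaleN1r; congr (_ *: _); move: D0; rewrite /diag_coef (xval_col sT ij cl) => D0.
  field; exact: D0.
by have [-> -> _ _] := Mmx_coef xij.
Qed.

Lemma xval_swap T i j k : tab_val (sw T i j) k = tab_val T (tperm i j k).
Proof. by rewrite /tab_val /content ffunE. Qed.

Lemma sw_sw T i j : sw (sw T i j) i j = T.
Proof. by apply/ffunP => k; rewrite !ffunE tpermK. Qed.

(* the two alternatives for a pair of consecutive entries of a standard tableau *)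
Lemma std_pair T i j : std l T -> i = j.+1 :> nat ->
  std l (sw T j i) \/
  [/\ blocked (T j) (T i), vv (sw T j i) = 0 &
     same_row T j i /\ tab_val T i = q * tab_val T j \/
     same_col T j i /\ tab_val T j = q * tab_val T i].
Proof.
move=> sT ij; case bl: (blocked (T j) (T i)); last by left; rewrite std_swap // bl.
right; split=> //; first by apply: basis_vec_nonstd; rewrite std_swap // bl.
case/andP: (bl) => d /orP[r|c]; [left|right].
  have rw : same_row T j i by rewrite /same_row d.
  by split=> //; exact: xval_row.
have cl : same_col T j i by rewrite /same_col d.
by split=> //; exact: xval_col.
Qed.

Lemma gen_step T i j : std l T -> i = j.+1 :> nat ->
  gen i (vv T) = coefA (tab_val T i) (tab_val T j) *: vv T
               + coefB (tab_val T i) (tab_val T j) *: vv (sw T j i).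
Proof. by move=> sT ij; rewrite gen_basis_vec // (seminormal_act_std sT ij). Qed.

Lemma gen_step0 T i : std l T -> i = 0%N :> nat ->
  gen i (vv T) = usign K (bdiag (T i)) *: vv T.
Proof. by move=> sT i0; rewrite gen_basis_vec // /seminormal_basis_act i0 eqxx. Qed.

End SeminormalRelations.

Section SeminormalRelations2.
Variables (K : fieldType) (q : K) (n : nat) (l : bipart n).
Hypothesis q_neq0 : q != 0.
Hypothesis q_exp1 : forall k : int, k != 0 -> q ^ k != 1.
Hypothesis q_expN1 : forall k : int, q ^ k != -1.
Implicit Types (T U : filling n) (i j k : 'I_n).
Local Notation W := {ffun stab l -> K^o}.
Local Notation vv T := (@basis_vec K n l T : W).
Local Notation coefA := (diag_coef q).
Local Notation coefB := (off_coef q).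
Local Notation xval := (@tab_val K q n).
Local Notation sw := swap_entries.
Variable gen : 'I_n -> {linear W -> W}.
Hypothesis gen_step : forall T i j, std l T -> i = j.+1 :> nat ->
  gen i (vv T) = coefA (xval T i) (xval T j) *: vv T
               + coefB (xval T i) (xval T j) *: vv (sw T j i).
Hypothesis gen_step0 : forall T i, std l T -> i = 0%N :> nat ->
  gen i (vv T) = usign K (bdiag (T i)) *: vv T.
Let std_pair' := @std_pair K q n l q_neq0.
Let xval_eq' := @xval_eq K q n l q_neq0 q_exp1 q_expN1.

Lemma gen_quad T i : std l T -> (0 < i)%N ->
  gen i (gen i (vv T)) = (q - 1) *: gen i (vv T) + q *: vv T.
Proof.
move=> sT i0; have ij : i = (pred_entry i).+1 :> nat by rewrite /= prednK.
move: (pred_entry i) ij => j ij.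
apply: (coef_quad (gen_step sT ij)); last exact: xval_eq'.
case: (std_pair' sT ij) => [sS|[_ v0 H]]; [left | right].
  have := gen_step sS ij; rewrite sw_sw !xval_swap tpermL tpermR => E2.
  by split=> //; exact: xval_eq'.
by split=> //; case: H => [[_ ?]|[_ ?]]; [left | right].
Qed.

Lemma gen_sq T i : std l T -> i = 0%N :> nat -> gen i (gen i (vv T)) = vv T.
Proof.
move=> sT i0; rewrite !(gen_step0 sT) // linearZ /= (gen_step0 sT) //.
by rewrite scalerA; case: (bdiag _); rewrite /usign ?mulrNN mulr1 scale1r.
Qed.

Lemma gen_comm_lt T i j : std l T -> (i.+1 < j)%N ->
  gen i (gen j (vv T)) = gen j (gen i (vv T)).
Proof.
move=> sT ij; have jj : j = (pred_entry j).+1 :> nat by rewrite /= prednK //; lia.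
move: (pred_entry j) jj => j' jj.
have Ej := gen_step sT jj.
case: (posnP i) => [i0|i0].
  have Ei := gen_step0 sT i0.
  have tE : tperm j' j i = i by rewrite tpermD // -val_eqE /=; lia.
  have Ei' : gen i (vv (sw T j' j)) = usign K (bdiag (T i)) *: vv (sw T j' j).
    case: (std_pair' sT jj) => [sS|[_ -> _]]; last by rewrite linear0 scaler0.
    by rewrite (gen_step0 sS i0) ffunE tE.
  have H := @coef_comm _ _ (gen i) (gen j) (vv T) 0 (vv (sw T j' j)) 0 (usign K (bdiag (T i))) 0 _ _ _ Ej.
  apply: H.
  - by rewrite scaler0 addr0.
  - by rewrite linear0 !scaler0 addr0.
  - by rewrite scaler0 addr0.
have ii : i = (pred_entry i).+1 :> nat by rewrite /= prednK.
move: (pred_entry i) ii => i' ii; have Ei := gen_step sT ii.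
have tj k : (k < i')%N || (i < k)%N -> tperm i' i k = k.
  by move=> kk; rewrite tpermD // -val_eqE /=; lia.
have ti k : (k < j')%N || (j < k)%N -> tperm j' j k = k.
  by move=> kk; rewrite tpermD // -val_eqE /=; lia.
have swC : sw (sw T j' j) i' i = sw (sw T i' i) j' j.
  apply/ffunP => k; rewrite !ffunE; congr (T _).
  case: (ltnP k j') => kj.
    rewrite (ti k) ?kj // ti //; case: tpermP => [_|_|_ _]; lia.
  rewrite (tj k); last by lia.
  by rewrite tj //; case: tpermP => [_|_|_ _]; lia.
have Ei' : gen i (vv (sw T j' j)) =
    coefA (xval T i) (xval T i') *: vv (sw T j' j) +
    coefB (xval T i) (xval T i') *: vv (sw (sw T j' j) i' i).
  case: (std_pair' sT jj) => [sS|[bl z _]].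
    by rewrite (gen_step sS ii) !xval_swap !ti //; lia.
  rewrite z linear0 scaler0 add0r.
  rewrite (@basis_vec_nonstd K n l _ (nonstd_inv (T := T) (i := j') (j := j) (i' := j) (j' := j') sT bl _ _ _ _)) ?scaler0 //.
  - by rewrite jj.
  - by rewrite !ffunE tj ?tpermR //; lia.
  - by rewrite !ffunE tj ?tpermL //; lia.
  - by rewrite jj.
have Ej' : gen j (vv (sw T i' i)) =
    coefA (xval T j) (xval T j') *: vv (sw T i' i) +
    coefB (xval T j) (xval T j') *: vv (sw (sw T i' i) j' j).
  case: (std_pair' sT ii) => [sS|[bl z _]].
    by rewrite (gen_step sS jj) !xval_swap !tj //; lia.
  rewrite z linear0 scaler0 add0r.
  rewrite (@basis_vec_nonstd K n l _ (nonstd_inv (T := T) (i := i') (j := i) (i' := i) (j' := i') sT bl _ _ _ _)) ?scaler0 //.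
  - by rewrite ii.
  - by rewrite !ffunE ti ?tpermR //; lia.
  - by rewrite !ffunE ti ?tpermL //; lia.
  - by rewrite ii.
rewrite swC in Ei'.
exact: (coef_comm Ei Ej Ej' Ei').
Qed.

Lemma gen_comm T i j : std l T -> (i.+1 < j)%N || (j.+1 < i)%N ->
  gen i (gen j (vv T)) = gen j (gen i (vv T)).
Proof. by move=> sT /orP[|] ij; [|symmetry]; exact: gen_comm_lt. Qed.

Lemma gen_braid4 T i j : std l T -> i = 0%N :> nat -> j = 1%N :> nat ->
  gen i (gen j (gen i (gen j (vv T)))) = gen j (gen i (gen j (gen i (vv T)))).
Proof.
move=> sT i0 j1; have ji : j = i.+1 :> nat by rewrite i0.
apply: (coef_braid4 (gen_step0 sT i0) (gen_step sT ji)).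
case: (std_pair' sT ji) => [sS|[]]; [right | by left].
have := gen_step sS ji; rewrite sw_sw !xval_swap tpermL tpermR => E.
have E0 := gen_step0 sS i0; rewrite ffunE tpermL in E0.
split; [exact: E0 | exact: E |].
case dE : (bdiag (T j) == bdiag (T i)); first by left; rewrite (eqP dE).
have corner (k m : 'I_n) : (k <= 1)%N -> bdiag (T k) != bdiag (T m) -> (m <= 1)%N ->
    brow (T k) = 0%N /\ bcol (T k) = 0%N.
  move=> k1 dN m1.
  pose o : 'I_n := i.
  pose b : box n := (bdiag (T k), o, o).
  have [p pE] : exists p, T p = b.
    by apply: (std_surj sT); apply: shape_le (std_shape k sT); rewrite // /brow /bcol /= i0.
  have pk : (p <= k)%N by apply: (std_mono sT); rewrite pE // /brow /bcol /= i0.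
  have pm : p != m by apply: contraNneq dN => <-; rewrite pE.
  have pkE : p = k.
    have km : k != m by apply: contraNneq dN => ->.
    by apply: val_inj => /=; move: pm km pk k1 m1; rewrite -!val_eqE /=; lia.
  by rewrite -pkE pE /brow /bcol /= i0.
have xE k m : (k <= 1)%N -> bdiag (T k) != bdiag (T m) -> (m <= 1)%N ->
    xval T k = usign K (bdiag (T k)).
  move=> k1 dN m1; rewrite /tab_val /content.
  by have [-> ->] := corner k m k1 dN m1; rewrite subr0 expr0z mulr1.
have xi : xval T i = usign K (bdiag (T i)).
  by apply: (xE i j); rewrite ?i0 ?j1 // eq_sym dE.
have xj : xval T j = usign K (bdiag (T j)).
  by apply: (xE j i); rewrite ?i0 ?j1 // dE.
right; have NE : usign K (bdiag (T j)) = - usign K (bdiag (T i)).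
  by move: dE; case: (bdiag (T j)); case: (bdiag (T i)) => //= _; rewrite /usign ?opprK.
have := xval_eq' sT ji; rewrite xi xj NE; move: (usign K _) => u ne; split=> //.
rewrite /diag_coef.
have D1 : - u - u != 0 by rewrite subr_eq0.
have D2 : u - - u != 0 by rewrite subr_eq0 eq_sym.
by field; rewrite D1 D2.
Qed.

Lemma gen_braid3 T i j : std l T -> (0 < i)%N -> j = i.+1 :> nat ->
  gen i (gen j (gen i (vv T))) = gen j (gen i (gen j (vv T))).
Proof.
move=> sT i0 ji; have ik : i = (pred_entry i).+1 :> nat by rewrite /= prednK.
move: (pred_entry i) ik => k ik.
have kNj : k != j by rewrite -val_eqE /= ji ik; lia.
have kNi : k != i by rewrite -val_eqE /= ik; lia.
have iNj : i != j by rewrite -val_eqE /= ji; lia.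
have E12 : tperm k i j = j by rewrite tpermD // eq_sym.
have E23 : tperm i j k = k by rewrite tpermD // eq_sym.
have sC : sw (sw (sw T k i) i j) k i = sw (sw (sw T i j) k i) i j.
  apply/ffunP => m; rewrite !ffunE; congr (T _).
  case: (eqVneq m k) => [->|mk]; first by rewrite E23 !tpermL E12.
  case: (eqVneq m i) => [->|mi]; first by rewrite [tperm k i i]tpermR E23 [tperm k i k]tpermL [tperm i j i]tpermL E12 tpermR.
  case: (eqVneq m j) => [->|mj]; first by rewrite E12 !tpermR E23.
  have H1 : tperm k i m = m by rewrite tpermD // eq_sym.
  have H2 : tperm i j m = m by rewrite tpermD // eq_sym.
  by rewrite !(H1, H2).
have q1 : q - 1 != 0 by rewrite subr_eq0 -[q]expr1z q_exp1.
have x0 := @xval_neq0 K q n q_neq0 T.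
have S1 U := xval_swap q U k i; have S2 U := xval_swap q U i j.
have ne1 := xval_eq' sT ik; have ne2 := xval_eq' sT ji.
have E1 := gen_step sT ik; have E2 := gen_step sT ji.
have P1 := std_pair' sT ik; have P2 := std_pair' sT ji.
have inv12 U i' j' : blocked (T k) (T i) -> U i' = T k -> U j' = T i ->
    (j' < i')%N -> vv U = 0.
  move=> bl Ui Uj ji'; apply: basis_vec_nonstd.
  by apply: (nonstd_inv sT bl _ Ui Uj ji'); rewrite ik.
have inv23 U i' j' : blocked (T i) (T j) -> U i' = T i -> U j' = T j ->
    (j' < i')%N -> vv U = 0.
  move=> bl Ui Uj ji'; apply: basis_vec_nonstd.
  by apply: (nonstd_inv sT bl _ Ui Uj ji'); rewrite ji.
have lt1 : (k < i)%N by rewrite ik.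
have lt2 : (i < j)%N by rewrite ji.
have lt3 : (k < j)%N by apply: ltn_trans lt1 lt2.
have inv13 U i' j' : blocked (T k) (T j) -> U i' = T k -> U j' = T j ->
    (j' < i')%N -> vv U = 0.
  move=> bl Ui Uj ji'; apply: basis_vec_nonstd.
  exact: (nonstd_inv sT bl _ Ui Uj ji').
have stdstep U (a b : 'I_n) : b = a.+1 :> nat ->
    vv U = 0 /\ vv (sw U a b) = 0 \/ std l U ->
    gen b (vv U) = coefA (xval U b) (xval U a) *: vv U +
                   coefB (xval U b) (xval U a) *: vv (sw U a b).
  move=> ab [[-> ->]|sU]; last exact: gen_step.
  by rewrite linear0 !scaler0 addr0.
pose T1 := sw T k i; pose T2 := sw T i j.
pose T12 := sw T1 i j; pose T21 := sw T2 k i; pose T3 := sw T12 k i.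
have [T1k T1i T1j] : [/\ T1 k = T i, T1 i = T k & T1 j = T j].
  by rewrite !ffunE tpermL tpermR E12.
have [T2k T2i T2j] : [/\ T2 k = T k, T2 i = T j & T2 j = T i].
  by rewrite !ffunE tpermL tpermR E23.
have [T12k T12i T12j] : [/\ T12 k = T i, T12 i = T j & T12 j = T k].
  by rewrite /T12 ![sw T1 _ _ _]ffunE tpermL tpermR E23.
have [T21k T21i T21j] : [/\ T21 k = T j, T21 i = T k & T21 j = T i].
  by rewrite /T21 ![sw T2 _ _ _]ffunE tpermL tpermR E12.
have [T3k T3i T3j] : [/\ T3 k = T j, T3 i = T i & T3 j = T k].
  by rewrite /T3 ![sw T12 _ _ _]ffunE tpermL tpermR E12.
have xv U a b : U a = T b -> xval U a = xval T b.
  by rewrite /tab_val /content => ->.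
have E3 : gen j (vv T1) = coefA (xval T j) (xval T k) *: vv T1 +
    coefB (xval T j) (xval T k) *: vv T12.
  rewrite (stdstep T1 i j ji) ?(xv _ _ _ T1i) ?(xv _ _ _ T1j) //.
  case: P1 => [sS|[bl z _]]; [by right | left; split=> //].
  exact: (inv12 _ _ _ bl T12j T12k).
have E4 : gen i (vv T2) = coefA (xval T j) (xval T k) *: vv T2 +
    coefB (xval T j) (xval T k) *: vv T21.
  rewrite (stdstep T2 k i ik) ?(xv _ _ _ T2i) ?(xv _ _ _ T2k) //.
  case: P2 => [sS|[bl z _]]; [by right | left; split=> //].
  exact: (inv23 _ _ _ bl T21j T21k).
have E5 : gen i (vv T12) = coefA (xval T j) (xval T i) *: vv T12 +
    coefB (xval T j) (xval T i) *: vv T3.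
  rewrite (stdstep T12 k i ik) ?(xv _ _ _ T12i) ?(xv _ _ _ T12k) //.
  case: P1 => [sS|[bl z _]]; last first.
    by left; split; [apply: (inv12 _ _ _ bl T12j T12k)|apply: (inv12 _ _ _ bl T3j T3i)].
  case: (std_pair' sS ji) => [|[bl z _]]; [by right | left; split=> //].
  rewrite -/T1 T1i T1j in bl; exact: (inv13 _ _ _ bl T3j T3k).
have E6 : gen j (vv T21) = coefA (xval T i) (xval T k) *: vv T21 +
    coefB (xval T i) (xval T k) *: vv T3.
  have -> : T3 = sw T21 i j by [].
  rewrite (stdstep T21 i j ji) ?(xv _ _ _ T21i) ?(xv _ _ _ T21j) //.
  rewrite -/T3 (_ : sw T21 i j = T3) //.
  case: P2 => [sS|[bl z _]]; last first.
    by left; split; [apply: (inv23 _ _ _ bl T21j T21k)|apply: (inv23 _ _ _ bl T3i T3k)].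
  case: (std_pair' sS ik) => [|[bl z _]]; [by right | left; split=> //].
  rewrite -/T2 T2i T2k in bl; exact: (inv13 _ _ _ bl T3j T3k).
have vneq0 U : std l U -> vv U = 0 -> False.
  move=> sU /ffunP/(_ (exist (fun U => is_tableau l U && is_standard U) U sU)).
  by rewrite !ffunE eqxx => /eqP; rewrite oner_eq0.
apply: (coef_braid3 q_neq0 q1 _ _ _ ne1 ne2 E1 E2 E3 E4 E5 E6); rewrite ?x0 //.
- case: P1 => [sS|[_ z H]]; [left | right]; last by split=> //; case: H => [[]|[]]; auto.
  split; first by have := xval_eq' sS ji; rewrite -/T1 (xv _ _ _ T1i) (xv _ _ _ T1j).
  by have := gen_step sS ik; rewrite sw_sw -/T1 (xv _ _ _ T1i) (xv _ _ _ T1k).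
- case: P2 => [sS|[_ z H]]; [left | right]; last by split=> //; case: H => [[]|[]]; auto.
  split; first by have := xval_eq' sS ik; rewrite -/T2 (xv _ _ _ T2i) (xv _ _ _ T2k).
  by have := gen_step sS ji; rewrite sw_sw -/T2 (xv _ _ _ T2i) (xv _ _ _ T2j).
move=> z1 z2; case: P1 => [/vneq0/(_ z1) //|[_ _ H1]].
case: P2 => [/vneq0/(_ z2) //|[_ _ H2]].
case: H1 => [[rw1 X1]|[cl1 X1]]; case: H2 => [[rw2 X2]|[cl2 X2]]; [by left| | |by right].
- case/andP: (rw1) => /eqP d1 /eqP r1; case/andP: (cl2) => /eqP d2 /eqP c2.
  exfalso; apply: (std_hook sT ik ji).
  + by rewrite -d2 -d1.
  + by rewrite (std_col sT ji cl2) r1.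
  + by rewrite -c2 (std_row sT ik rw1).
- case/andP: (cl1) => /eqP d1 /eqP c1; case/andP: (rw2) => /eqP d2 /eqP r2.
  exfalso; apply: (std_hook sT ik ji).
  + by rewrite -d2 -d1.
  + by rewrite -r2 (std_col sT ik cl1).
  + by rewrite (std_row sT ji rw2) c1.
Qed.
End SeminormalRelations2.

Section SeminormalEquations.
Variables (K : fieldType) (q : K) (n : nat) (l : bipart n).
Hypothesis q_neq0 : q != 0.
Hypothesis q_exp1 : forall k : int, k != 0 -> q ^ k != 1.
Hypothesis q_expN1 : forall k : int, q ^ k != -1.
Local Notation V := (seminormal_space K l).
Local Notation gen := (@seminormal_gen K q n l).

Lemma seminormal_gen_pair (T : filling n) (i : 'I_n) :
    std l T -> (0 < i)%N -> ~~ same_row T (pred_entry i) i -> ~~ same_col T (pred_entry i) i ->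
  let T' := swap_entries T (pred_entry i) i in
  let M := Mmx q (axial_dist T i (pred_entry i))
                 (usign K (bdiag (T (pred_entry i))) / usign K (bdiag (T i))) in
  gen i (basis_vec l T) = M 0 0 *: basis_vec l T + M 1 0 *: basis_vec l T' /\
  gen i (basis_vec l T') = M 0 1 *: basis_vec l T + M 1 1 *: basis_vec l T'.
Proof.
move=> sT i0 nr nc; have ij : i = (pred_entry i).+1 :> nat by rewrite /= prednK.
move: (pred_entry i) ij nr nc => j ij nr nc T' M.
have [-> -> -> ->] := Mmx_coef q_neq0 (xval_eq q_neq0 q_exp1 q_expN1 sT ij).
split; first exact: (gen_step q_neq0 q_exp1 q_expN1).
have sT' : std l T'.
  rewrite std_swap //; apply: contraNN nr => /andP[d rc].
  by case/orP: rc => rc; [rewrite /same_row d | case/negP: nc; rewrite /same_col d].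
rewrite (gen_step q_neq0 q_exp1 q_expN1 sT' ij) sw_sw !xval_swap tpermL tpermR.
exact: addrC.
Qed.

Lemma seminormal_eqs : hecke_eqs q (@comp_lfun K V V V) \1%VF gen.
Proof.
pose g i : {linear {ffun stab l -> K^o} -> {ffun stab l -> K^o}} := gen i.
have st T i j sT ij := @gen_step K q n l q_neq0 q_exp1 q_expN1 T i j sT ij.
have st0 T i sT i0 := @gen_step0 K q n l T i sT i0.
split.
- by move=> x y z; rewrite comp_lfunA.
- exact: comp_lfun1l.
- exact: comp_lfun1r.
- by move=> y c u v; rewrite comp_lfunDl comp_lfunZl.
- by move=> y c u v; rewrite comp_lfunDr comp_lfunZr.
- move=> i i0; apply: seminormal_endP => T sT.
  rewrite comp_lfunE id_lfunE.
  exact: (gen_sq (gen := g) st0).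
- move=> i i0; apply: seminormal_endP => T sT.
  rewrite comp_lfunE add_lfunE !scale_lfunE id_lfunE.
  exact: (gen_quad q_neq0 q_exp1 q_expN1 (gen := g) st).
- move=> i j i0 j1; apply: seminormal_endP => T sT.
  do 3![rewrite [LHS]comp_lfunE]; do 3![rewrite [RHS]comp_lfunE].
  exact: (gen_braid4 q_neq0 q_exp1 q_expN1 (gen := g) st st0).
- move=> i j i0 ji; apply: seminormal_endP => T sT.
  do 2![rewrite [LHS]comp_lfunE]; do 2![rewrite [RHS]comp_lfunE].
  exact: (gen_braid3 q_neq0 q_exp1 q_expN1 (gen := g) st).
- move=> i j ij; apply: seminormal_endP => T sT.
  rewrite [LHS]comp_lfunE [RHS]comp_lfunE.
  exact: (gen_comm q_neq0 (gen := g) st st0 sT ij).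
Qed.
End SeminormalEquations.

Definition K1 : fieldType := {fraction {poly rat}}.
Definition qvar : K1 := tofrac 'X.

Section Extension.
Variables (K : fieldType) (iota : {rmorphism K1 -> K}).

Lemma iota_q_neq0 : iota qvar != 0.
Proof. by rewrite fmorph_eq0 tofrac_eq0 polyX_eq0. Qed.

Lemma iota_q_expn (m : nat) (c : rat) : (0 < m)%N || (c != 1) ->
  iota qvar ^+ m != iota (tofrac c%:P).
Proof.
move=> H; rewrite -rmorphXn /= (inj_eq (fmorph_inj iota)) -tofracXn tofrac_eq.
apply: contraTneq H => E; have := congr1 (fun p : {poly rat} => size p) E.
rewrite size_polyXn size_polyC; case: m E => [|m] E; last by case: (c != 0).
by move: E; rewrite expr0 => /polyC_inj <-; rewrite eqxx.
Qed.

Lemma iota_q_exp1 (k : int) : k != 0 -> iota qvar ^ k != 1.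
Proof.
have H (m : nat) : iota qvar ^+ m.+1 != 1.
  by have := @iota_q_expn m.+1 1 isT; rewrite polyC1 tofrac1 rmorph1.
case: k => [[|m]|m] // _; first exact: H.
by rewrite NegzE -invr_expz invr_eq1; exact: H.
Qed.

Lemma iota_q_expN1 (k : int) : iota qvar ^ k != -1.
Proof.
have H (m : nat) : iota qvar ^+ m != -1.
  have := @iota_q_expn m (-1); rewrite polyCN polyC1 tofracN tofrac1 rmorphN rmorph1.
  by apply; rewrite orbT.
case: k => m; first exact: H.
by rewrite NegzE -invr_expz -(inj_eq invr_inj) invrK invrN invr1; exact: H.
Qed.

Variables (n : nat) (l : bipart n).

Definition seminormal : algrep (hecke (iota qvar) n) :=
  hecke_rep (seminormal_eqs l iota_q_neq0 iota_q_exp1 iota_q_expN1).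
Definition seminormal_sharp : algrep (hecke_fixed (iota qvar) n) :=
  res_sharp seminormal.

(* The matrices of the generators over K are those over K1 with scalars extended
   along iota. *)
Lemma seminormal_gen_ext (i : 'I_n) (T : filling n) (t : stab l) : std l T ->
  seminormal_gen (iota qvar) l i (basis_vec l T) t =
  iota (seminormal_gen qvar l i (basis_vec l T) t).
Proof.
have vE U : (basis_vec l U : {ffun stab l -> K^o}) t =
    iota ((basis_vec l U : {ffun stab l -> K1^o}) t).
  by rewrite !ffunE rmorph_nat.
have uE d : usign K d = iota (usign K1 d) by case: d; rewrite /usign ?rmorphN rmorph1.
have ME d y i' j' : Mmx (iota qvar) d (iota y) i' j' = iota (Mmx qvar d y i' j').
  rewrite !mxE rmorphM fmorphV rmorphB rmorphM rmorph1 fmorphXz; congr (_ * _).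
  by do 2?case: ifP => _;
    rewrite ?(rmorphN, rmorphM, rmorphB, rmorph1, fmorphXz).
move=> sT; rewrite !gen_basis_vec // /seminormal_basis_act.
case: ifP => _.
  by rewrite uE !ffunE /GRing.scale /= rmorphM rmorph_nat.
case: ifP => _; first by rewrite !ffunE /GRing.scale /= rmorphM rmorph_nat.
case: ifP => _; first by rewrite !ffunE rmorphN rmorph_nat.
rewrite !uE -fmorph_div !ME !ffunE /GRing.scale /=.
by rewrite rmorphD !rmorphM !rmorph_nat.
Qed.
End Extension.

Definition direct_sum_decomp (K : fieldType) (A : algType K) (r : algrep A)
    (U W : subrep r) : Prop :=
  (U + W = fullv)%VS /\ (U :&: W = 0)%VS.

(* L contains exactly one of l and its swap whenever these differ. *)
Definition swap_choice (n : nat) (L : {pred bipart n}) : Prop :=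
  forall l, if bipart_swap l == l then l \notin L
            else (l \in L) (+) (bipart_swap l \in L).

Section SharpFamily.
Variables (K : fieldType) (iota : {rmorphism K1 -> K}) (n : nat).
Variable L : {pred bipart n}.
Variables Vp Vm : forall l : bipart n, subrep (seminormal_sharp iota l).

Definition sharp_index : Type :=
  ({l : bipart n | l \in L} + {l : bipart n | bipart_swap l == l} * bool)%type.

Definition sharp_family (x : sharp_index) : algrep (hecke_fixed (iota qvar) n) :=
  match x with
  | inl l => seminormal_sharp iota (val l)
  | inr (l, true) => rep_of_sub (Vp (val l))
  | inr (l, false) => rep_of_sub (Vm (val l))
  end.
End SharpFamily.

(* Main.v *)
(* Every seminormal representation is diagonalised by the Jucys-Murphy elements,
   and a standard tableau is determined by its eigenvalues +-q^content; with the
   generators moving between tableaux that differ by an exchange of i-1 and i, this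
   produces in the Hecke algebra an element acting as the matrix unit e_(T,U) on
   every V_lambda at once. There are 2^n n! pairs (T,U), because the up and down
   operators on pairs of Young diagrams satisfy UD - DU = 2; since normal forms
   span the algebra by as many elements, it acts faithfully on the sum of the
   V_lambda.
   Exchanging the two diagrams of a tableau intertwines pi_lambda twisted by sharp
   with pi_(lambda^* ), so e_(T,U) + e_(T^*,U^* ) is fixed by sharp. These elements are
   matrix units for V_lambda when lambda <> lambda^*; when lambda = lambda^* they
   split into matrix units for the two eigenspaces of v_T |-> v_(T^* ). A faithful
   family of modules with matrix units in the algebra is a basic set, and the
   algebra is then semisimple. The argument works over any extension of Q(q). *)

From HB Require Import structures.
Require Import Defs.
From mathcomp Require Import all_boot all_order all_fingroup all_algebra.
From mathcomp Require Import boolp zify ring.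
From mathcomp Require Import generic_quotient ring_quotient.
From mathcomp.multinomials Require Import monalg.

Set Implicit Arguments.
Unset Strict Implicit.
Unset Printing Implicit Defensive.

Import GRing.Theory.
Local Open Scope ring_scope.

(** * Matrix units *)

(** The obstacle is that the algebra is given by generators and relations, so nothing is known in
    advance about its size. An identity between elements, such as 1 being the sum of the diagonal
    matrix units, can be checked in the representations only after these are known to be jointly
    faithful. The matrix units therefore have to be built before faithfulness, using nothing but the
    eigenvalues of the Jucys-Murphy elements on each [v_T]; they bound the rank of the action from
    below, while the relations bound the number of spanning words from above. That the bounds meet
    is a count of pairs of standard tableaux of equal shape, done with operators on functions of
    shapes rather than by a bijection. The two halves of a symmetric shape have equal degree because
    the first generator, which sharp negates, anticommutes with the exchange of the two diagrams and
    so carries each eigenspace into the other. *)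

Lemma semisimple_ring_sum (A : nzRingType) (s : seq A) :
    \sum_(x <- s) x = 1 ->
    {in s, forall x a, a * x != 0 -> exists b, b * (a * x) = x} ->
  semisimple_ring A.
Proof.
move=> s1 ssimple J [J0 JD JM].
suff [J' [[J'0 J'D J'M] sJ JJ']] : exists J' : A -> Prop, [/\ left_ideal J',
    forall x, x \in s -> exists2 y, J y & J' (x - y)
    & forall x, J x -> J' x -> x = 0].
  exists J'; split=> // x; have [y Jy J'y] : exists2 y, J y & J' (1 - y).
    rewrite -s1; elim: (s) sJ => [|z t IH] sJ.
      by exists 0; rewrite // big_nil subr0.
    have [|y Jy J'y] := IH; first by move=> u ut; apply: sJ; rewrite inE ut orbT.
    have [|y' Jy' J'y'] := sJ z; first by rewrite inE eqxx.
    exists (y' + y); first exact: JD.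
    by rewrite big_cons opprD addrACA; apply: J'D.
  exists (x * y); first exact: JM.
  by rewrite -[X in X - _]mulr1 -mulrBr; apply: J'M.
(* Greedy complement: the elements of [s] are treated one at a time, and [x] enlarges [J'] only when
   it does not already lie in [J + J']. *)
elim: s {s1} ssimple => [|x s IH] ssimple.
  exists (fun x => x = 0); split=> //.
  by split=> // [x y -> ->|a x ->]; rewrite ?addr0 ?mulr0.
have [|J' [[J'0 J'D J'M] sJ JJ']] := IH.
  by move=> y ys; apply: ssimple; rewrite inE ys orbT.
have [[y Jy J'y]|nx] := pselect (exists2 y, J y & J' (x - y)).
  exists J'; split=> // z; rewrite inE => /orP[/eqP->|]; last exact: sJ.
  by exists y.
(* The new complement is [J' + A x]. If it met [J] in some [z] with [a * x] nonzero, the multiplier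
   [b] that recovers [x] would place [x] in [J + J']. *)
exists (fun z => exists a, J' (z - a * x)); split.
- split=> [|y z [a Ja] [b Jb]|b z [a Ja]].
  + by exists 0; rewrite mul0r subr0.
  + by exists (a + b); rewrite mulrDl opprD addrACA; apply: J'D.
  + by exists (b * a); rewrite -mulrA -mulrBr; apply: J'M.
- move=> z; rewrite inE => /orP[/eqP->|zs].
    by exists 0 => //; exists 1; rewrite mul1r subr0 subrr.
  by have [y Jy J'y] := sJ _ zs; exists y => //; exists 0; rewrite mul0r subr0.
- move=> z Jz [a J'z]; have [ax|ax] := eqVneq (a * x) 0.
    by apply: JJ' => //; move: J'z; rewrite ax subr0.
  have [|b bx] := ssimple x _ a ax; first by rewrite inE eqxx.
  case: nx; exists (b * z); first exact: JM.
  have -> : x - b * z = (- b) * (z - a * x) by rewrite mulNr mulrBr bx opprB.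
  exact: J'M.
Qed.

(** Schur's lemma: the kernel and the image are stable subspaces. *)
Lemma rirreducible_hom_bij (K : fieldType) (A : algType K) (s t : algrep A) (f : 'Hom(rspace s, rspace t)) :
    rirreducible s -> rirreducible t -> f != 0 ->
    (forall a v, f (s a v) = t a (f v)) -> bijective f.
Proof.
move=> [_ irrs] [_ irrt] f0 fr.
have kst : rstable (lker f).
  move=> a; apply/subvP => _ /memv_imgP[v vk ->].
  by move: vk; rewrite !memv_ker fr => /eqP ->; rewrite linear0.
have ist : rstable (limg f).
  move=> a; apply/subvP => _ /memv_imgP[_ /memv_imgP[v _ ->] ->].
  by rewrite -fr memv_img ?memvf.
have ker0 : lker f = 0%VS.
  case: (irrs _ kst) => // kf; case/eqP: f0; apply/lfunP => v.
  by rewrite zero_lfunE; apply/eqP; rewrite -memv_ker kf memvf.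
have imf : limg f = fullv.
  case: (irrt _ ist) => // i0; case/eqP: f0; apply/lfunP => v.
  by rewrite zero_lfunE; apply/eqP; rewrite -memv0 -i0 memv_img ?memvf.
exists (f^-1)%VF => v; first by apply: lker0_lfunK; rewrite ker0.
by apply: limg_lfunVK; rewrite imf memvf.
Qed.

Lemma requiv_sym (K : fieldType) (A : algType K) (s t : algrep A) : requiv s t -> requiv t s.
Proof.
case=> f fbij fr; have finj := bij_inj fbij.
have fK : cancel f (f^-1)%VF by apply: lker0_lfunK; apply/lker0P.
have Kf : cancel (f^-1)%VF f by case: fbij => g gK Kg v; rewrite -[v]Kg fK.
exists (f^-1)%VF => [|a v]; first by exists f.
by apply: finj; rewrite fr !Kf.
Qed.

Section MatrixUnits.
Variables (K : fieldType) (A : algType K) (I : eqType) (X : I -> finType).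
Variables (r : I -> algrep A) (E : forall i, X i -> X i -> A).
Variables (w : forall i, X i -> rspace (r i)).
Variables (coo : forall i, rspace (r i) -> X i -> K).
Arguments E {i}.
Arguments w {i}.
Arguments coo {i}.
Hypothesis coo_linear : forall i x c (u v : rspace (r i)),
  coo (c *: u + v) x = c * coo u x + coo v x.
Hypothesis coo_expand : forall i (v : rspace (r i)), v = \sum_x coo v x *: w x.
Hypothesis coo_w : forall i (x y : X i), coo (w x) y = (x == y)%:R.
Hypothesis E_w : forall i (x y z : X i), r i (E x y) (w z) = (y == z)%:R *: w x.
Hypothesis E_other : forall i j (x y : X i), i != j -> r j (E x y) = 0.
Hypothesis faithful : forall a, (forall i, r i a = 0) -> a = 0.
Hypothesis X_inhabited : forall i, exists x : X i, True.
Variable (sI : seq I).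
Hypotheses (sI_uniq : uniq sI) (mem_sI : forall i, i \in sI).

Let coo0 i (x : X i) : coo 0 x = 0.
Proof. by rewrite -[0 in LHS]addr0 -[X in X + 0](scaler0 _ (-1)) coo_linear mulN1r addNr. Qed.
Let cooZ i (x : X i) c v : coo (c *: v) x = c * coo v x.
Proof. by rewrite -[c *: v]addr0 coo_linear coo0 addr0. Qed.

Lemma mxunit_ext a b :
  (forall i (x : X i), r i a (w x) = r i b (w x)) -> a = b.
Proof.
move=> ab; apply/eqP; rewrite -subr_eq0; apply/eqP/faithful => i.
apply/lfunP => v; rewrite zero_lfunE (coo_expand v) linear_sum big1 // => x _.
by rewrite linearZ raddfB /= add_lfunE opp_lfunE ab subrr scaler0.
Qed.

(** By faithfulness it is enough to compare the actions on basis vectors. For fixed [x] the elements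
    [E z x] thus span a left ideal that is a copy of [r i]. *)
Lemma mxunit_mul i a (y x : X i) :
  a * E y x = \sum_z coo (r i a (w y)) z *: E z x.
Proof.
apply: mxunit_ext => j u; have [ij|ij] := eqVneq i j; last first.
  rewrite ractM E_other // comp_lfunE zero_lfunE linear0 linear_sum sum_lfunE big1 // => z _.
  by rewrite linearZ /= E_other // scaler0 zero_lfunE.
case: j / ij u => u; rewrite ractM comp_lfunE E_w linearZ /= {1}(coo_expand (r i a (w y))).
rewrite [in RHS]linear_sum sum_lfunE scaler_sumr; apply: eq_bigr => z _.
by rewrite [in RHS]linearZ /= scale_lfunE E_w !scalerA mulrC.
Qed.

Lemma mxunit_mulE i (x y z u : X i) : E x y * E z u = (y == z)%:R *: E x u.
Proof.
rewrite mxunit_mul (bigD1 x) //= E_w big1 => [|v vx].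
  by rewrite cooZ coo_w eqxx mulr1 addr0.
by rewrite cooZ coo_w [x == v]eq_sym (negbTE vx) mulr0 scale0r.
Qed.

Lemma mxunit_sum1 : \sum_(i <- sI) \sum_(x : X i) E x x = 1.
Proof.
apply: mxunit_ext => j u; rewrite linear_sum sum_lfunE (bigD1_seq j) //= [X in _ + X]big1 => [|i ij].
  rewrite addr0 linear_sum sum_lfunE (bigD1 u) //= E_w eqxx scale1r big1 ?addr0.
    by rewrite ract1 id_lfunE.
  by move=> x /negbTE xu; rewrite E_w xu scale0r.
rewrite linear_sum sum_lfunE big1 // => x _.
by rewrite E_other // zero_lfunE.
Qed.

Lemma mxunit_w_neq0 i (x : X i) : w x != 0.
Proof.
apply/eqP => w0; have := coo_w x x; rewrite w0 eqxx coo0 => /eqP.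
by rewrite eq_sym oner_eq0.
Qed.

Lemma mxunit_semisimple : semisimple_ring A.
Proof.
apply: (@semisimple_ring_sum _ [seq E x x | i <- sI, x <- enum (X i)]).
  by rewrite big_allpairs_dep -[RHS]mxunit_sum1; apply: eq_bigr => i _; rewrite big_enum.
move=> _ /allpairsPdep[i [x [_ _ ->]]] a; rewrite mxunit_mul => ne.
have [z cz] : exists z, coo (r i a (w x)) z != 0.
  apply/existsP; apply: contraNT ne => /existsPn c0; apply/eqP; rewrite big1 // => z _.
  by have := c0 z; rewrite negbK => /eqP ->; rewrite scale0r.
(* [E x z] selects the nonzero coefficient of [E z x] in [a * E x x] and moves it back to
   [E x x]. *)
exists ((coo (r i a (w x)) z)^-1 *: E x z).
rewrite mulr_sumr (bigD1 z) //= big1 ?addr0 => [|y yz].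
  by rewrite -scalerAl -scalerAr mxunit_mulE eqxx scale1r scalerA mulVf // scale1r.
by rewrite -scalerAl -scalerAr mxunit_mulE eq_sym (negbTE yz) scale0r !scaler0.
Qed.

Lemma mxunit_irreducible i : rirreducible (r i).
Proof.
split=> [|U Ust].
  rewrite /rdeg lt0n dimv_eq0; have [x _] := X_inhabited i.
  apply/eqP => f0; have := mxunit_w_neq0 x.
  by rewrite -memv0 -f0 memvf.
have [->|U0] := eqVneq U 0%VS; [by left|right].
have [u uU u0] : exists2 u, u \in U & u != 0 by exists (vpick U); rewrite ?memv_pick ?vpick0.
have [x cx] : exists x, coo u x != 0.
  apply/existsP; apply: contraNT u0 => /existsPn c0; rewrite (coo_expand u) big1 // => z _.
  by have := c0 z; rewrite negbK => /eqP ->; rewrite scale0r.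
apply/eqP; rewrite eqEsubv subvf; apply/subvP => v _.
rewrite (coo_expand v) memv_suml // => y _; rewrite memvZ //.
have -> : w y = (coo u x)^-1 *: r i (E y x) u.
  rewrite [in r i _ u](coo_expand u) linear_sum (bigD1 x) //= big1 => [|z zx].
    by rewrite linearZ /= E_w eqxx scale1r addr0 scalerA mulVf ?scale1r.
  by rewrite linearZ /= E_w eq_sym (negbTE zx) scale0r scaler0.
by rewrite memvZ //; apply: (subvP (Ust (E y x))); exact: memv_img.
Qed.

Lemma mxunit_inequiv i j : requiv (r i) (r j) -> i = j.
Proof.
case=> f /bij_inj finj fr; have [//|ij] := eqVneq i j.
have [x _] := X_inhabited i; have := fr (E x x) (w x).
rewrite (E_other _ _ ij) zero_lfunE E_w eqxx scale1r -(linear0 f) => /finj w0.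
by have := mxunit_w_neq0 x; rewrite w0 eqxx.
Qed.

(** The diagonal units sum to 1, so some [E x x] does not kill [v]. Sending [w y] to [E y x] applied
    to [v] is then a nonzero homomorphism, by [mxunit_mul], and Schur's lemma applies. *)
Lemma mxunit_complete s : rirreducible s -> exists i, requiv s (r i).
Proof.
move=> irrs; have [dims _] := irrs.
have [v v0] : exists v : rspace s, v != 0.
  by exists (vpick fullv); rewrite vpick0 -dimv_eq0 -lt0n.
have [i [x sx]] : exists (i : I) (x : X i), s (E x x) v != 0.
  apply: contrapT => H; case/eqP: v0.
  rewrite -[v]id_lfunE -(ract1 s) -mxunit_sum1 linear_sum sum_lfunE big1 // => i _.
  rewrite linear_sum sum_lfunE big1 // => x _; apply/eqP/negPn/negP => sx.
  by apply: H; exists i, x.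
exists i; apply: requiv_sym.
pose f0 (u : rspace (r i)) : rspace s := \sum_y coo u y *: s (E y x) v.
have f0_lin : linear f0.
  move=> c u u'; rewrite scaler_sumr -big_split; apply: eq_bigr => y _ /=.
  by rewrite coo_linear scalerDl scalerA.
pose fl := HB.pack f0 (GRing.isLinear.Build K _ _ _ f0 f0_lin) : {linear rspace (r i) -> rspace s}.
have fw y : f0 (w y) = s (E y x) v.
  rewrite /f0 (bigD1 y) //= coo_w eqxx scale1r big1 ?addr0 // => z zy.
  by rewrite coo_w eq_sym (negbTE zy) scale0r.
have fE (u : rspace (r i)) : linfun f0 u = fl u by exact: (lfunE fl).
have {}fw y : linfun f0 (w y) = s (E y x) v by rewrite fE -fw.
move: (linfun f0) fw => f fw {f0_lin fl fE f0}.
have fr a u : f (r i a u) = s a (f u).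
  have rZ c (y z : X i) : s (c *: E y z) v = c *: s (E y z) v by rewrite linearZ scale_lfunE.
  have E1 y : f (r i a (w y)) = s a (f (w y)).
    rewrite fw -[RHS]comp_lfunE -ractM mxunit_mul linear_sum sum_lfunE.
    rewrite [in LHS](coo_expand (r i a (w y))) linear_sum.
    by apply: eq_bigr => z _; rewrite (linearZZ f) /= fw rZ.
  rewrite (coo_expand u) (linear_sum (r i a)) (linear_sum f) (linear_sum f) (linear_sum (s a)).
  apply: eq_bigr => y _; rewrite (linearZZ (r i a)) (linearZZ f) (linearZZ f) (linearZZ (s a)) /=.
  by rewrite E1.
exists f => //; apply: (rirreducible_hom_bij (mxunit_irreducible i) irrs _ fr).
by apply: contraNneq sx => f00; rewrite -fw f00 zero_lfunE.
Qed.

Lemma mxunit_basic_set : basic_set r.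
Proof.
by split; [exact: mxunit_irreducible|exact: mxunit_inequiv|exact: mxunit_complete].
Qed.
End MatrixUnits.

(** * Standard tableaux *)

Section BipartRows.
Variable n : nat.
Implicit Types (l : bipart n) (d : bool) (r : nat).

Definition bipart_row l d r : nat := nth 0%N (if d then (val l).2 else (val l).1) r.

(** Parts are nonzero, so the default 0 of [nth] marks where the list ends. *)
Lemma partition_nth_inj (s t : seq nat) : is_partition s -> is_partition t ->
  (forall r, nth 0%N s r = nth 0%N t r) -> s = t.
Proof.
move=> /andP[_ s0] /andP[_ t0] st.
have le (u v : seq nat) : 0%N \notin u -> (forall r, nth 0%N u r = nth 0%N v r) ->
    (size u <= size v)%N.
  move=> u0 uv; rewrite leqNgt; apply/negP => lt.
  by case/negP: u0; rewrite -(nth_default 0%N (leqnn (size v))) -uv mem_nth.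
by apply: (@eq_from_nth _ 0%N) => [|i _] //; apply/eqP; rewrite eqn_leq !le.
Qed.

Lemma bipart_row_inj l l' : (forall d r, bipart_row l d r = bipart_row l' d r) -> l = l'.
Proof.
move=> E; apply: val_inj; have /and3P[p1 p2 _] := valP l; have /and3P[p1' p2' _] := valP l'.
rewrite [val l]surjective_pairing [val l']surjective_pairing.
by congr (_, _); apply: partition_nth_inj => //; [exact: (E false)|exact: (E true)].
Qed.

Lemma bipart_row_le l d r : (bipart_row l d r <= n)%N.
Proof.
have /and3P[_ _ /eqP <-] := valP l.
have le (s : seq nat) k : (nth 0%N s k <= sumn s)%N.
  elim: s k => [|x s IH] [|k] //=; first exact: leq_addr.
  exact: leq_trans (IH k) (leq_addl _ _).
rewrite /bipart_row; case: d.
  exact: leq_trans (le _ _) (leq_addl _ _).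
exact: leq_trans (le _ _) (leq_addr _ _).
Qed.

Lemma bipart_row_out l d r : (n <= r)%N -> bipart_row l d r = 0%N.
Proof.
move=> nr; apply: nth_default; apply: leq_trans nr.
have le (s : seq nat) : is_partition s -> (size s <= sumn s)%N.
  case/andP => _; elim: s => //= x s IH; rewrite inE negb_or => /andP[x0 /IH]; lia.
have /and3P[/le p1 /le p2 /eqP E] := valP l; rewrite /bipart_row; move: p1 p2 E.
by case: d; move: (sumn _) (sumn _) => a b; lia.
Qed.

Lemma in_shapeE l (b : box n) : in_shape l b = (bcol b < bipart_row l (bdiag b) (brow b))%N.
Proof. by []. Qed.

(** The occupied boxes are the shape. Tableaux of all shapes can therefore be handled as plain
    fillings and compared across shapes. *)
Lemma std_bipart_inj l l' (T : filling n) : std l T -> std l' T -> l = l'.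
Proof.
case/andP => /andP[_ /forallP sh] _ /andP[/andP[_ /forallP sh'] _].
have E b : in_shape l b = in_shape l' b by rewrite (eqP (sh b)) (eqP (sh' b)).
have le l1 l2 d r : (forall b, in_shape l1 b = in_shape l2 b) ->
    (bipart_row l1 d r <= bipart_row l2 d r)%N.
  move=> El; have [rn|] := ltnP r n; last by move/bipart_row_out->.
  rewrite leqNgt; apply/negP => lt.
  have cn : (bipart_row l2 d r < n)%N := leq_trans lt (bipart_row_le _ _ _).
  have := El (d, Ordinal rn, Ordinal cn).
  by rewrite !in_shapeE /bcol /brow /bdiag /= lt ltnn.
by apply: bipart_row_inj => d r; apply/eqP; rewrite eqn_leq !le.
Qed.
End BipartRows.

Section TableauConnect.
Variables (n : nat) (l : bipart n).
Implicit Types (T U : filling n) (i j k : 'I_n).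

(* The entry of U in the box that carries k in T increases with k only if T = U;
   at a descent the two consecutive entries of T can be exchanged. *)
Lemma std_swap_ind U (P : filling n -> Prop) : std l U -> P U ->
    (forall T i j, std l T -> i = j.+1 :> nat -> std l (swap_entries T j i) ->
       P (swap_entries T j i) -> P T) ->
  forall T, std l T -> P T.
Proof.
move=> sU PU PS T.
have wP V k : std l V -> exists m, U m == V k.
  by move=> sV; have [m mE] := std_surj sU (std_shape k sV); exists m; rewrite mE.
(* The default [k] keeps [w] below [n] for every filling, so that [mu] is bounded without any
   standardness. *)
pose w (V : filling n) (k : 'I_n) : nat := odflt k [pick m | U m == V k].
have wE V k : std l V -> exists2 m : 'I_n, w V k = m & U m = V k.
  move=> sV; rewrite /w; case: pickP => [m /eqP mE|H]; first by exists m.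
  by have [m] := wP V k sV; rewrite H.
(* Rearrangement: exchanging the entries of a descent raises [mu] by the size of the drop of [w],
   and [mu] is bounded, so the induction ends. *)
pose mu (V : filling n) := (\sum_(k < n) k * w V k)%N.
have mu_le V : (mu V <= n * (n * n))%N.
  rewrite -[X in (X * _)%N]card_ord -sum_nat_const leq_sum // => k _.
  by apply: leq_mul; rewrite ltnW // /w; case: pickP => /=.
have [N] := ubnP (n * (n * n) - mu T)%N.
elim: N T => // N IH T ltN sT.
have [/existsP[i /existsP[j /andP[/eqP ij wij]]]|H] :=
    boolP [exists i : 'I_n, exists j : 'I_n, (i == j.+1 :> nat) && (w T i < w T j)%N].
  have sS : std l (swap_entries T j i).
    rewrite std_swap //; apply/negP => bl.
    have := blocked_before sT bl; rewrite ij ltnSn => /(_ isT).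
    have [mi wi <-] := wE T i sT; have [mj wj <-] := wE T j sT.
    by move/(std_before sU); rewrite ltnNge ltnW // -wi -wj.
  apply: (PS T i j) => //; apply: IH => //.
  have jNi : j != i by rewrite -val_eqE /= ij; lia.
  have wS k : std l (swap_entries T j i) -> w (swap_entries T j i) k = w T (tperm j i k).
    move=> sS'; have [m -> mE] := wE _ k sS'; have [m' -> m'E] := wE T (tperm j i k) sT.
    by congr (nat_of_ord _); apply: (std_inj sU); rewrite mE m'E ffunE.
  suff : (mu T < mu (swap_entries T j i))%N.
    by move=> lt; have := mu_le (swap_entries T j i); move: ltN; lia.
  rewrite /mu (bigD1 i) //= (bigD1 j) //= [X in (_ < X)%N](bigD1 i) //=.
  rewrite [X in (_ < _ + X)%N](bigD1 j) //= !wS // tpermL tpermR !addnA.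
  rewrite (eq_bigr (fun k : 'I_n => k * w (swap_entries T j i) k)%N) => [|k /andP[ki kj]].
    by rewrite ltn_add2r ij; move: wij; clear; nia.
  by rewrite wS // tpermD // eq_sym.
suff -> : T = U by [].
have mono : forall k m : 'I_n, (k <= m)%N -> (w T k <= w T m)%N.
  move=> k m; have [d] := ubnP (m - k)%N; elim: d m => // d IHd m.
  case: (eqVneq k m) => [->//|km] ltd le.
  have m1 : (m.-1 < n)%N by apply: leq_ltn_trans (leq_pred m) (ltn_ord m).
  have km' : (k < m)%N by rewrite ltn_neqAle le km.
  apply: (@leq_trans (w T (Ordinal m1))).
    by apply: IHd => /=; move: ltd km'; clear; lia.
  rewrite leqNgt; apply/negP => lt; case/negP: H.
  apply/existsP; exists m; apply/existsP; exists (Ordinal m1); rewrite lt andbT /=.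
  by apply/eqP; move: km'; clear; lia.
have winj k m : w T k = w T m -> k = m.
  have [a -> aE] := wE T k sT; have [b -> bE] := wE T m sT.
  by move=> /val_inj ab; apply: (std_inj sT); rewrite -aE -bE ab.
(* A strictly increasing self-map of ['I_n] is the identity: one inequality by induction from 0, the
   other by induction down from [n - 1]. *)
have wid k : w T k = k.
  have ge (m : nat) (mn : (m < n)%N) : (m <= w T (Ordinal mn))%N.
    elim: m mn => // m IHm mn; have mn' := ltnW mn.
    apply: leq_ltn_trans (IHm mn') _; rewrite ltn_neqAle mono ?leqnSn // andbT.
    by apply/eqP => /winj/(congr1 val)/=; clear; lia.
  have le d (m : nat) (mn : (m < n)%N) : (n - m = d.+1)%N -> (w T (Ordinal mn) <= m)%N.
    elim: d m mn => [|d IHd] m mn E.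
      by have [a -> _] := wE T (Ordinal mn) sT; have := ltn_ord a; move: E; clear; lia.
    have mn' : (m.+1 < n)%N by move: E; clear; lia.
    rewrite -ltnS; apply: leq_trans (IHd m.+1 mn' _); last by move: E; clear; lia.
    rewrite ltn_neqAle mono ?leqnSn // andbT.
    by apply/eqP => /winj/(congr1 val)/=; clear; lia.
  case: k => m mn /=; apply/eqP; rewrite eqn_leq ge andbT; apply: (le (n - m).-1).
  by move: mn; clear; lia.
apply/ffunP => k; have [m mk <-] := wE T k sT; congr (U _).
by apply: val_inj; rewrite /= -mk wid.
Qed.
End TableauConnect.

Section Weights.
Variable n : nat.
Implicit Types (T U : filling n) (l : bipart n) (i j k : 'I_n).

Lemma std_weight_inj l l' T U : std l T -> std l' U ->
    (forall k, bdiag (T k) = bdiag (U k)) -> (forall k, content T k = content U k) ->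
  T = U.
Proof.
move=> sT sU dE cE.
(* an entry of a standard filling lies in the first free box of its diagonal *)
have key l1 l2 V W k : std l1 V -> std l2 W -> bdiag (V k) = bdiag (W k) ->
    content V k = content W k -> (forall j, (j < k)%N -> V j = W j) ->
    (brow (V k) < brow (W k))%N -> False.
  move=> sV sW d c eqVW r; rewrite /content in c.
  have rc : (bcol (V k) < bcol (W k))%N by lia.
  have [m mE] : exists m, W m = V k.
    by apply: (std_surj sW); apply: shape_le (std_shape k sW) => //; exact: ltnW.
  have mk : (m <= k)%N by apply: (std_mono sW); rewrite mE //; exact: ltnW.
  have mNk : m != k by apply/eqP => E; move: r; rewrite -mE E ltnn.
  have lt : (m < k)%N by rewrite ltn_neqAle mk mNk.
  have := eqVW m lt; rewrite mE => /(std_inj sV) E.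
  by rewrite E eqxx in mNk.
apply/ffunP => -[k kn]; have [N] := ubnP k; elim: N k kn => // N IH k kn ltN.
have prev j : (j < Ordinal kn)%N -> T j = U j.
  by case: j => j jn /= jk; apply: IH; exact: leq_trans jk ltN.
have d := dE (Ordinal kn); have c := cE (Ordinal kn).
have rE : brow (T (Ordinal kn)) = brow (U (Ordinal kn)).
  case: (ltngtP (brow (T (Ordinal kn))) (brow (U (Ordinal kn)))) => // r; exfalso.
    exact: (key l l' T U (Ordinal kn)).
  apply: (key l' l U T (Ordinal kn)) => // j jk; exact/esym/prev.
by apply: box_eqP => //; move: c; rewrite /content rE => /addIr [].
Qed.

(** Otherwise [i] would precede [j], or the box just below that of [j] would carry an entry strictly
    between the two. The content condition is the one under which the numerator of [off_coef]
    vanishes, so that coefficient is nonzero at every admissible exchange. *)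
Lemma std_adjacent l T i j : std l T -> i = j.+1 :> nat ->
    bdiag (T i) = bdiag (T j) -> content T j = content T i + 1 ->
  blocked (T j) (T i).
Proof.
move=> sT ij dE; rewrite /content => cE.
case: (leqP (brow (T i)) (brow (T j))) => r.
  have : (i <= j)%N by apply: (std_mono sT) => //; lia.
  by rewrite ij ltnn.
case: (ltnP (brow (T j)).+1 (brow (T i))) => r'; last first.
  by rewrite /blocked dE eqxx /=; apply/orP; right; apply/eqP; lia.
have rn : ((brow (T j)).+1 < n)%N by apply: ltn_trans r' (ltn_ord _).
pose b : box n := (bdiag (T i), Ordinal rn, (T j).2).
have [m mE] : exists m, T m = b.
  apply: (std_surj sT); apply: shape_le (std_shape i sT) => //.
  by rewrite -[bcol b]/(bcol (T j)); move: cE r r'; clear; lia.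
have jm : (j < m)%N.
  by apply: (std_before sT); rewrite mE; apply: before_col; first exact: (esym dE).
have mi : (m <= i)%N.
  apply: (std_mono sT); rewrite mE //.
  by rewrite -[bcol b]/(bcol (T j)); move: cE r r'; clear; lia.
have mNi : m != i.
  apply/eqP => E; move: mE; rewrite E => /(congr1 (@brow n)).
  by rewrite -[brow b]/(brow (T j)).+1; move: r'; clear; lia.
by move: mNi; rewrite -val_eqE /=; lia.
Qed.
End Weights.

(** * Jucys-Murphy elements *)

Section HeckeMatrixUnits.
Variables (K : fieldType) (q : K) (n : nat).
Hypothesis q_neq0 : q != 0.
Hypothesis q_exp1 : forall k : int, k != 0 -> q ^ k != 1.
Hypothesis q_expN1 : forall k : int, q ^ k != -1.
Implicit Types (T U W : filling n) (l : bipart n) (i j k : 'I_n).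

Local Notation rho l := (hecke_rep (seminormal_eqs l q_neq0 q_exp1 q_expN1)).
Local Notation vv := (@basis_vec K n).
Local Notation xval := (@tab_val K q n).

(** Natural indices allow recursion and index arithmetic; the value 1 beyond the range is a
    dummy. *)
Definition nat_gen (k : nat) : hecke q n :=
  if insub k is Some i then hecke_gen q i else 1.

Lemma nat_gen_ord i : nat_gen i = hecke_gen q i.
Proof. by rewrite /nat_gen valK. Qed.

(** The factor [q^-1] makes the eigenvalue on [v_T] exactly the signed power of [q] given by the
    content. *)
Fixpoint jucys_murphy (k : nat) : hecke q n :=
  if k is k'.+1 then q^-1 *: (nat_gen k * jucys_murphy k' * nat_gen k) else nat_gen 0.

(* The action of the seminormal representations is sealed, to keep unification
   from unfolding the quotient that defines the algebra. *)
Fact seminormal_act_key :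
  {a : forall l, hecke q n -> seminormal_space K l -> seminormal_space K l |
   forall l x v, a l x v = rho l x v}.
Proof. by exists (fun l x v => rho l x v). Qed.
Definition seminormal_act := sval seminormal_act_key.
Local Notation act := (@seminormal_act _).

Lemma snactE l x v : act x v = rho l x v.
Proof. exact: (svalP seminormal_act_key). Qed.
Lemma act_gen l i v : act (hecke_gen q i) v = seminormal_gen q l i v.
Proof. rewrite snactE; exact: (congr1 (fun f : 'End(_) => f v) (hecke_rep_gen _ i)). Qed.
Lemma snact1 l (v : seminormal_space K l) : act 1 v = v.
Proof. by rewrite snactE ract1 id_lfunE. Qed.
Lemma snactM l x y (v : seminormal_space K l) : act (x * y) v = act x (act y v).
Proof. by rewrite !snactE ractM comp_lfunE. Qed.
Lemma snactZ l c x (v : seminormal_space K l) : act (c *: x) v = c *: act x v.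
Proof. rewrite !snactE; exact: (etrans (congr1 (fun f : 'End(_) => f v) (linearZZ (rho l) c x)) (scale_lfunE _ _ _)). Qed.
Lemma snactD l x y (v : seminormal_space K l) : act (x + y) v = act x v + act y v.
Proof. rewrite !snactE; exact: (etrans (congr1 (fun f : 'End(_) => f v) (linearD (rho l) x y)) (add_lfunE _ _ _)). Qed.
Lemma snact0 l (v : seminormal_space K l) : act 0 v = 0.
Proof. by rewrite -(scale0r (1 : hecke q n)) snactZ scale0r. Qed.
Lemma snactvP l x c (u v : seminormal_space K l) :
  act x (c *: u + v) = c *: act x u + act x v.
Proof. rewrite !snactE; exact: (linearP (rho l x)). Qed.
Lemma snactv0 l x : act x (0 : seminormal_space K l) = 0.
Proof. rewrite !snactE; exact: (linear0 (rho l x)). Qed.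
Lemma snactvZ l x c (v : seminormal_space K l) : act x (c *: v) = c *: act x v.
Proof. rewrite !snactE; exact: (linearZZ (rho l x)). Qed.
Lemma snactvD l x (u v : seminormal_space K l) : act x (u + v) = act x u + act x v.
Proof. rewrite !snactE; exact: (linearD (rho l x)). Qed.

Lemma xval_sub_neq0 l T i j : std l T -> i = j.+1 :> nat ->
  xval T i - xval T j != 0 /\ xval T j - xval T i != 0.
Proof.
move=> sT ij; have ne := xval_eq q_neq0 q_exp1 q_expN1 sT ij.
by rewrite !subr_eq0 ne eq_sym ne.
Qed.

(** Induction on [k] for all [T] at once: the step needs the previous element on [T] and on the
    exchanged tableau, where its eigenvalue is [xval T i]. If the exchange is not standard, the
    generator acts on [v_T] by [q] or -1. *)
Lemma act_jucys_murphy l T k : std l T ->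
  act (jucys_murphy k) (vv l T) = xval T k *: vv l T.
Proof.
have gstep := @gen_step K q n l q_neq0 q_exp1 q_expN1.
case: k => k kn; elim: k kn T => [|k IH] kn T sT.
  rewrite /= (nat_gen_ord (Ordinal kn)) act_gen (gen_step0 _ sT) //.
  congr (_ *: _); rewrite /tab_val /content.
  (* The corner box of the diagram of [i] carries an entry at most [i], that is 0, hence [i] itself;
     so the content is 0. *)
  set i := Ordinal kn.
  pose b : box n := (bdiag (T i), i, i).
  have [m mE] : exists m, T m = b.
    by apply: (std_surj sT); apply: shape_le (std_shape i sT); rewrite // /brow /bcol.
  have mi : (m <= i)%N by apply: (std_mono sT); rewrite mE // /brow /bcol.
  have -> : i = m by apply: val_inj => /=; move: mi; rewrite leqn0 => /eqP.
  by rewrite mE /bcol /brow /= subrr expr0z mulr1.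
pose i : 'I_n := Ordinal kn; pose j : 'I_n := Ordinal (ltnW kn).
have ij : i = j.+1 :> nat by [].
have IHj U : std l U -> act (jucys_murphy k) (vv l U) = xval U j *: vv l U by exact: IH.
have E1 : act (jucys_murphy k.+1) (vv l T) =
   q^-1 *: seminormal_gen q l i (act (jucys_murphy k) (seminormal_gen q l i (vv l T))).
  by rewrite [jucys_murphy _]/= (nat_gen_ord i) snactZ !snactM !act_gen.
have lin2 (f : 'End(seminormal_space K l)) c d u w :
    f (c *: u + d *: w) = c *: f u + d *: f w by rewrite linearP linearZ.
rewrite E1 (gstep _ _ _ sT ij) snactvD !snactvZ lin2 IHj //.
have [D1 D2] := xval_sub_neq0 sT ij; have xi0 := @xval_neq0 K q n q_neq0 T i.
have xj0 := @xval_neq0 K q n q_neq0 T j.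
have [sS|[_ v0 H]] := std_pair q_neq0 sT ij; last first.
  rewrite v0 !(snactv0, linear0, scaler0, addr0) (linearZZ (seminormal_gen q l i)) /=.
  rewrite (gstep _ _ _ sT ij) v0 scaler0 addr0.
  rewrite !scalerA; congr (_ *: _); rewrite /diag_coef.
  by move: D1 D2 xi0 xj0; case: H => [[_ ->]|[_ ->]] D1 D2 xi0 xj0; field; rewrite ?D1 ?D2 ?q_neq0 //=.
rewrite IHj // xval_swap tpermL !(linearZZ (seminormal_gen q l i)) /= (gstep _ _ _ sT ij) (gstep _ _ _ sS ij) sw_sw.
rewrite !xval_swap tpermL tpermR.
apply/ffunP => t; rewrite !ffunE /GRing.scale /= /diag_coef /off_coef; field.
by rewrite D1 D2 q_neq0.
Qed.

Lemma signed_exp_inj (a b : bool) (c d : int) :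
  usign K a * q ^ c = usign K b * q ^ d -> a = b /\ c = d.
Proof.
move=> E; have {}E : usign K a * q ^ (c - d) = usign K b.
  by rewrite expfzDr // -invr_expz mulrA E mulfK // expfz_neq0.
have dE : a = b.
  move: (q_expN1 (c - d)) E; case: a; case: b => //; rewrite /usign ?mulN1r ?mul1r.
    by move=> ne E; rewrite -E opprK eqxx in ne.
  by move=> ne E; rewrite E eqxx in ne.
split=> //; apply/eqP; rewrite -subr_eq0; apply/negPn/negP => /q_exp1/eqP; case.
by apply: (mulfI (@usign_neq0 K a)); rewrite E dE mulr1.
Qed.

(** Fillings that are not standard contribute too, so that a single list of interpolation nodes
    serves all shapes. *)
Definition weight_values : seq K :=
  undup [seq xval T k | T <- enum {: filling n}, k <- enum 'I_n].

Lemma mem_weight_values T k : xval T k \in weight_values.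
Proof.
rewrite mem_undup; apply/allpairsP; exists (T, k); by rewrite !mem_enum.
Qed.

(* Lagrange interpolation in the Jucys-Murphy elements *)
Definition tab_proj T : hecke q n :=
  \prod_(k < n) \prod_(y <- weight_values | y != xval T k)
    ((xval T k - y)^-1 *: (jucys_murphy k - y%:A)).

Lemma act_scale_prod l (v : seminormal_space K l) (I : Type) (s : seq I) (P : pred I)
    (x : I -> hecke q n) (c : I -> K) :
    (forall y, P y -> act (x y) v = c y *: v) ->
  act (\prod_(y <- s | P y) x y) v = (\prod_(y <- s | P y) c y) *: v.
Proof.
move=> xc; elim: s => [|y s IH]; first by rewrite !big_nil snact1 scale1r.
rewrite !big_cons; case Py: (P y); last exact: IH.
by rewrite snactM IH snactvZ xc // scalerA mulrC.
Qed.

Lemma tab_projE l l' T W : std l T -> std l' W ->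
  act (tab_proj T) (vv l' W) = (W == T)%:R *: vv l' W.
Proof.
move=> sT sW.
pose c k := \prod_(y <- weight_values | y != xval T k) ((xval T k - y)^-1 * (xval W k - y)).
rewrite (@act_scale_prod _ _ _ _ _ _ c) => [|k _]; last first.
  apply: act_scale_prod => y _; rewrite snactZ snactD -scaleNr snactZ snact1.
  by rewrite act_jucys_murphy // -scalerDl scalerA.
congr (_ *: _); have [E|WT] := eqVneq W T.
  by rewrite big1 // => k _; rewrite /c E big1 // => y yk; rewrite mulVf // subr_eq0 eq_sym.
have [k kP] : exists k, xval W k != xval T k.
  apply/existsP; apply: contraNT WT => /existsPn H; apply/eqP.
  have H' k : xval W k = xval T k by have := H k; rewrite negbK => /eqP.
  by apply: (std_weight_inj sW sT) => k; have [] := signed_exp_inj (H' k).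
rewrite (bigD1 k) //= [X in X * _](_ : _ = 0) ?mul0r //.
(* The node [y = xval W k] differs from [xval T k], and its factor vanishes on [v_W]. *)
rewrite /c -big_filter (bigD1_seq (xval W k)) /=.
- by rewrite subrr mulr0 mul0r.
- by rewrite mem_filter kP mem_weight_values.
- by rewrite filter_uniq // undup_uniq.
Qed.

Lemma off_coef_neq0 l T i j : std l T -> i = j.+1 :> nat ->
  std l (swap_entries T j i) -> off_coef q (xval T i) (xval T j) != 0.
Proof.
move=> sT ij sS; have [D1 _] := xval_sub_neq0 sT ij.
rewrite /off_coef mulf_neq0 ?invr_eq0 // subr_eq0; apply/eqP => E.
have /signed_exp_inj[dE cE] : usign K (bdiag (T j)) * q ^ content T j =
    usign K (bdiag (T i)) * q ^ (content T i + 1).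
  by move: E; rewrite /tab_val => <-; rewrite expfzDr // expr1z; ring.
have bl : blocked (T j) (T i) by apply: (std_adjacent sT ij) => //; exact: esym.
by move: sS; rewrite (std_swap sT ij) bl.
Qed.

Lemma exists_mxunit l T U : std l T -> std l U -> exists e : hecke q n,
  forall l' W, std l' W -> act e (vv l' W) = (W == U)%:R *: vv l' T.
Proof.
move=> sT sU; move: T sT; apply: (std_swap_ind sU).
  exists (tab_proj U) => l' W sW; rewrite (tab_projE sU sW).
  by case: eqP => [->|]; rewrite ?scale0r.
move=> T i j sT ij sS [e eE].
have b0 : off_coef q (xval T j) (xval T i) != 0.
  have := off_coef_neq0 sS ij; rewrite sw_sw !xval_swap tpermL tpermR; exact.
(* After [e] the vector is that of the exchanged tableau; the generator sends it to a combination of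
   itself and [v_T], and the projector keeps [v_T]. The coefficient is computed at the exchanged
   tableau, hence the swapped arguments. *)
exists ((off_coef q (xval T j) (xval T i))^-1 *: (tab_proj T * hecke_gen q i * e)) => l' W sW.
rewrite snactZ !snactM eE //.
case: eqP => [E|_]; last by rewrite !scale0r !snactv0 scaler0.
have {E W sW}-> : l' = l by apply: std_bipart_inj sU; rewrite -E.
rewrite !scale1r act_gen (gen_step q_neq0 q_exp1 q_expN1 sS ij) sw_sw !xval_swap tpermL tpermR.
rewrite snactvP snactvZ !(tab_projE sT) // eqxx scale1r.
rewrite (_ : (swap_entries T j i == T) = false) ?scale0r ?scaler0 ?add0r.
  by rewrite scalerA mulVf ?scale1r.
apply/eqP => /ffunP/(_ i); rewrite ffunE tpermR => /(std_inj sT)/(congr1 val) /=.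
by rewrite ij; lia.
Qed.
End HeckeMatrixUnits.

(** * Normal forms in the Hecke algebra *)

Section LinearSpan.
Variables (K : fieldType) (A : lmodType K).

(** A predicate rather than a [{vspace A}]: finite dimension of the algebra is an outcome of the
    spanning argument. *)
Inductive lspan (s : seq A) : A -> Prop :=
| LSpan0 : lspan s 0
| LSpanD c b x of b \in s & lspan s x : lspan s (c *: b + x).

Lemma lspan_add s x y : lspan s x -> lspan s y -> lspan s (x + y).
Proof.
move=> sx sy; elim: sx => [|c b z bs _ IH]; first by rewrite add0r.
by rewrite -addrA; apply: LSpanD.
Qed.

Lemma lspan_scale s c x : lspan s x -> lspan s (c *: x).
Proof.
elim=> [|d b z bs _ IH]; first by rewrite scaler0; left.
by rewrite scalerDr scalerA; apply: LSpanD.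
Qed.

Lemma lspan_mem s x : x \in s -> lspan s x.
Proof. by move=> xs; rewrite -[x]scale1r -[_ *: _]addr0; apply: LSpanD => //; left. Qed.

Lemma lspan_coef s x : lspan s x -> exists c : 'I_(size s) -> K, x = \sum_i c i *: s`_i.
Proof.
elim=> [|d b z bs _ [c ->]].
  by exists (fun=> 0); rewrite big1 // => i _; rewrite scale0r.
have bi : (index b s < size s)%N by rewrite index_mem.
exists (fun i => d *+ (i == Ordinal bi) + c i).
under [RHS]eq_bigr do rewrite scalerDl.
rewrite big_split /= [X in _ = X + _](bigD1 (Ordinal bi)) //= [X in _ + X + _]big1 => [|i /negbTE ->].
  by rewrite addr0 eqxx mulr1n nth_index.
by rewrite mulr0n scale0r.
Qed.
End LinearSpan.

Section NormalForms.
Variables (K : fieldType) (A : algType K) (q : K) (n : nat) (g : nat -> A).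
Hypothesis g_sq : (0 < n)%N -> g 0 * g 0 = 1.
Hypothesis g_quad : forall i, (0 < i < n)%N -> g i * g i = (q - 1) *: g i + q *: 1.
Hypothesis g_braid4 : (1 < n)%N -> g 0 * g 1 * g 0 * g 1 = g 1 * g 0 * g 1 * g 0.
Hypothesis g_braid3 : forall i, (0 < i)%N -> (i.+1 < n)%N ->
  g i * g i.+1 * g i = g i.+1 * g i * g i.+1.
Hypothesis g_comm : forall i j, (i.+1 < j < n)%N -> g i * g j = g j * g i.

Fixpoint down k m : A := if m is m'.+1 then down k m' * g (k - m') else 1.
Fixpoint up p : A := if p is p'.+1 then up p' * g p else 1.

Lemma down_comm k m i : (k < n)%N -> (i + m < k)%N -> down k m * g i = g i * down k m.
Proof.
move=> kn; elim: m => [|m IH] im /=; first by rewrite mul1r mulr1.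
by rewrite -mulrA -g_comm ?mulrA ?IH //; lia.
Qed.

(** [g i] passes the letters below [i - 1], the cubic braid relation turns it into [g i.-1], and
    that passes the letters above [i]. The bound [1 < i] keeps [g 0] out of the braid relation. *)
Lemma down_braid k m i : (k < n)%N -> (m <= k.+1)%N -> (1 < i <= k)%N ->
  (k.+1 < i + m)%N -> down k m * g i = g i.-1 * down k m.
Proof.
move=> kn; elim: m => [|m IH] mk ik im; first by lia.
have [im'|im'] := ltnP k.+1 (i + m); rewrite /=.
  by rewrite -mulrA g_comm ?mulrA ?IH //; lia.
case: m IH mk im im' => [|m] IH mk im im' /=; first by lia.
have -> : i = (k - m.+1).+1 by lia.
have -> : (k - m)%N = (k - m.+1).+1 by lia.
rewrite -!mulrA [g _ * (_ * _)]mulrA -g_braid3; try lia.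
by rewrite !mulrA down_comm //; lia.
Qed.

Lemma up_comm p i : (p.+1 < i < n)%N -> up p * g i = g i * up p.
Proof.
elim: p => [|p IH] pin /=; first by rewrite mul1r mulr1.
by rewrite -mulrA g_comm ?mulrA ?IH //; lia.
Qed.

Lemma up_braid p i : (0 < i < p)%N -> (p < n)%N -> up p * g i = g i.+1 * up p.
Proof.
elim: p => [|p IH] ip pn; first by lia.
have [ip'|ip'] := ltnP i p; rewrite /=.
  by rewrite -mulrA -g_comm ?mulrA ?IH //; lia.
have -> : i = p by lia.
case: p IH ip pn ip' => [|p] IH ip pn ip' /=; first by lia.
by rewrite -!mulrA [g _ * (_ * _)]mulrA g_braid3 // !mulrA up_comm //; lia.
Qed.

(** The relation of length four enters here: it moves [g 0] across [g 1 * g 0 * g 1], and [g 0]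
    commutes with all the letters of index above 1. *)
Lemma down_up_gen0 k p : (0 < p <= k)%N -> (k < n)%N ->
  down k k.+1 * up p * g 0 = g 0 * (down k k.+1 * up p).
Proof.
move=> + kn; elim: p => [|p IH] pk; first by lia.
case: p IH pk => [|p] IH pk; last first.
  have {}IH : down k k.+1 * up p.+1 * g 0 = g 0 * (down k k.+1 * up p.+1) by apply: IH; lia.
  rewrite (_ : up p.+2 = up p.+1 * g p.+2) //; move: (down _ _) (up _) IH => D u IH.
  have C : g p.+2 * g 0 = g 0 * g p.+2 by rewrite -g_comm //; lia.
  by rewrite [D * (u * _)]mulrA [RHS]mulrA -IH -!mulrA C.
case: k kn pk {IH} => [|k] kn pk; first by lia.
have -> : down k.+1 k.+2 = down k.+1 k * g 1 * g 0.
  by rewrite /= subnn (_ : (k.+1 - k)%N = 1%N) //; lia.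
have C : down k.+1 k * g 0 = g 0 * down k.+1 k by rewrite down_comm //; lia.
rewrite (_ : up 1 = g 1) /=; last by rewrite /= mul1r.
have B : g 1 * g 0 * g 1 * g 0 = g 0 * g 1 * g 0 * g 1 by rewrite g_braid4 //; lia.
move: (down _ _) C => D C; have := congr1 ( *%R D) B.
by rewrite !mulrA C => ->.
Qed.

(* Representatives of the cosets of the subalgebra of the first k generators in
   that of the first k+1: a_k ... a_(k-m+1) and a_k ... a_0 a_1 ... a_p. *)
Definition coset_words k : seq A :=
  [seq down k m | m <- iota 0 k.+1] ++ [seq down k k.+1 * up p | p <- iota 0 k.+1].

Lemma down_in k m : (m <= k.+1)%N -> down k m \in coset_words k.
Proof.
rewrite mem_cat leq_eqVlt ltnS => /orP[/eqP->|mk].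
  by apply/orP; right; apply/mapP; exists 0; rewrite ?mem_iota //= mulr1.
by apply/orP; left; apply/mapP; exists m; rewrite ?mem_iota.
Qed.

Lemma up_in k p : (p <= k)%N -> down k k.+1 * up p \in coset_words k.
Proof. by move=> pk; rewrite mem_cat; apply/orP; right; apply/mapP; exists p; rewrite ?mem_iota. Qed.

(** Deodhar's alternative for minimal coset representatives: a generator appended to one either
    leads to another, up to the quadratic relation, or moves to the front as a generator of the
    smaller subalgebra. *)
Lemma coset_words_gen k x i : (k < n)%N -> x \in coset_words k -> (i <= k)%N ->
  (exists2 j, (j < k)%N & x * g i = g j * x) \/ lspan (coset_words k) (x * g i).
Proof.
move=> kn xX ik.
(* The appended generator repeats the last letter. *)
have sq y : y \in coset_words k -> y * g i \in coset_words k ->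
    lspan (coset_words k) (y * g i * g i).
  move=> yX ygX; rewrite -mulrA; case: (posnP i) => [i0|i0].
    by rewrite i0 g_sq ?mulr1; [exact: lspan_mem | lia].
  rewrite g_quad; last by lia.
  rewrite mulrDr -!scalerAr mulr1.
  by apply: lspan_add; apply: lspan_scale; apply: lspan_mem.
move: xX; rewrite mem_cat => /orP[/mapP[m]|/mapP[p]]; rewrite mem_iota => /andP[_ mk] ->.
  have [im|im] := ltnP (i + m) k; first by left; exists i; [lia|exact: down_comm].
  have [E|im'] := eqVneq (i + m)%N k.
    right; apply: lspan_mem; have -> : i = (k - m)%N by lia.
    exact: (@down_in k m.+1).
  have [E|im''] := eqVneq (i + m)%N k.+1.
    case: m mk im im' E => [|m] mk im im' E; first by lia.
    right; have E' : i = (k - m)%N by lia.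
    rewrite /= -E'; apply: sq; [apply: down_in; lia|rewrite E'; apply: (@down_in k m.+1); lia].
  by left; exists i.-1; [lia|apply: down_braid; lia].
have [E|ip] := eqVneq i p.+1.
  right; apply: lspan_mem; rewrite -mulrA E; apply: (@up_in k p.+1); lia.
have [E|ip'] := eqVneq i p.
  right; rewrite E in sq *; case: p mk ip E sq => [|p] mk ip E sq.
    rewrite /= mulr1 subnn in sq *.
    by apply: sq; [apply: down_in; lia|have := @down_in k k.+1; rewrite /= subnn; apply].
  rewrite /= mulrA; apply: sq; first by apply: up_in; lia.
  by rewrite -mulrA; apply: (@up_in k p.+1); lia.
left; have [pi|pi] := ltnP p i.
  exists i.-1; first by lia.
  rewrite -mulrA up_comm; last by lia.
  by rewrite mulrA down_braid ?mulrA //; lia.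
case: (posnP i) => [->|i0].
  by exists 0%N; [lia|apply: down_up_gen0; lia].
exists i; first by lia.
rewrite -mulrA up_braid; [|lia..].
by rewrite mulrA down_braid ?mulrA //; lia.
Qed.

Fixpoint normal_words k : seq A :=
  if k is k'.+1 then [seq b * x | b <- normal_words k', x <- coset_words k'] else [:: 1].

Lemma size_normal_words k : size (normal_words k) = (2 ^ k * k`!)%N.
Proof.
elim: k => // k IH; rewrite (size_allpairs *%R) IH size_cat !size_map !size_iota.
by rewrite factS expnS addnn -mul2n mulnC mulnACA.
Qed.

Lemma normal_words1 k : 1 \in normal_words k.
Proof.
elim: k => [|k IH]; first by rewrite inE.
by apply/allpairsP; exists (1, 1); rewrite mul1r (@down_in k 0).
Qed.

Lemma lspan_normal_words_coset k x y :
  lspan (normal_words k) y -> x \in coset_words k -> lspan (normal_words k.+1) (y * x).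
Proof.
move=> sy xX; elim: sy => [|c b z bB _ IH]; first by rewrite mul0r; left.
rewrite mulrDl -scalerAl; apply: LSpanD => //.
by apply/allpairsP; exists (b, x).
Qed.

(** The last coset factor absorbs the generator or passes it to the left with a smaller index, where
    the induction hypothesis takes it. *)
Lemma lspan_normal_words_gen k x i : (k <= n)%N -> (i < k)%N ->
  lspan (normal_words k) x -> lspan (normal_words k) (x * g i).
Proof.
elim: k x i => // k IH x i kn ik; elim=> [|c b z]; first by rewrite mul0r; left.
case/allpairsP => -[b' y] [b'B yX ->] _ IHz.
rewrite mulrDl -scalerAl; apply: lspan_add IHz; apply: lspan_scale.
rewrite -[_ * g i]mulrA; case: (coset_words_gen kn yX ik) => [[j jk ->]|].
  rewrite mulrA; apply: lspan_normal_words_coset => //.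
  by apply: IH => //; [exact: ltnW|exact: lspan_mem].
elim=> [|d u v uX _ IHv]; first by rewrite mulr0; left.
rewrite mulrDr -scalerAr; apply: lspan_add IHv; apply: lspan_scale; apply: lspan_mem.
by apply/allpairsP; exists (b', u).
Qed.
End NormalForms.

Section HeckeSpan.
Variables (K : fieldType) (q : K) (n : nat).
Local Notation H := (hecke q n).
Local Open Scope quotient_scope.

Lemma hecke_words_ind (P : H -> Prop) :
    (forall c x y, P x -> P y -> P (c *: x + y)) -> P 0 -> P 1 ->
    (forall x i, P x -> P (x * hecke_gen q i)) -> forall x, P x.
Proof.
move=> Plin P0 P1 Pg x.
have PZ c y : P y -> P (c *: y) by move=> Py; rewrite -[_ *: _]addr0; apply: Plin.
have Pword (y : H) (s : seq 'I_n) : P y -> P (y * \pi_H << FMonom s >>).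
  elim: s y => [|i s IH] y Py.
    have -> : << FMonom [::] >> = 1 :> {malg K[{fmonom 'I_n}]} by rewrite -fmE.
    by rewrite pi_hecke1E mulr1.
  have -> : << FMonom (i :: s) >> = freegen K i * << FMonom s >>.
    rewrite malgM_def fgmulUU mulr1; congr << _ *g _ >>.
    by rewrite /mmul /= fmmulE fmuE.
  by rewrite pi_heckeM mulrA; apply: IH; apply: Pg.
rewrite -[x]reprK; move: (repr x) => {}x; rewrite [x]monalgE raddf_sum /=.
elim/big_rec: _ => // w y _ Py.
have -> : << x@_w *g w >> = x@_w *: << w >> :> {malg K[{fmonom 'I_n}]}.
  by rewrite -mul_malgC malgM_def fgmulUU mulr1 mul1m.
rewrite pi_heckeZ; apply: Plin => //.
by case: w => s; rewrite -[X in P X]mul1r; apply: Pword.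
Qed.

Lemma hecke_span (x : H) : lspan (normal_words (@nat_gen K q n) n) x.
Proof.
have gP := @hecke_genP K q n.
have gE i (ni : (i < n)%N) : nat_gen q n i = hecke_gen q (Ordinal ni) by exact: (nat_gen_ord _ (Ordinal ni)).
have sq : (0 < n)%N -> nat_gen q n 0 * nat_gen q n 0 = 1.
  by move=> n0; rewrite gE; apply: gP; exact: HeckeSq.
have qu i : (0 < i < n)%N -> nat_gen q n i * nat_gen q n i = (q - 1) *: nat_gen q n i + q *: 1.
  by case/andP => i0 ni; rewrite gE; apply: gP; exact: HeckeQuad.
have b4 : (1 < n)%N -> nat_gen q n 0 * nat_gen q n 1 * nat_gen q n 0 * nat_gen q n 1 =
    nat_gen q n 1 * nat_gen q n 0 * nat_gen q n 1 * nat_gen q n 0.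
  by move=> n1; rewrite (gE 0%N (ltnW n1)) gE; apply: gP; exact: HeckeBraid4.
have b3 i : (0 < i)%N -> (i.+1 < n)%N -> nat_gen q n i * nat_gen q n i.+1 * nat_gen q n i =
    nat_gen q n i.+1 * nat_gen q n i * nat_gen q n i.+1.
  by move=> i0 ni; rewrite (gE i (ltnW ni)) gE; apply: gP; exact: HeckeBraid3.
have co i j : (i.+1 < j < n)%N -> nat_gen q n i * nat_gen q n j = nat_gen q n j * nat_gen q n i.
  case/andP => ij nj; have ni : (i < n)%N by lia.
  by rewrite (gE i ni) gE; apply: gP; apply: HeckeComm; rewrite /= ij.
apply: (@hecke_words_ind (lspan (normal_words (nat_gen q n) n))) => [c y z sy sz|||y i sy].
- by apply: lspan_add => //; apply: lspan_scale.
- by left.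
- by apply: lspan_mem; apply: normal_words1.
- by rewrite -nat_gen_ord; apply: (lspan_normal_words_gen (q := q) (n := n)).
Qed.
End HeckeSpan.

(** * Counting pairs of standard tableaux *)

Section BallotWords.
Local Open Scope nat_scope.
Variable n : nat.
Local Notation letter := (bool * 'I_n)%type.
Local Notation rows := (bool -> nat -> nat).
Implicit Types (f : rows) (a b : letter) (g : rows -> nat).

Definition is_row a : bool -> nat -> bool := fun d r => (d == a.1) && (r == a.2).
Definition add_box f a : rows := fun d r => f d r + is_row a d r.
Definition rem_box f a : rows := fun d r => f d r - is_row a d r.
Definition addable f a := (a.2 == 0 :> nat) || (f a.1 a.2 < f a.1 a.2.-1).
Definition removable f a := f a.1 a.2.+1 < f a.1 a.2.
Definition nonincr f := forall d r, f d r.+1 <= f d r.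

Lemma is_row_eq a b : is_row a b.1 b.2 = (b == a).
Proof. by case: a => d r; case: b => d' r'; rewrite /is_row xpair_eqE. Qed.

Lemma nonincr_add f a : nonincr f -> addable f a -> nonincr (add_box f a).
Proof.
move=> fN fa d r; have := fN d r; rewrite /add_box /is_row.
case: eqP => [->|_] /=; last by rewrite !addn0.
case: (r =P a.2 :> nat) => [->|ra]; first by rewrite (gtn_eqF (ltnSn _)); lia.
case: (r.+1 =P a.2 :> nat) => ra'; last by lia.
by move: fa; rewrite /addable -ra' /=; lia.
Qed.

Lemma nonincr_rem f a : nonincr f -> removable f a -> nonincr (rem_box f a).
Proof.
move=> fN fa d r; have := fN d r; rewrite /rem_box /is_row.
case: eqP => [->|_] /=; last by rewrite !subn0.
case: (r =P a.2 :> nat) => [->|ra]; last by case: (r.+1 =P a.2 :> nat) => ra'; lia.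
by move: fa; rewrite /removable (gtn_eqF (ltnSn _)); lia.
Qed.

(** The operators act on functions of shapes, so [iter k up_op g empty_rows] sums [g] over all ways
    to add [k] boxes to the empty pair. *)
Definition up_op g : rows -> nat := fun f => \sum_(a : letter | addable f a) g (add_box f a).
Definition down_op g : rows -> nat := fun f => \sum_(a : letter | removable f a) g (rem_box f a).

Lemma sum_letter (F : bool -> nat -> nat) :
  \sum_(a : letter) F a.1 a.2 = \sum_(d : bool) \sum_(r < n) F d r.
Proof. by rewrite pair_bigA. Qed.

(** Row [r.+1] is addable exactly when row [r] is removable, and row 0 is always addable: one extra
    per diagram. The empty last row makes this count correct with only [n] rows. *)
Lemma count_addable f : 0 < n -> nonincr f -> (forall d, f d n.-1 = 0) ->
  \sum_(a : letter) addable f a = \sum_(a : letter) removable f a + 2.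
Proof.
move=> n0 fN f0.
rewrite (sum_letter (fun d r => (r == 0) || (f d r < f d r.-1))).
rewrite (sum_letter (fun d r => f d r.+1 < f d r)) !big_bool /=.
have E d : \sum_(r < n) ((r == 0 :> nat) || (f d r < f d r.-1)) = (\sum_(r < n) (f d r.+1 < f d r)).+1.
  case: n n0 f0 => // m _ /(_ d) /= f0.
  by rewrite big_ord_recl big_ord_recr /= f0 ltn0 addn0 add1n.
by rewrite !E addSn addnS addn2.
Qed.

(* A pair of diagrams has two more addable than removable boxes, and adding then
   removing two distinct boxes can be done in either order. *)
Lemma up_down_comm g f : 0 < n -> nonincr f -> (forall d, f d n.-1 = 0) ->
  up_op (down_op g) f = down_op (up_op g) f + 2 * g f.
Proof.
move=> n0 fN f0.
have ud : up_op (down_op g) f = \sum_(a : letter | addable f a) g f +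
    \sum_(a : letter | addable f a) \sum_(b : letter | removable (add_box f a) b && (b != a))
      g (rem_box (add_box f a) b).
  rewrite /up_op /down_op -big_split; apply: eq_bigr => a fa /=.
  rewrite (bigD1 a) /=.
    congr (g _ + _); apply/funext => d; apply/funext => r.
    by rewrite /rem_box /add_box addnK.
  rewrite /removable /add_box is_row_eq eqxx /is_row eqxx /= (gtn_eqF (ltnSn _)).
  by rewrite addn0 addn1 ltnS.
have du : down_op (up_op g) f = \sum_(a : letter | removable f a) g f +
    \sum_(b : letter | removable f b) \sum_(a : letter | addable (rem_box f b) a && (a != b))
      g (add_box (rem_box f b) a).
  rewrite /up_op /down_op -big_split; apply: eq_bigr => a fa /=.
  rewrite (bigD1 a) /=.
    congr (g _ + _); apply/funext => d; apply/funext => r.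
    rewrite /rem_box /add_box; case E: (is_row a d r); rewrite ?addn0 ?subn0 //= subnK //.
    by move: E fa => /andP[/eqP-> /eqP->]; rewrite /removable; lia.
  rewrite /addable /rem_box is_row_eq eqxx /is_row eqxx /=.
  case: (a.2 =P 0 :> nat) => //= a0; rewrite (_ : (_.-1 == _) = false) ?subn0; last by lia.
  have := fN a.1 a.2.-1; rewrite prednK; last by rewrite lt0n; apply/eqP.
  by move: fa; rewrite /removable; clear; move: (f _ _) (f _ _) (f _ _) => x y z; lia.
have cond a b : a != b -> addable f a && removable (add_box f a) b =
    removable f b && addable (rem_box f b) a.
  move=> ab; have ba : (b == a) = false by rewrite eq_sym (negbTE ab).
  rewrite /removable /addable /add_box /rem_box !is_row_eq ba (negbTE ab) addn0 subn0.
  rewrite /is_row; case: a b ab ba => [d r] [d' r'] /= ab ba.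
  case: (eqVneq d d') ab ba => [<- ab ba|_ _ _] /=; last by rewrite addn0 subn0 andbC.
  have rr : (r : nat) != r' by apply: contraFneq ba => /val_inj ->; rewrite eqxx.
  have := fN d r'; have := fN d r.-1; case: (r =P 0 :> nat) => [r0|r0] /=.
    by rewrite (_ : (r'.+1 == r) = false) ?addn0; [rewrite andbT|lia].
  rewrite prednK; last by lia.
  (* The only interaction is [a] lying in the row just below [b]; in either order [f] must then drop
     by at least two between these rows. *)
  case: (r'.+1 =P r :> nat) => [E|E].
    by rewrite -E /= eqxx; lia.
  by rewrite (_ : (r.-1 == r') = false) ?addn0 ?subn0; [rewrite andbC|lia].
rewrite ud du addnAC; congr (_ + _).
  have cst (P : pred letter) c : \sum_(a | P a) c = (\sum_a P a) * c.
    by rewrite big_mkcond big_distrl; apply: eq_bigr => a _ /=; case: (P a); rewrite /= ?mul1n ?mul0n.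
  by rewrite !cst count_addable // mulnDl.
rewrite [RHS](exchange_big_dep predT) //= [LHS]big_mkcond; apply: eq_bigr => a _ /=.
have boxE b : a != b -> rem_box (add_box f a) b = add_box (rem_box f b) a.
  move=> ab; apply/funext => d; apply/funext => r; rewrite /rem_box /add_box.
  case E: (is_row b d r); last by rewrite !subn0.
  rewrite (_ : is_row a d r = false) ?addn0 //; apply/negP => E'.
  case/negP: ab; case/andP: E => /eqP dE /eqP rE; rewrite -is_row_eq.
  by move: E'; rewrite dE rE is_row_eq eq_sym -is_row_eq.
have PE b : addable f a && (removable (add_box f a) b && (b != a)) =
    removable f b && (addable (rem_box f b) a && (a != b)).
  rewrite [b == a]eq_sym; case ab: (a == b); rewrite ?andbF // !andbT.
  by apply: cond; rewrite ab.
case fa: (addable f a).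
  apply: eq_big => [b|b /andP[_]]; first by rewrite -PE fa.
  by rewrite eq_sym => /boxE ->.
by rewrite big_pred0 // => b; rewrite -PE fa.
Qed.

Definition rows_of_size m f := [/\ nonincr f, forall d, f d n = 0 & \sum_(a : letter) f a.1 a.2 = m].

Lemma nonincr_le f d r s : nonincr f -> r <= s -> f d s <= f d r.
Proof.
move=> fN; elim: s => [|s IH]; first by rewrite leqn0 => /eqP ->.
rewrite leq_eqVlt ltnS => /orP[/eqP->//|/IH]; exact: leq_trans (fN d s).
Qed.

(** A nonempty row [n.-1] forces [n] nonempty rows, hence at least [n] boxes. *)
Lemma rows_of_size_last m f d : m < n -> rows_of_size m f -> f d n.-1 = 0.
Proof.
move=> mn [fN f0 fs]; apply/eqP; rewrite -leqn0 leqNgt; apply/negP => fd.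
move: mn; rewrite ltnNge -fs => /negP; apply.
rewrite (sum_letter f) (bigD1 d) //=; apply: leq_trans (leq_addr _ _).
rewrite -[X in X <= _]card_ord -sum1_card; apply: leq_sum => r _.
apply: leq_trans fd (nonincr_le _ fN _); case: r => r /=; lia.
Qed.

Lemma sum_is_row a : \sum_(b : letter) is_row a b.1 b.2 = 1.
Proof.
rewrite (bigD1 a) //= is_row_eq eqxx big1 // => b /negbTE ba.
by rewrite is_row_eq ba.
Qed.

Lemma is_row_out a d : is_row a d n = false.
Proof. by rewrite /is_row gtn_eqF ?andbF. Qed.

Lemma rows_of_size_add m f a : rows_of_size m f -> addable f a -> rows_of_size m.+1 (add_box f a).
Proof.
move=> [fN f0 fs] fa; split; first exact: nonincr_add.
  by move=> d; rewrite /add_box is_row_out f0.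
by rewrite big_split /= fs sum_is_row addn1.
Qed.

Lemma rows_of_size_rem m f a : rows_of_size m f -> removable f a -> 0 < m /\ rows_of_size m.-1 (rem_box f a).
Proof.
move=> [fN f0 fs] fa; have E : \sum_(b : letter) rem_box f a b.1 b.2 + 1 = m.
  rewrite -(sum_is_row a) -fs -big_split; apply: eq_bigr => b _ /=.
  rewrite /rem_box subnK // is_row_eq; case: eqP => // ->.
  by apply: leq_ltn_trans fa.
split; first by rewrite -E addn1.
split; first exact: nonincr_rem.
  by move=> d; rewrite /rem_box is_row_out f0.
by rewrite -E addn1.
Qed.

Definition empty_rows : rows := fun _ _ => 0.
(** For [f] with [k] boxes, [iter k down_op delta f] counts the ways to empty [f] box by box, which
    are its standard tableaux. *)
Definition delta f : nat := `[< f = empty_rows >].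

Lemma rows_of_size0 : rows_of_size 0 empty_rows.
Proof. by split=> //; rewrite big1. Qed.

Lemma rows_of_size0E f : rows_of_size 0 f -> f = empty_rows.
Proof.
move=> [fN f0 fs]; apply/funext => d; apply/funext => r.
have [rn|nr] := ltnP r n; last by apply/eqP; rewrite -leqn0 -(f0 d) nonincr_le.
by move/eqP: fs; rewrite sum_nat_eq0 => /forallP/(_ (d, Ordinal rn))/eqP.
Qed.

Lemma up_delta f : up_op delta f = 0.
Proof.
rewrite /up_op big1 // => a _; rewrite /delta asboolF // => /(congr1 (fun h : rows => h a.1 a.2)).
by rewrite /add_box is_row_eq eqxx addn1.
Qed.

(** As for the derivative of a power: [up_op] kills [delta], and moving it past each of the [k.+1]
    copies of [down_op] leaves twice the remaining power. *)
Lemma up_iter_down m k f : m < n -> rows_of_size m f ->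
  up_op (iter k.+1 down_op delta) f = 2 * k.+1 * iter k down_op delta f.
Proof.
elim: k m f => [|k IH] m f mn gf; have [fN _ _] := gf.
  rewrite /= up_down_comm //; [|lia|by move=> d; apply: rows_of_size_last gf].
  by rewrite [down_op _ _]big1 // => a _; rewrite up_delta.
rewrite iterS up_down_comm //; [|lia|by move=> d; apply: rows_of_size_last gf].
rewrite [down_op _ _](_ : _ = 2 * k.+1 * iter k.+1 down_op delta f).
  by rewrite -mulnDl; congr (_ * _); rewrite [in RHS]mulnS addnC.
rewrite [in RHS]iterS [in RHS]/down_op big_distrr; apply: eq_bigr => a fa.
have [m0 gr] := rows_of_size_rem gf fa; rewrite (IH m.-1) //; lia.
Qed.

Lemma iter_up_eq m k g g' c f : rows_of_size m f ->
    (forall f', rows_of_size (m + k) f' -> g f' = c * g' f') ->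
  iter k up_op g f = c * iter k up_op g' f.
Proof.
elim: k m f => [|k IH] m f gf gg; first by apply: gg; rewrite addn0.
rewrite !iterS [in LHS]/up_op [in RHS]/up_op big_distrr; apply: eq_bigr => a fa.
by apply: (IH m.+1); [exact: rows_of_size_add|rewrite addSnnS].
Qed.

(** The left side is the sum, over pairs of diagrams with [k] boxes in all, of the squared number of
    standard tableaux. *)
Lemma iter_up_down k : k <= n ->
  iter k up_op (iter k down_op delta) empty_rows = 2 ^ k * k`!.
Proof.
elim: k => [|k IH] kn; first by rewrite /= /delta asboolT.
rewrite iterSr (@iter_up_eq 0 k _ (iter k down_op delta) (2 * k.+1)).
- rewrite (IH (ltnW kn)) factS expnS; exact: mulnACA.
- exact: rows_of_size0.
- by move=> f' gf'; rewrite (@up_iter_down k) //; rewrite add0n in gf'.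
Qed.

Definition word_shape (p : seq letter) : rows := fun d r => count (fun a => is_row a d r) p.

(* Words are read from the right: the head is the last box added. *)
Fixpoint ballot (p : seq letter) : bool :=
  if p is a :: p' then addable (word_shape p') a && ballot p' else true.

Lemma shape_cons a p : word_shape (a :: p) = add_box (word_shape p) a.
Proof. by apply/funext => d; apply/funext => r; rewrite /word_shape /add_box /= addnC. Qed.

Lemma rows_of_size_shape p : ballot p -> rows_of_size (size p) (word_shape p).
Proof.
elim: p => [|a p IH] /= => [_|/andP[pa /IH gp]]; first exact: rows_of_size0.
by rewrite shape_cons; apply: rows_of_size_add.
Qed.

(** This enumeration and [down_words] follow [up_op] and [down_op] term by term, so sums over them
    are iterates of these operators. *)
Fixpoint up_words k : seq (seq letter) :=
  if k is k'.+1 then [seq a :: p | p <- up_words k', a <- enum (addable (word_shape p))]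
  else [:: [::]].

Fixpoint down_words k f : seq (seq letter) :=
  if k is k'.+1 then [seq a :: p | a <- enum (removable f), p <- down_words k' (rem_box f a)]
  else if `[< f = empty_rows >] then [:: [::]] else [::].

Lemma sum_up_words k g : \sum_(p <- up_words k) g (word_shape p) = iter k up_op g empty_rows.
Proof.
elim: k g => [|k IH] g; first by rewrite big_seq1.
rewrite iterSr -IH big_allpairs_dep; apply: eq_bigr => p _.
by rewrite big_enum /=; apply: eq_bigr => a _; rewrite shape_cons.
Qed.

Lemma size_down_words k f : size (down_words k f) = iter k down_op delta f.
Proof.
elim: k f => [|k IH] f; first by rewrite /= /delta; case: asboolP.
rewrite iterS /down_op size_allpairs_dep sumnE big_map big_enum.
by apply: eq_bigr => a _; rewrite IH.
Qed.

Lemma up_wordsP k p : p \in up_words k -> ballot p /\ size p = k.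
Proof.
elim: k p => [|k IH] p; first by rewrite inE => /eqP ->.
case/allpairsPdep => p' [a [/IH[bp <-]]]; rewrite mem_enum => pa ->.
by rewrite /= bp andbT.
Qed.

Lemma down_wordsP k f p : rows_of_size k f -> p \in down_words k f ->
  [/\ ballot p, size p = k & word_shape p = f].
Proof.
elim: k f p => [|k IH] f p gf /=; first by case: asboolP => // ->; rewrite inE => /eqP ->.
case/allpairsPdep => a [p' [fa pin ->]]; rewrite mem_enum in fa.
have [_ gr] := rows_of_size_rem gf fa; have [bp sp shp] := IH _ _ gr pin.
have [fN _ _] := gf; split; rewrite ?shape_cons ?shp /= ?sp //; last first.
  apply/funext => d; apply/funext => r; rewrite /add_box /rem_box.
  case E: (is_row a d r); rewrite ?addn0 ?subn0 // subnK //.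
  by move: E fa => /andP[/eqP-> /eqP->]; apply: leq_ltn_trans.
rewrite bp andbT /addable /rem_box shp /rem_box is_row_eq eqxx /is_row eqxx /=.
case: (a.2 =P 0 :> nat) => //= a0; have a1 : 0 < a.2 by rewrite lt0n; apply/eqP.
rewrite (_ : (_.-1 == _) = false) ?subn0; last by lia.
have := fN a.1 a.2.-1; rewrite prednK //; apply: leq_trans.
by rewrite subn1 prednK //; apply: leq_ltn_trans fa.
Qed.

Lemma uniq_up_words k : uniq (up_words k).
Proof.
elim: k => //= k IH; apply: allpairs_uniq_dep => // [p _|]; first exact: enum_uniq.
by move=> [p a] [p' a'] _ _ /= [-> ->].
Qed.

Lemma uniq_down_words k f : uniq (down_words k f).
Proof.
elim: k f => [|k IH] f /=; first by case: asboolP.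
apply: allpairs_uniq_dep => // [|a p]; first exact: enum_uniq.
by case: a p => [a p] [a' p'] _ _ /= [-> ->].
Qed.

Definition ballot_pairs : seq (seq letter * seq letter) :=
  [seq (p, p') | p <- up_words n, p' <- down_words n (word_shape p)].

Lemma size_ballot_pairs : size ballot_pairs = 2 ^ n * n`!.
Proof.
rewrite -(iter_up_down (leqnn n)) -sum_up_words size_allpairs_dep sumnE big_map.
by apply: eq_bigr => p _; rewrite size_down_words.
Qed.

Lemma uniq_ballot_pairs : uniq ballot_pairs.
Proof.
apply: allpairs_uniq_dep => // [|p _|].
- exact: uniq_up_words.
- exact: uniq_down_words.
- by move=> [p a] [p' a'] _ _ /= [-> ->].
Qed.

Lemma ballot_pairsP p p' : (p, p') \in ballot_pairs ->
  [/\ ballot p, ballot p', size p = n, size p' = n & word_shape p = word_shape p'].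
Proof.
case/allpairsPdep => u [v [uin vin [-> ->]]].
have [bu su] := up_wordsP uin; have := rows_of_size_shape bu; rewrite su => gu.
by have [bv sv ->] := down_wordsP gu vin.
Qed.

Lemma exists_ballot k f : rows_of_size k f -> exists p, [/\ ballot p, size p = k & word_shape p = f].
Proof.
move=> gf; suff : down_words k f != [::].
  case: (down_words k f) (@down_wordsP k f) => // p s H _; exists p; apply: H => //.
  by rewrite inE eqxx.
elim: k f gf => [|k IH] f gf /=; first by rewrite (rows_of_size0E gf) asboolT.
(* Without a removable row the row lengths would not decrease before the empty row [n], and [f]
   would have no boxes. *)
have [a fa] : exists a, removable f a.
  have [fN f0 fs] := gf; apply: contrapT => nex.
  have H a : ~~ removable f a by apply/negP => fa; apply: nex; exists a.
  have f00 (a : letter) : f a.1 a.2 = 0.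
    have lt d r : r < n -> f d r <= f d n.
      move=> rn; have [m] := ubnP (n - r); elim: m r rn => // m IHm r rn rm.
      have := H (d, Ordinal rn); rewrite /removable /= -leqNgt => le.
      apply: leq_trans le _; have [E|ne] := eqVneq r.+1 n; first by rewrite E.
      by apply: IHm; lia.
    by apply/eqP; rewrite -leqn0 -(f0 a.1) lt.
  by move: fs; rewrite big1.
have [_ gr] := rows_of_size_rem gf fa; have := IH _ gr.
case E: (down_words k _) => [//|p s] _.
have : a :: p \in down_words k.+1 f.
  apply/allpairsPdep; exists a, p; split=> //; first by rewrite mem_enum.
  by rewrite -/down_words E mem_head.
by apply: contraTneq => /= ->.
Qed.
End BallotWords.

(** * From ballot words to standard tableaux *)

Section BallotFilling.
Local Open Scope nat_scope.
Variable n : nat.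
Local Notation letter := (bool * 'I_n)%type.
Implicit Types (p : seq letter) (l : bipart n) (k i j : 'I_n).

Lemma exists_bipart f : rows_of_size n n f -> exists l, bipart_row l = f.
Proof.
move=> [fN f0 fs].
have ex d : exists m, f d m == 0 by exists n; rewrite f0.
pose len d := ex_minn (ex d).
have lenP d r : (r < len d) = (f d r != 0).
  rewrite /len; case: ex_minnP => m /eqP fm min; apply/idP/idP => [rm|fr].
    by apply: contraTN rm => /min; rewrite leqNgt.
  by rewrite ltnNge; apply: contra fr => mr; rewrite -leqn0 -fm nonincr_le.
have len_n d : len d <= n.
  by rewrite leqNgt lenP f0.
pose s d := mkseq (f d) (len d).
have nth_s d r : nth 0 (s d) r = f d r.
  have [rl|rl] := ltnP r (len d); first by rewrite nth_mkseq.
  by rewrite nth_default ?size_mkseq //; move: rl; rewrite leqNgt lenP negbK => /eqP.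
have part d : is_partition (s d).
  apply/andP; split.
    apply: (@homo_sorted _ _ (f d) leq geq) => [x y xy|]; first exact: nonincr_le.
    exact: iota_sorted.
  apply/negP => /mapP[r]; rewrite mem_iota /= => rl.
  by move: rl; rewrite lenP => /eqP H E; case: H.
have sumE d : sumn (s d) = \sum_(r < n) f d r.
  rewrite sumnE /s big_map -(big_mkord predT) /=.
  rewrite (_ : iota 0 (len d) = index_iota 0 (len d)); last by rewrite /index_iota subn0.
  rewrite [RHS](big_cat_nat (n := len d)) //=.
  rewrite [X in _ = _ + X]big_nat [X in _ = _ + X]big1 ?addn0 // => r /andP[rl _].
  by move: rl; rewrite leqNgt lenP negbK => /eqP.
have lP : [&& is_partition (s false), is_partition (s true)
    & sumn (s false) + sumn (s true) == n].
  by move: fs; rewrite !part !sumE (@sum_letter n f) big_bool addnC => /eqP.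
exists (exist _ (s false, s true) lP); apply/funext => -[] ; apply/funext => r;
  by rewrite /bipart_row /= nth_s.
Qed.

Lemma rows_of_size_bipart l : 0 < n -> rows_of_size n n (bipart_row l).
Proof.
move=> n0; split.
- move=> d r; rewrite leqNgt; apply/negP => lt.
  have rn : r.+1 < n by rewrite ltnNge; apply/negP => /(bipart_row_out l d) E; rewrite E in lt.
  have cn : bipart_row l d r < n by apply: leq_trans lt (bipart_row_le _ _ _).
  pose b : box n := (d, Ordinal (ltnW rn), Ordinal cn).
  pose c : box n := (d, Ordinal rn, Ordinal cn).
  have : in_shape l b by apply: (@shape_le _ l b c) => //=; rewrite /brow /=.
  by rewrite in_shapeE ltnn.
- by move=> d; apply: bipart_row_out.
- have /and3P[p1 p2 /eqP sE] := valP l.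
  rewrite (@sum_letter n (bipart_row l)) big_bool -[RHS]sE addnC.
  have sz (t : seq nat) : is_partition t -> sumn t <= n -> sumn t = \sum_(r < n) nth 0 t r.
    case/andP => _ t0 tn; have st : size t <= n.
      apply: leq_trans tn; elim: t t0 => //= x t IH; rewrite inE negb_or => /andP[x0 /IH].
      by move: x0; case: x => // x _; move: (sumn t) (size t) => a b; lia.
    rewrite sumnE (big_nth 0) -(big_mkord predT) [RHS](big_cat_nat (n := size t)) //=.
    rewrite [X in _ = _ + X]big_nat [X in _ = _ + X]big1 ?addn0 // => r /andP[rl _].
    exact: nth_default.
  by congr (_ + _); symmetry; apply: sz => //; apply: leq_trans (eq_leq sE);
    rewrite ?leq_addl ?leq_addr.
Qed.

(** Words list the last box first, so entry [k] is found at position [n - k.+1]. *)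
Definition letter_at p k : letter := nth (false, k) p (n - k.+1).
Definition prefix_shape p m : bool -> nat -> nat := word_shape (drop (n - m) p).
(** Each box goes to the end of its row: its column is the length of the row before step [k]. This
    length is below [n] for words of length [n], where the default of [insubd] is not reached. *)
Definition filling_of_word p : filling n :=
  [ffun k => ((letter_at p k).1, (letter_at p k).2,
     insubd k (prefix_shape p k (letter_at p k).1 (letter_at p k).2))].

Lemma ballot_drop p m : ballot p -> ballot (drop m p).
Proof. by elim: p m => [|a p IH] [|m] //= /andP[_ /IH]. Qed.

Section OneWord.
Variables (p : seq letter).
Hypotheses (bp : ballot p) (sp : size p = n).
Local Notation T := (filling_of_word p).
Local Notation A := (prefix_shape p).

Lemma prefix_shapeS k : A k.+1 = add_box (A k) (letter_at p k).
Proof.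
rewrite /prefix_shape (drop_nth (false, k)); last by rewrite sp; have := ltn_ord k; lia.
by rewrite shape_cons /letter_at (_ : (n - k.+1).+1 = n - k) //; have := ltn_ord k; lia.
Qed.

Lemma prefix_shape_mono (i j : nat) d r : i <= j -> j <= n -> A i d r <= A j d r.
Proof.
move=> ij jn; rewrite /prefix_shape /word_shape.
rewrite (_ : n - i = (j - i) + (n - j)); last by lia.
by rewrite -drop_drop -[X in _ <= count _ X](cat_take_drop (j - i)) count_cat leq_addl.
Qed.

Lemma prefix_shape_nonincr m : nonincr (A m).
Proof. by have [] := rows_of_size_shape (ballot_drop (n - m) bp). Qed.

Lemma prefix_shape_full : A n = word_shape p.
Proof. by rewrite /prefix_shape subnn drop0. Qed.

Lemma filling_diag k : bdiag (T k) = (letter_at p k).1.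
Proof. by rewrite ffunE. Qed.
Lemma filling_row k : brow (T k) = (letter_at p k).2.
Proof. by rewrite ffunE. Qed.

Lemma filling_col k : bcol (T k) = A k (bdiag (T k)) (brow (T k)).
Proof.
rewrite filling_diag filling_row ffunE /bcol /= val_insubd ifT //.
rewrite /prefix_shape; apply: leq_ltn_trans (count_size _ _) _.
by rewrite size_drop sp; have := ltn_ord k; lia.
Qed.

Lemma filling_col_next k : A k.+1 (bdiag (T k)) (brow (T k)) = (bcol (T k)).+1.
Proof.
by rewrite filling_col prefix_shapeS /add_box filling_diag filling_row is_row_eq eqxx addn1.
Qed.

Lemma filling_col_lt i j : i < j -> bdiag (T i) = bdiag (T j) -> brow (T i) = brow (T j) ->
  bcol (T i) < bcol (T j).
Proof.
move=> ij dE rE; rewrite -filling_col_next [bcol (T j)]filling_col dE rE.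
by apply: prefix_shape_mono => //; exact: ltnW.
Qed.

Lemma filling_cover m d r c : m <= n -> c < A m d r ->
  exists k, [/\ k < m, bdiag (T k) = d, brow (T k) = r & bcol (T k) = c].
Proof.
elim: m => [|m IH] mn; first by rewrite /prefix_shape subn0 drop_oversize ?sp.
have [cm _|cm] := ltnP c (A m d r).
  by have [k [km ? ? ?]] := IH (ltnW mn) cm; exists k; split=> //; exact: ltnW.
pose k := Ordinal mn; rewrite (prefix_shapeS k) /add_box.
case E: (is_row _ d r); rewrite ?addn0 => lt; last by rewrite ltnNge cm in lt.
case/andP: E => /eqP dE /eqP rE; exists k; rewrite filling_col filling_diag filling_row -dE -rE.
by split=> //=; move: lt; rewrite addn1 ltnS => le; apply/eqP; rewrite eqn_leq cm le.
Qed.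

Lemma std_filling l : bipart_row l = word_shape p -> std l T.
Proof.
move=> lp; apply/andP; split.
  apply/andP; split.
    have nlt i j : T i = T j -> (i < j) = false.
      move=> E; apply/negP => /filling_col_lt; move: (T i) (T j) E => b c ->.
      by rewrite ltnn => /(_ erefl erefl).
    apply/injectiveP => i j E; apply: val_inj.
    by case: ltngtP (nlt i j E) (nlt j i (esym E)).
  apply/forallP => b; apply/eqP; rewrite in_shapeE lp -prefix_shape_full.
  apply/idP/codomP => [/(filling_cover (leqnn n))[k [_ dE rE cE]]|[k ->]].
    by exists k; apply: box_eqP.
  by rewrite -filling_col_next; apply: prefix_shape_mono.
apply/forallP => i; apply/forallP => j; apply/implyP => /andP[/eqP dE].
have [//|ji] := ltnP i j; case: (eqVneq i j) => [->|ij]; first by rewrite !ltnn !andbF.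
have {ij}ji : j < i by rewrite ltn_neqAle ji andbT eq_sym.
case/orP => /andP[/eqP E lt].
  by have := filling_col_lt ji (esym dE) (esym E); rewrite ltnNge ltnW.
(* The row of [i] is above that of [j], so it is at least as long at time [j.+1]; being added later,
   [i] lies strictly to the right of [j]. *)
suff : bcol (T j) < bcol (T i) by rewrite E ltnn.
rewrite -filling_col_next [bcol (T i)]filling_col -dE.
apply: leq_trans (prefix_shape_mono _ _ ji (ltnW (ltn_ord i))).
by apply: nonincr_le (ltnW lt); exact: prefix_shape_nonincr.
Qed.
End OneWord.

Lemma filling_of_word_inj p p' : size p = n -> size p' = n ->
  filling_of_word p = filling_of_word p' -> p = p'.
Proof.
move=> sp sp' E; have lE k : letter_at p k = letter_at p' k.
  move/ffunP/(_ k): E; rewrite !ffunE => -[E1 E2 _].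
  by rewrite [LHS]surjective_pairing E1 E2 -surjective_pairing.
case: p sp E lE => [|a p] sp E lE; first by apply/esym/size0nil; rewrite sp'; exact: esym sp.
apply: (@eq_from_nth _ a) => [|m]; rewrite ?sp // => mn.
have kn : n - m.+1 < n by lia.
have := lE (Ordinal kn); rewrite /letter_at /= (_ : n - (n - m.+1).+1 = m); last by lia.
by rewrite (set_nth_default a) ?sp // [RHS](set_nth_default a) ?sp'.
Qed.

Lemma exists_std l : 0 < n -> exists T, std l T.
Proof.
move=> n0; have [p [bp sp pl]] := exists_ballot (rows_of_size_bipart l n0).
by exists (filling_of_word p); apply: std_filling.
Qed.

Lemma std_pairs_count : exists s : seq (filling n * filling n),
  [/\ uniq s, size s = 2 ^ n * n`! &
      forall TU, TU \in s -> exists2 l, std l TU.1 & std l TU.2].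
Proof.
exists [seq (filling_of_word pp.1, filling_of_word pp.2) | pp <- ballot_pairs n].
rewrite size_map size_ballot_pairs; split=> //.
  rewrite map_inj_in_uniq ?uniq_ballot_pairs // => -[p p'] [u u'].
  case/ballot_pairsP => _ _ sp sp' _ /ballot_pairsP[_ _ su su' _] /= [E E'].
  by congr (_, _); apply: filling_of_word_inj.
move=> _ /mapP[[p p'] /ballot_pairsP[bp bp' sp sp' E] ->] /=.
have := rows_of_size_shape bp; rewrite sp => /exists_bipart[l lp].
by exists l; apply: std_filling; rewrite // lp.
Qed.
End BallotFilling.

(** * Faithfulness *)

Definition stab_of n (l : bipart n) (T : filling n) (sT : std l T) : stab l :=
  exist (fun U => is_tableau l U && is_standard U) T sT.

Section Faithful.
Variables (K : fieldType) (q : K) (n : nat).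
Hypothesis q_neq0 : q != 0.
Hypothesis q_exp1 : forall k : int, k != 0 -> q ^ k != 1.
Hypothesis q_expN1 : forall k : int, q ^ k != -1.
Local Notation act := (@seminormal_act _ _ _ q_neq0 q_exp1 q_expN1 _).

(* The hecke algebra is spanned by as many elements as there are matrix
   coefficients of the seminormal representations, and these are independent. *)
Lemma seminormal_faithful (h : hecke q n) :
  (forall l (v : seminormal_space K l), act h v = 0) -> h = 0.
Proof.
move=> h0; have [s [us ss sP]] := std_pairs_count n.
pose N := size s; pose pr (j : 'I_N) := tnth (in_tuple s) j.
have pr_inj : injective pr by apply/(tuple_uniqP (in_tuple s)).
have /choice[x xP] (j : 'I_N) : exists x : {l : bipart n & (stab l * stab l)%type},
    val (tagged x).1 = (pr j).1 /\ val (tagged x).2 = (pr j).2.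
  have [|l sT sU] := sP (pr j); first exact: mem_tnth.
  by exists (Tagged (fun l => (stab l * stab l)%type) (stab_of sT, stab_of sU)).
pose Q (a : hecke q n) (j : 'I_N) : K :=
  act a (basis_vec (tag (x j)) (pr j).2) (tagged (x j)).1.
have QD c a b j : Q (c *: a + b) j = c * Q a j + Q b j.
  by rewrite /Q snactD snactZ !ffunE.
have Qsum (I : finType) (c : I -> K) (a : I -> hecke q n) j :
    Q (\sum_i c i *: a i) j = \sum_i c i * Q (a i) j.
  elim/big_rec2: _ => [|i u w _ <-]; last by rewrite QD.
  by rewrite /Q (_ : act 0 _ = 0) ?ffunE // -[X in act X](scale0r (1 : hecke q n)) snactZ scale0r.
have std_x j : std (tag (x j)) (pr j).1 /\ std (tag (x j)) (pr j).2.
  by have [<- <-] := xP j; split; apply: valP.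
have /choice[e eP] (j : 'I_N) : exists e : hecke q n, forall j', Q e j' = (j == j')%:R.
  have [sT sU] := std_x j.
  have [e eP] := exists_mxunit q_neq0 q_exp1 q_expN1 sT sU; exists e => j'.
  rewrite /Q eP; last by have [] := std_x j'.
  have [E1 E2] := xP j'; rewrite !ffunE E1 /GRing.scale /= -natrM mulnb; congr ((nat_of_bool _)%:R).
  apply/andP/eqP => [[/eqP E /eqP E']|->]; last by rewrite !eqxx.
  by apply: pr_inj; rewrite [pr j]surjective_pairing [pr j']surjective_pairing E E'.
pose B := normal_words (@nat_gen K q n) n.
have span (a : hecke q n) := lspan_coef (hecke_span a).
pose M : 'M[K]_(size B, N) := \matrix_(i, j) Q B`_i j.
have /choice[c cP] (j : 'I_N) := span (e j).
have full : row_full M.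
  apply/row_fullP; exists (\matrix_(j, i) c j i); apply/matrixP => j j'.
  rewrite !mxE -(eP j j') (cP j) Qsum; apply: eq_bigr => i _.
  by rewrite !mxE.
(* The units [e] are dual to the coefficients [Q], which gives rank [N]; since [B] and [s] have
   equally many terms, [M] is square, so its rows are independent too. *)
have free : row_free M.
  by move: full; rewrite /row_full /row_free => /eqP ->; rewrite /N ss /B size_normal_words.
have [d dE] := span h.
have : (\row_i d i) *m M == 0.
  apply/eqP/matrixP => i j; rewrite !mxE.
  transitivity (Q h j); last by rewrite /Q h0 ffunE.
  by rewrite dE Qsum; apply: eq_bigr => k _; rewrite !mxE.
rewrite mulmx_free_eq0 // => /eqP d0; rewrite dE big1 // => i _.
by have /matrixP/(_ 0 i) := d0; rewrite !mxE => ->; rewrite scale0r.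
Qed.
End Faithful.

(** * The involution sharp *)

Section TableauStar.
Variable n : nat.
Implicit Types (T U : filling n) (l : bipart n) (i j k : 'I_n) (b : box n).

Definition box_star b : box n := (~~ bdiag b, b.1.2, b.2).
Definition tab_star T : filling n := [ffun k => box_star (T k)].

Lemma box_starK : involutive box_star.
Proof. by case=> -[d r] c; rewrite /box_star /bdiag /= negbK. Qed.

Lemma tab_starK : involutive tab_star.
Proof. by move=> T; apply/ffunP => k; rewrite !ffunE box_starK. Qed.

Lemma tab_star_diag T k : bdiag (tab_star T k) = ~~ bdiag (T k).
Proof. by rewrite ffunE. Qed.

Lemma content_star T k : content (tab_star T) k = content T k.
Proof. by rewrite /content /bcol /brow ffunE. Qed.

Lemma swap_star T i j : swap_entries (tab_star T) i j = tab_star (swap_entries T i j).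
Proof. by apply/ffunP => k; rewrite !ffunE. Qed.

Lemma tab_star_neq T U k : bdiag (T k) = bdiag (U k) -> (tab_star T == U) = false.
Proof. by move=> d; apply/eqP => E; move: d; rewrite -E tab_star_diag; case: bdiag. Qed.

Lemma bipart_swapK : involutive (@bipart_swap n).
Proof. by move=> l; apply: val_inj => /=; rewrite -surjective_pairing. Qed.

Lemma std_star l T : std (bipart_swap l) (tab_star T) = std l T.
Proof.
suff H l' U : std l' U -> std (bipart_swap l') (tab_star U).
  by apply/idP/idP => /H //; rewrite bipart_swapK tab_starK.
case/andP => /andP[/injectiveP Uinj /forallP sh] /forallP st; apply/andP; split.
  apply/andP; split.
    apply/injectiveP => i j; rewrite !ffunE => /(can_inj box_starK); exact: Uinj.
  apply/forallP => b; have -> : in_shape (bipart_swap l') b = in_shape l' (box_star b).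
    by rewrite /in_shape /= /box_star /bdiag /=; case: b.1.1.
  rewrite (eqP (sh _)); apply/eqP; apply/codomP/codomP => -[k].
    by move=> E; exists k; rewrite ffunE -E box_starK.
  by rewrite ffunE => ->; exists k; rewrite box_starK.
apply/forallP => i; apply/forallP => j; have /forallP/(_ j) := st i.
by rewrite /brow /bcol !tab_star_diag !ffunE /=; case: bdiag; case: bdiag.
Qed.

Lemma std_star_neq l T : bipart_swap l != l -> std l T -> ~~ std l (tab_star T).
Proof.
move=> ll sT; apply/negP => sT'; case/eqP: ll.
by apply: std_bipart_inj sT'; rewrite std_star.
Qed.
End TableauStar.

Section SharpTwist.
Variables (K : fieldType) (q : K) (n : nat).
Hypothesis q_neq0 : q != 0.
Hypothesis q_exp1 : forall k : int, k != 0 -> q ^ k != 1.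
Hypothesis q_expN1 : forall k : int, q ^ k != -1.
Implicit Types (T U W : filling n) (l m : bipart n) (i j k : 'I_n).
Local Notation act := (@seminormal_act _ _ _ q_neq0 q_exp1 q_expN1 _).
Local Notation V := (seminormal_space K).
Local Notation vv := (@basis_vec K n).
Local Notation xval := (@tab_val K q n).
Local Notation sharp := (@hecke_sharp K q n).

Lemma xval_star T k : xval (tab_star T) k = - xval T k.
Proof.
rewrite /tab_val content_star tab_star_diag -mulNr; congr (_ * _).
by case: bdiag; rewrite /usign ?opprK.
Qed.

(** With the target shape as a parameter, a symmetric [l] gets an endomorphism without transport
    along [bipart_swap l = l]. If [m] is not the swap of [l], the map is zero. *)
Definition sigma_fun l m (f : V l) : V m := \sum_(t : stab l) (f t : K) *: vv m (tab_star (val t)).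

Fact sigma_fun_linear l m : linear (@sigma_fun l m).
Proof.
move=> c f g; rewrite /sigma_fun scaler_sumr -big_split; apply: eq_bigr => t _.
by rewrite !ffunE scalerDl scalerA.
Qed.

Definition sigma l m : 'Hom(V l, V m) := linfun (@sigma_fun l m).

Lemma sigmaE l m f : sigma l m f = \sum_(t : stab l) (f t : K) *: vv m (tab_star (val t)).
Proof.
pose L := HB.pack (@sigma_fun l m)
  (GRing.isLinear.Build K (V l) (V m) _ _ (@sigma_fun_linear l m)) : {linear V l -> V m}.
exact: (lfunE L).
Qed.

Lemma sigma_vec l m T : std l T -> sigma l m (vv l T) = vv m (tab_star T).
Proof.
move=> sT; rewrite sigmaE (bigD1 (stab_of sT)) //= ffunE eqxx scale1r big1 ?addr0 // => u.
by rewrite -val_eqE /= => /negbTE uT; rewrite ffunE uT scale0r.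
Qed.

Lemma seminormal_ind l (P : V l -> Prop) : P 0 ->
    (forall c u v, P u -> P v -> P (c *: u + v)) ->
    (forall T, std l T -> P (vv l T)) -> forall v, P v.
Proof.
move=> P0 PD PT v; rewrite (seminormal_expand v).
by elim/big_rec: _ => // t u _ Pu; apply: PD => //; apply: PT; apply: (valP t).
Qed.

Lemma sigmaK l v : sigma (bipart_swap l) l (sigma l (bipart_swap l) v) = v.
Proof.
move: v; apply: seminormal_ind => [|c u v IHu IHv|T sT]; first by rewrite !linear0.
  by rewrite !linearP /= IHu IHv.
by rewrite !sigma_vec ?std_star // tab_starK.
Qed.

Lemma sigmaP l m c u v : sigma l m (c *: u + v) = c *: sigma l m u + sigma l m v.
Proof. exact: (linearP (sigma l m)). Qed.
Lemma sharpP c x y : sharp (c *: x + y) = c *: sharp x + sharp y.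
Proof. exact: (linearP (hecke_sharp (q := q) (n := n))). Qed.
Lemma sharpM x y : sharp (x * y) = sharp x * sharp y.
Proof. exact: (rmorphM (hecke_sharp (q := q) (n := n))). Qed.

(** Exchanging the diagrams negates every [xval]. The first generator changes sign, as under sharp;
    the coefficients of the others are homogeneous of degree 0 in these values and do not change. *)
Lemma sigma_act l m x v : m = bipart_swap l ->
  sigma l m (act (sharp x) v) = act x (sigma l m v).
Proof.
move=> {m}->; move: v; elim/hecke_words_ind: x => [c x y IHx IHy|||x i IHx] v.
- rewrite sharpP. rewrite snactD. rewrite snactZ. rewrite sigmaP.  rewrite (IHx v). rewrite (IHy v). rewrite [RHS]snactD. rewrite snactZ. by [].
- by rewrite (linear0 (hecke_sharp (q := q) (n := n))) !snact0 linear0.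
- by rewrite (rmorph1 (hecke_sharp (q := q) (n := n))) !snact1.
rewrite sharpM !snactM IHx; congr (act x _); rewrite hecke_sharp_gen.
move: v; apply: seminormal_ind => [|c u v IHu IHv|T sT]; first by rewrite !(snactv0, linear0).
  by rewrite !(snactvP, sigmaP) IHu IHv.
have sT' : std (bipart_swap l) (tab_star T) by rewrite std_star.
rewrite sigma_vec // [RHS]act_gen; case: (posnP i) => [i0|i0].
  rewrite -scaleN1r snactZ act_gen !(gen_step0 _ _ i0) // scalerA linearZ /= sigma_vec //.
  by rewrite tab_star_diag; case: bdiag; rewrite /usign /= ?mulrNN ?mulr1 ?mulN1r.

have ij : i = (pred_entry i).+1 :> nat by rewrite /= prednK.
move: (pred_entry i) ij => j ij.
rewrite act_gen (gen_step q_neq0 q_exp1 q_expN1 sT ij) (gen_step q_neq0 q_exp1 q_expN1 sT' ij).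
rewrite linearP linearZ /= sigma_vec // swap_star !xval_star.
have -> a b : diag_coef q (- a) (- b) = diag_coef q a b.
  by rewrite /diag_coef mulrN -opprD invrN mulrNN.
have -> a b : off_coef q (- a) (- b) = off_coef q a b.
  by rewrite /off_coef mulrN -!opprD invrN mulrNN.
congr (_ + _ *: _).
have [sS|nS] := boolP (std l (swap_entries T j i)); first by rewrite sigma_vec.
by rewrite !basis_vec_nonstd ?std_star // linear0.
Qed.

Lemma fixed_sigma l (h : hecke_fixed q n) v :
  sigma l (bipart_swap l) (act h v) = act h (sigma l (bipart_swap l) v).
Proof.
rewrite -sigma_act //; have := hecke_fixedP h; rewrite inE => /eqP ->.
by [].
Qed.

(** [sharp e] is [e] conjugated by [sigma], so it is the matrix unit at the two starred tableaux. *)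
Lemma act_sharp l l' (e : hecke q n) T U : std l T -> std l U ->
    (forall l' W, std l' W -> act e (vv l' W) = (W == U)%:R *: vv l' T) ->
  forall W, std l' W -> act (sharp e) (vv l' W) = (tab_star W == U)%:R *: vv l' (tab_star T).
Proof.
move=> sT sU eE W sW; rewrite -[LHS]sigmaK sigma_act // sigma_vec // eE ?std_star //.
rewrite linearZ /=; case: eqP => [E|]; last by rewrite !scale0r.
rewrite sigma_vec //; suff -> : bipart_swap l' = l by [].
by apply: std_bipart_inj sU; rewrite -E std_star.
Qed.

Lemma sharp_sym_fixed (e : hecke q n) : e + sharp e \in @sharp_fixed K q n.
Proof. by rewrite inE linearD /= hecke_sharpK addrC. Qed.

Lemma exists_fixed_unit T U : exists b : hecke_fixed q n, forall l, std l T -> std l U ->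
  forall l' W, std l' W ->
  act b (vv l' W) = (W == U)%:R *: vv l' T + (tab_star W == U)%:R *: vv l' (tab_star T).
Proof.
have [[l sT sU]|no] := pselect (exists2 l, std l T & std l U); last first.
  (* Without a common shape the claim is vacuous; the element is chosen before the shape so that it
     depends on [T] and [U] alone. *)
  by exists 0 => l sT sU; case: no; exists l.
have [e eE] := exists_mxunit q_neq0 q_exp1 q_expN1 sT sU.
exists (HeckeFixed (sharp_sym_fixed e)) => _ _ _ l' W sW /=.
by rewrite snactD eE // (act_sharp sT sU eE).
Qed.

(** [sigma] carries the action of a fixed element from one shape to the swapped one, so one shape of
    each pair decides. *)
Lemma fixed_faithful (P : pred (bipart n)) (h : hecke_fixed q n) :
    (forall l, P l || P (bipart_swap l)) ->
    (forall l (v : V l), P l -> act h v = 0) -> h = 0.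
Proof.
move=> Pl h0; apply: val_inj => /=.
apply: (seminormal_faithful (q_neq0 := q_neq0) (q_exp1 := q_exp1) (q_expN1 := q_expN1)) => l v.
case/orP: (Pl l) => Pll; first exact: h0.
by rewrite -[LHS]sigmaK fixed_sigma h0 // linear0.
Qed.

Definition tau l := sigma l l.

(** The subrepresentations of the theorem are families over all shapes, so this has to hold for
    every [l]; off the symmetric shapes [tau] is zero. *)
Lemma tau_act l (h : hecke_fixed q n) v : tau l (act h v) = act h (tau l v).
Proof.
have [E|ll] := eqVneq l (bipart_swap l).
  rewrite /tau -(sigma_act _ _ E); congr (sigma l l (act _ _)).
  by have := hecke_fixedP h; rewrite inE => /eqP ->.
suff t0 u : tau l u = 0 by rewrite !t0 snactv0.
move: u; apply: seminormal_ind => [|c u w IHu IHw|T sT]; first by rewrite linear0.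
  by rewrite linearP /= IHu IHw scaler0 addr0.
by rewrite /tau sigma_vec // basis_vec_nonstd // std_star_neq // eq_sym.
Qed.

Lemma tauK l v : bipart_swap l = l -> tau l (tau l v) = v.
Proof. by move=> E; have := @sigmaK l v; rewrite E. Qed.

Lemma tau_gen0 l i v : bipart_swap l = l -> i = 0%N :> nat ->
  tau l (act (hecke_gen q i) v) = - act (hecke_gen q i) (tau l v).
Proof.
move=> E i0; rewrite -(sigma_act _ _ (esym E)) hecke_sharp_gen i0 /= -[- hecke_gen _ _]scaleN1r.
by rewrite snactZ linearZ /= scaleN1r opprK.
Qed.

Lemma gen0K l i (v : V l) : i = 0%N :> nat -> act (hecke_gen q i) (act (hecke_gen q i) v) = v.
Proof. by move=> i0; rewrite -snactM (hecke_genP (HeckeSq _ _ i0)) snact1. Qed.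
End SharpTwist.

(** * Representations of the fixed subalgebra *)

Section SharpReps.
Variables (K : fieldType) (q : K) (n : nat).
Hypothesis q_neq0 : q != 0.
Hypothesis q_exp1 : forall k : int, k != 0 -> q ^ k != 1.
Hypothesis q_expN1 : forall k : int, q ^ k != -1.
Hypothesis n_gt0 : (0 < n)%N.
Implicit Types (T U W : filling n) (l m : bipart n) (b : bool).
Local Notation act := (@seminormal_act _ _ _ q_neq0 q_exp1 q_expN1 _).
Local Notation V := (seminormal_space K).
Local Notation vv := (@basis_vec K n).
Local Notation R l := (res_sharp (hecke_rep (seminormal_eqs l q_neq0 q_exp1 q_expN1))).
Let k0 : 'I_n := Ordinal n_gt0.
Local Notation tau := (@tau K n _).

(** The exponent 0 in the hypothesis that -1 is not a power of [q]. *)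
Lemma two_neq0 : 2%:R != 0 :> K.
Proof.
have := q_expN1 0; rewrite expr0z; apply: contraNneq => E.
by rewrite -subr_eq0 opprK -[1 + 1]/(2%:R : K) E.
Qed.

Definition eps b : K := if b then 1 else -1.
Lemma epsM b : eps b * eps b = 1.
Proof. by case: b; rewrite /eps ?mulrNN mulr1. Qed.
Lemma epsN b : eps (~~ b) = - eps b.
Proof. by case: b; rewrite /eps ?opprK. Qed.

Lemma RE l (h : hecke_fixed q n) (v : V l) : R l h v = act h v.
Proof. by rewrite snactE. Qed.

Definition eigen_tau b l : {vspace V l} := lker (sigma K l l - eps b *: \1)%VF.

Lemma mem_eigen_tau b l v : (v \in eigen_tau b l) = (tau v == eps b *: v).
Proof. by rewrite memv_ker add_lfunE opp_lfunE scale_lfunE id_lfunE subr_eq0. Qed.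

Lemma eigen_tauP b l v : reflect (tau v = eps b *: v) (v \in eigen_tau b l).
Proof. by rewrite mem_eigen_tau; apply: eqP. Qed.

Lemma tauP l c (u v : V l) : tau (c *: u + v) = c *: tau u + tau v.
Proof. exact: sigmaP. Qed.

Fact eigen_tau_stable b l : @rstable _ _ (R l) (eigen_tau b l).
Proof.
move=> h; apply/subvP => _ /memv_imgP[v /eigen_tauP vE ->]; apply/eigen_tauP.
by rewrite RE tau_act vE snactvZ.
Qed.

Definition sharp_half b l : subrep (R l) := SubRep (@eigen_tau_stable b l).

Definition half_vec b l T : V l := vv l T + eps b *: vv l (tab_star T).

Lemma tau_vec l T : std l T -> tau (vv l T) = vv l (tab_star T).
Proof. exact: sigma_vec. Qed.

Lemma std_star_sym l T : bipart_swap l = l -> std l (tab_star T) = std l T.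
Proof. by move=> E; rewrite -{1}E std_star. Qed.

Lemma half_vec_mem b l T : bipart_swap l = l -> std l T -> half_vec b l T \in eigen_tau b l.
Proof.
move=> E sT; apply/eigen_tauP; rewrite /half_vec addrC tauP !tau_vec ?std_star_sym // tab_starK.
by rewrite scalerDr scalerA epsM scale1r addrC.
Qed.

Lemma coord_star l (v : V l) (t u : stab l) : bipart_swap l = l -> val u = tab_star (val t) ->
  (tau v) t = v u.
Proof.
move=> E ut; move: v; apply: seminormal_ind => [|c x y IHx IHy|T sT].
- by rewrite linear0 !ffunE.
- by rewrite tauP !ffunE IHx IHy.
- by rewrite tau_vec // !ffunE ut (can2_eq (@tab_starK n) (@tab_starK n)).
Qed.

(* One tableau from each pair T, T^*. *)
Definition half_tab l : finType := {t : stab l | ~~ bdiag (val t k0)}.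

Lemma half_tab_std l (x : half_tab l) : std l (val (val x)).
Proof. exact: (valP (val x)). Qed.

Lemma star_half_tab l (x y : half_tab l) : (tab_star (val (val x)) == val (val y)) = false.
Proof. by apply: (@tab_star_neq _ _ _ k0); rewrite (negbTE (valP x)) (negbTE (valP y)). Qed.

Lemma half_vecE c b l T (t : stab l) : (c *: half_vec b l T) t =
  c * ((val t == T)%:R + eps b * (val t == tab_star T)%:R).
Proof. by rewrite !ffunE. Qed.

Lemma half_vec_coord b l (x y : half_tab l) :
  half_vec b l (val (val x)) (val y) = (x == y)%:R.
Proof.
rewrite -[half_vec _ _ _]scale1r half_vecE [_ == tab_star _]eq_sym star_half_tab.
by rewrite mulr0 addr0 mul1r [val (val y) == _]eq_sym.
Qed.

(** The eigenvalue equation ties the coordinate at a starred tableau to the one at the tableau, so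
    the coordinates at the representatives determine [v]. *)
Lemma half_vec_expand b l (v : V l) : bipart_swap l = l -> v \in eigen_tau b l ->
  v = \sum_(x : half_tab l) (v (val x) : K) *: half_vec b l (val (val x)).
Proof.
move=> E /eigen_tauP vE; apply/ffunP => t; rewrite sum_ffunE.
have key (x : half_tab l) : val (val x) = val t \/ val (val x) = tab_star (val t) ->
    v t = \sum_(x : half_tab l) ((v (val x) : K) *: half_vec b l (val (val x))) t.
  move=> H; rewrite (bigD1 x) //= big1 ?addr0 => [|y yx].
    rewrite half_vecE; case: H => H.
      rewrite -H eqxx eq_sym star_half_tab mulr0 addr0 mulr1; congr (v _); apply: val_inj.
      exact: esym H.
    rewrite -[val t]tab_starK -H star_half_tab eqxx add0r mulr1.
    have -> : v (val x) = tau v t by rewrite (coord_star _ E H).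
    by rewrite vE !ffunE /GRing.scale /= mulrC mulrA epsM mul1r.
  rewrite half_vecE.
  have {}yx : (val (val y) == val (val x)) = false by rewrite !val_eqE (negbTE yx).
  case: H => H.
    by rewrite -H eq_sym yx [_ == tab_star _]eq_sym star_half_tab mulr0 addr0 mulr0.
  rewrite -[val t]tab_starK -H star_half_tab (inj_eq (can_inj (@tab_starK n))) eq_sym yx.
  by rewrite mulr0 addr0 mulr0.
have [d|d] := boolP (bdiag (val t k0)); last by apply: (key (exist _ t d)); left.
have sT : std l (tab_star (val t)) by rewrite std_star_sym //; apply: (valP t).
have d' : ~~ bdiag (val (stab_of sT) k0) by rewrite /= tab_star_diag d.
by apply: (key (exist _ (stab_of sT) d')); right.
Qed.

Lemma eigen_tau_split l (v : V l) : bipart_swap l = l ->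
  exists2 u, u \in eigen_tau true l & exists2 w, w \in eigen_tau false l & v = u + w.
Proof.
move=> E; exists (2%:R^-1 *: (tau v + v)).
  apply/eigen_tauP; rewrite linearZ linearD /= tauK // scale1r addrC //.
exists (2%:R^-1 *: (v - tau v)).
  by apply/eigen_tauP; rewrite linearZ linearB /= tauK // scaleN1r -scalerN opprB.
rewrite -scalerDr [tau v + v]addrC addrACA subrr addr0 -mulr2n -scaler_nat scalerA mulVf ?two_neq0 //.
by rewrite scale1r.
Qed.

Lemma eigen_tau_add l : bipart_swap l = l ->
  (eigen_tau true l + eigen_tau false l)%VS = fullv.
Proof.
move=> E; apply/eqP; rewrite eqEsubv subvf; apply/subvP => v _.
by have [u up [w wm ->]] := eigen_tau_split v E; apply: memv_add.
Qed.

Lemma eigen_tau_cap l : (eigen_tau true l :&: eigen_tau false l)%VS = 0%VS.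
Proof.
apply/eqP; rewrite -subv0; apply/subvP => v; rewrite memv_cap.
case/andP => /eigen_tauP v1 /eigen_tauP v2.
rewrite memv0; move: v1; rewrite v2 scale1r scaleN1r => /eqP; rewrite eq_sym -addr_eq0.
by rewrite -mulr2n -scaler_nat scaler_eq0 (negbTE two_neq0).
Qed.

Lemma sharp_half_direct l : bipart_swap l = l ->
  direct_sum_decomp (sharp_half true l) (sharp_half false l).
Proof. by move=> E; split; [exact: eigen_tau_add|exact: eigen_tau_cap]. Qed.

(** The first generator squares to 1, hence is injective, and it anticommutes with [tau], hence maps
    each eigenspace into the other. *)
Lemma dim_eigen_tau b l : bipart_swap l = l ->
  (\dim (eigen_tau b l) <= \dim (eigen_tau (~~ b) l))%N.
Proof.
move=> E; have [f fE] : exists f : 'End(V l), forall v, f v = act (hecke_gen q k0) v.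
  by exists (seminormal_gen q l k0) => v; rewrite act_gen.
have inj : lker f = 0%VS.
  apply/eqP/lker0P => u v; rewrite !fE => /(congr1 (fun v => act (hecke_gen q k0) v)).
  by rewrite !gen0K.
have dimf : \dim (f @: eigen_tau b l) = \dim (eigen_tau b l).
  by apply: limg_dim_eq; rewrite inj capv0.
apply: leq_trans (eq_leq (esym dimf)) _; apply/dimvS/subvP => _ /memv_imgP[v /eigen_tauP vE ->]; apply/eigen_tauP.
by rewrite fE tau_gen0 // vE snactvZ epsN scaleNr.
Qed.

Lemma rdeg_sharp_half b l : bipart_swap l = l ->
  (rdeg (rep_of_sub (sharp_half b l)) * 2 = rdeg (R l))%N.
Proof.
move=> E; have -> : rdeg (R l) = (\dim (eigen_tau true l) + \dim (eigen_tau false l))%N.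
  by rewrite -(dimv_disjoint_sum (eigen_tau_cap l)) eigen_tau_add.
have -> : rdeg (rep_of_sub (sharp_half b l)) = \dim (eigen_tau b l) by exact: dimvf.
have := dim_eigen_tau true E; have := dim_eigen_tau false E; case: b => /=; lia.
Qed.
End SharpReps.

(** Fillings form a finite type; each determines at most one shape, and every shape has a standard
    filling. *)
Lemma bipart_enum n : (0 < n)%N -> exists s : seq (bipart n), forall l, l \in s.
Proof.
move=> n0; have /choice[f fP] (T : filling n) : exists o, forall l : bipart n, std l T -> o = Some l.
  have [[l sT]|no] := pselect (exists l : bipart n, std l T).
    by exists (Some l) => l' sT'; rewrite (std_bipart_inj sT sT').
  by exists None => l sT; case: no; exists l.
exists (pmap f (enum {: filling n})) => l; have [T sT] := exists_std l n0.
by rewrite mem_pmap -(fP T l sT) map_f // mem_enum.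
Qed.

(** * Matrix units of the fixed subalgebra *)

Section SharpBasicSet.
Variables (K : fieldType) (q : K) (n : nat).
Hypothesis q_neq0 : q != 0.
Hypothesis q_exp1 : forall k : int, k != 0 -> q ^ k != 1.
Hypothesis q_expN1 : forall k : int, q ^ k != -1.
Hypothesis n_gt0 : (0 < n)%N.
Implicit Types (T U W : filling n) (l m : bipart n) (b : bool).
Local Notation act := (@seminormal_act _ _ _ q_neq0 q_exp1 q_expN1 _).
Local Notation V := (seminormal_space K).
Local Notation vv := (@basis_vec K n).
Local Notation R l := (res_sharp (hecke_rep (seminormal_eqs l q_neq0 q_exp1 q_expN1))).
Local Notation half := (@sharp_half K q n q_neq0 q_exp1 q_expN1).
Local Notation tab l := (half_tab n_gt0 l).
Local Notation hv b l x := (half_vec K b l (val (val x))).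

Lemma fixed_unit_key : exists f : filling n -> filling n -> hecke_fixed q n,
  forall T U l, std l T -> std l U -> forall l' W, std l' W ->
  act (f T U) (vv l' W) = (W == U)%:R *: vv l' T + (tab_star W == U)%:R *: vv l' (tab_star T).
Proof.
have /choice[f fP] (TU : filling n * filling n) :=
  exists_fixed_unit q_neq0 q_exp1 q_expN1 TU.1 TU.2.
by exists (fun T U => f (T, U)) => T U; apply: (fP (T, U)).
Qed.

Definition fixed_unit := sval (cid fixed_unit_key).

Lemma fixed_unitE T U l l' W : std l T -> std l U -> std l' W ->
  act (fixed_unit T U) (vv l' W) =
  (W == U)%:R *: vv l' T + (tab_star W == U)%:R *: vv l' (tab_star T).
Proof. by move=> sT sU; apply: (svalP (cid fixed_unit_key) T U l). Qed.

(** On [half_vec] of [U] with sign [b'] the first term gives that of [T], and the second gives it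
    times [eps b * eps b']; the half-sum is 1 for equal signs and 0 for opposite ones. *)
Definition half_unit b T U : hecke_fixed q n :=
  2%:R^-1 *: (fixed_unit T U + eps K b *: fixed_unit T (tab_star U)).

Lemma half_unitE b T U l (v : V l) : act (half_unit b T U) v =
  2%:R^-1 *: (act (fixed_unit T U) v + eps K b *: act (fixed_unit T (tab_star U)) v).
Proof. by rewrite /half_unit /= snactZ snactD snactZ. Qed.

Lemma fixed_unit_other T U l l' (v : V l') : std l T -> std l U ->
  l' != l -> bipart_swap l' != l -> act (fixed_unit T U) v = 0.
Proof.
move=> sT sU ll sll; move: v; apply: seminormal_ind => [|c u v IHu IHv|W sW].
- exact: snactv0.
- by rewrite snactvP IHu IHv scaler0 addr0.
rewrite (fixed_unitE sT sU sW).
have [E|_] := eqVneq W U.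
  by case/eqP: ll; apply: std_bipart_inj sU; rewrite -E.
have [E|_] := eqVneq (tab_star W) U; last by rewrite !scale0r addr0.
by case/eqP: sll; apply: std_bipart_inj sU; rewrite -E std_star.
Qed.

Lemma fixed_unit_same T U l W : bipart_swap l != l -> std l T -> std l U -> std l W ->
  act (fixed_unit T U) (vv l W) = (U == W)%:R *: vv l T.
Proof.
move=> ll sT sU sW; rewrite (fixed_unitE sT sU sW) [U == W]eq_sym.
have [E|_] := eqVneq (tab_star W) U; last by rewrite scale0r addr0.
by case/negP: (std_star_neq ll sW); rewrite E.
Qed.

Lemma half_unit_half b b' l (x y z : tab l) : bipart_swap l = l ->
  act (half_unit b (val (val x)) (val (val y))) (hv b' l z) =
  ((b == b') && (y == z))%:R *: hv b l x.
Proof.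
move=> E; have sx := half_tab_std x; have sy := half_tab_std y; have sz := half_tab_std z.
have sy' : std l (tab_star (val (val y))) by rewrite std_star_sym.
have sz' : std l (tab_star (val (val z))) by rewrite std_star_sym.
have e1 : (val (val z) == val (val y)) = (y == z) by rewrite eq_sym !val_eqE.
have star_inj := inj_eq (can_inj (@tab_starK n)).
have -> : hv b' l z = eps K b' *: vv l (tab_star (val (val z))) + vv l (val (val z)).
  by rewrite /half_vec addrC.
rewrite half_unitE !snactvP.
rewrite !(fixed_unitE sx sy) // !(fixed_unitE sx sy') // !tab_starK !star_inj.
rewrite !e1 [_ == tab_star (val (val y))]eq_sym !star_half_tab !scale0r !addr0 !add0r.
have h2 : 2%:R != 0 :> K := two_neq0 q_expN1.
case: (y == z); last by rewrite andbF !scale0r !(scaler0, addr0).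
rewrite andbT !scale1r; apply/ffunP => t; rewrite !ffunE /GRing.scale /=.
by case: b; case: b'; rewrite /eps /=; field.
Qed.

Lemma sharp_half_act b l h (u : subvs_of (half b l)) :
  vsval (rep_of_sub (half b l) h u) = act h (vsval u).
Proof. by rewrite [LHS]subrep_actE RE. Qed.
End SharpBasicSet.

Section SharpFamilyUnits.
Variables (K : fieldType) (q : K) (n : nat).
Hypothesis q_neq0 : q != 0.
Hypothesis q_exp1 : forall k : int, k != 0 -> q ^ k != 1.
Hypothesis q_expN1 : forall k : int, q ^ k != -1.
Hypothesis n_gt0 : (0 < n)%N.
Variable L : {pred bipart n}.
Hypothesis L_choice : swap_choice L.
Local Notation act := (@seminormal_act _ _ _ q_neq0 q_exp1 q_expN1 _).
Local Notation V := (seminormal_space K).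
Local Notation vv := (@basis_vec K n).
Local Notation R l := (res_sharp (hecke_rep (seminormal_eqs l q_neq0 q_exp1 q_expN1))).
Local Notation half := (@sharp_half K q n q_neq0 q_exp1 q_expN1).
Local Notation tab l := (half_tab n_gt0 l).
Local Notation hv b l x := (half_vec K b l (val (val x))).
Local Notation funit := (fixed_unit q_neq0 q_exp1 q_expN1).
Local Notation hunit := (half_unit q_neq0 q_exp1 q_expN1).
Local Notation I := ({l : bipart n | l \in L} + {l : bipart n | bipart_swap l == l} * bool)%type.

(** The sign is matched, not passed on to [half], so that this family is convertible to
    [sharp_family] taken at the two halves. *)
Definition sharp_rep (i : I) : algrep (hecke_fixed q n) :=
  match i with
  | inl l => R (val l)
  | inr (l, true) => rep_of_sub (half true (val l))
  | inr (l, false) => rep_of_sub (half false (val l))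
  end.

Definition sharp_basis (i : I) : finType :=
  match i with inl l => stab (val l) | inr (l, _) => tab (val l) end.

Definition sharp_vec (i : I) : sharp_basis i -> rspace (sharp_rep i) :=
  match i with
  | inl l => fun t => vv (val l) (val t)
  | inr (l, true) => fun t => vsproj (half true (val l)) (hv true (val l) t)
  | inr (l, false) => fun t => vsproj (half false (val l)) (hv false (val l) t)
  end.

Definition sharp_coord (i : I) : rspace (sharp_rep i) -> sharp_basis i -> K :=
  match i with
  | inl l => fun (v : V (val l)) t => v t
  | inr (l, true) => fun (v : subvs_of (half true (val l))) t => (vsval v : V (val l)) (val t)
  | inr (l, false) => fun (v : subvs_of (half false (val l))) t => (vsval v : V (val l)) (val t)
  end.

Definition sharp_unit (i : I) : sharp_basis i -> sharp_basis i -> hecke_fixed q n :=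
  match i with
  | inl l => fun t u => funit (val t) (val u)
  | inr (l, b) => fun t u => hunit b (val (val t)) (val (val u))
  end.

Lemma choice_neq l : l \in L -> bipart_swap l != l.
Proof. by move=> lL; apply/eqP => E; have := L_choice l; rewrite E eqxx lL. Qed.

Lemma choice_swap l : l \in L -> bipart_swap l \notin L.
Proof.
by move=> lL; have := L_choice l; rewrite (negbTE (choice_neq lL)) lL; case: (_ \in L).
Qed.

Lemma sharp_coord_linear i x c (u v : rspace (sharp_rep i)) :
  sharp_coord (c *: u + v) x = c * sharp_coord u x + sharp_coord v x.
Proof.
by move: x u v; case: i => [l|[l []]] x u v; rewrite /sharp_coord /= ?linearP !ffunE.
Qed.

Lemma half_vec_proj b l (x : tab l) : bipart_swap l = l ->
  vsval (vsproj (half b l) (hv b l x)) = hv b l x.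
Proof. by move=> E; apply: vsprojK; apply: half_vec_mem => //; apply: half_tab_std. Qed.

Lemma half_expand b l (v : subvs_of (half b l)) : bipart_swap l = l ->
  v = \sum_(x : tab l) ((vsval v : V l) (val x) : K) *: vsproj (half b l) (hv b l x).
Proof.
move=> E; apply: subvs_inj; rewrite linear_sum.
rewrite {1}(half_vec_expand n_gt0 E (subvsP v)); apply: eq_bigr => x _.
by rewrite linearZ /= half_vec_proj.
Qed.

Lemma sharp_coord_expand i (v : rspace (sharp_rep i)) :
  v = \sum_x sharp_coord v x *: sharp_vec x.
Proof.
move: v; case: i => [l|[l []]] v; first exact: seminormal_expand.
  by apply: half_expand; exact/eqP/(valP l).
by apply: half_expand; exact/eqP/(valP l).
Qed.

Lemma sharp_coord_vec i (x y : sharp_basis i) : sharp_coord (sharp_vec x) y = (x == y)%:R.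
Proof.
move: x y; case: i => [l|[l []]] x y; rewrite /sharp_coord /sharp_vec.
- by rewrite ffunE val_eqE eq_sym.
- by rewrite half_vec_proj ?half_vec_coord //; exact/eqP/(valP l).
- by rewrite half_vec_proj ?half_vec_coord //; exact/eqP/(valP l).
Qed.

Lemma half_unit_proj b b' l (x y z : tab l) : bipart_swap l = l ->
  rep_of_sub (half b' l) (hunit b (val (val x)) (val (val y))) (vsproj (half b' l) (hv b' l z)) =
  ((b == b') && (y == z))%:R *: vsproj (half b' l) (hv b' l x).
Proof.
move=> E; apply: subvs_inj; rewrite sharp_half_act half_vec_proj // half_unit_half //.
rewrite [RHS]linearZ /= half_vec_proj //.
by case: eqP => [->|] //=; rewrite !scale0r.
Qed.

Lemma sharp_unit_vec i (x y z : sharp_basis i) :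
  sharp_rep i (sharp_unit x y) (sharp_vec z) = (y == z)%:R *: sharp_vec x.
Proof.
move: x y z; case: i => [l|[l []]] x y z.
- rewrite /sharp_rep /sharp_unit /sharp_vec RE.
  rewrite (fixed_unit_same _ _ _ (choice_neq (valP l)) (valP x) (valP y) (valP z)).
  by rewrite val_eqE.
- by rewrite [LHS]half_unit_proj //; exact/eqP/(valP l).
- by rewrite [LHS]half_unit_proj //; exact/eqP/(valP l).
Qed.

Lemma sub_act0 b l (h : hecke_fixed q n) : (forall v : V l, act h v = 0) -> rep_of_sub (half b l) h = 0.
Proof.
move=> h0; apply/lfunP => v; rewrite zero_lfunE.
by apply: subvs_inj; rewrite sharp_half_act h0 linear0.
Qed.

Lemma half_unit_other b (l l' : bipart n) T U (v : V l') : bipart_swap l = l -> std l T -> std l U ->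
  l' != l -> bipart_swap l' != l -> act (hunit b T U) v = 0.
Proof.
move=> E sT sU ll sll; have sU' : std l (tab_star U) by rewrite std_star_sym.
by rewrite half_unitE !(fixed_unit_other q_neq0 q_exp1 q_expN1 v sT) // !scaler0 addr0 scaler0.
Qed.

Lemma half_unit_sign b b' l (x y : tab l) : bipart_swap l = l -> b != b' ->
  rep_of_sub (half b' l) (hunit b (val (val x)) (val (val y))) = 0.
Proof.
move=> E bb; apply/lfunP => v; rewrite zero_lfunE (half_expand v E) linear_sum big1 // => z _.
by rewrite linearZ /= half_unit_proj // (negbTE bb) scale0r scaler0.
Qed.

Lemma rep_act0 l (h : hecke_fixed q n) : (forall v : V l, act h v = 0) -> R l h = 0.
Proof. by move=> h0; apply/lfunP => v; rewrite zero_lfunE RE h0. Qed.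

(** A fixed unit acts only on its own shape and on the swapped one, of which [L] contains at most
    one; on a common symmetric shape the signs in [half_unit] separate the halves. *)
Lemma sharp_unit_other i j (x y : sharp_basis i) : i != j -> sharp_rep j (sharp_unit x y) = 0.
Proof.
have sym (m : {l : bipart n | bipart_swap l == l}) : bipart_swap (val m) = val m.
  exact/eqP/(valP m).
have neqL (l : {l | l \in L}) (m : {l | bipart_swap l == l}) : val m != val l.
  by apply: contraNneq (choice_neq (valP l)) => E; rewrite -E sym.
case: i x y => [l|[l b]] x y; case: j => [m|[m b']] ij.
- apply: rep_act0 => v; apply: (fixed_unit_other q_neq0 q_exp1 q_expN1 v (valP x) (valP y)).
    by apply: contraNneq ij => E; apply/eqP; congr inl; apply: val_inj.
  by apply: contraNneq (choice_swap (valP m)) => ->; apply: valP.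
- have H : forall v : V (val m), act (funit (val x) (val y)) v = 0.
    move=> v; apply: (fixed_unit_other q_neq0 q_exp1 q_expN1 v (valP x) (valP y)) => //.
    by rewrite sym.
  by move: H {ij}; case: b' => H; apply: sub_act0.
- apply: rep_act0 => v; apply: (half_unit_other _ _ (sym l) (half_tab_std x) (half_tab_std y)).
    by rewrite eq_sym.
  by apply: contraNneq (neqL m l) => E; rewrite -[val m]bipart_swapK E sym.
- have [E|lm] := eqVneq (val m) (val l); last first.
    have H v : act (hunit b (val (val x)) (val (val y))) (v : V (val m)) = 0.
      apply: (half_unit_other _ _ (sym l) (half_tab_std x) (half_tab_std y)) => //.
      by rewrite sym.
    by move: H {ij}; case: b' => H; apply: sub_act0.
  have {}E : m = l by apply: val_inj.
  case: l / E x y ij => x y ij; have bb : b != b'.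
    by apply: contraNneq ij => ->.
  by move: bb {ij}; case: b' => bb; apply: half_unit_sign.
Qed.

Lemma sharp_rep_faithful h : (forall i, sharp_rep i h = 0) -> h = 0.
Proof.
move=> h0; pose P l := (bipart_swap l == l) || (l \in L).
apply: (@fixed_faithful K q n q_neq0 q_exp1 q_expN1 P h) => [l|l v]; rewrite /P.
  have := L_choice l; rewrite bipart_swapK [l == _]eq_sym; case: eqP => //= _.
  by case: (l \in L).
case/orP => [E|lL]; last first.
  by have /lfunP/(_ v) := h0 (inl (exist _ l lL)); rewrite zero_lfunE RE.
have half0 b u : u \in eigen_tau K b l -> act h u = 0.
  move=> uE; have := h0 (inr (exist _ l E, b)); rewrite /sharp_rep /=.
  by case: b uE => uE /lfunP/(_ (Subvs uE))/(congr1 vsval); rewrite zero_lfunE sharp_half_act linear0.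
have [u uE [w wE ->]] := eigen_tau_split q_expN1 v (eqP E).
by rewrite snactvD (half0 _ _ uE) (half0 _ _ wE) addr0.
Qed.

Lemma sharp_basis_inhabited i : exists x : sharp_basis i, True.
Proof.
case: i => [l|[l b]] /=; have [T sT] := exists_std (val l) n_gt0.
  by exists (stab_of sT).
pose k0 := Ordinal n_gt0.
have [d|d] := boolP (bdiag (T k0)); last by exists (exist _ (stab_of sT) d).
have sT' : std (val l) (tab_star T) by rewrite std_star_sym //; exact/eqP/(valP l).
have d' : ~~ bdiag (val (stab_of sT') k0) by rewrite /= tab_star_diag d.
by exists (exist _ (stab_of sT') d').
Qed.

Lemma sharp_index_enum : exists s : seq I, uniq s /\ forall i, i \in s.
Proof.
have [s sP] := bipart_enum n_gt0.
pose s1 : seq I := [seq inl l | l <- pmap insub s].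
pose s2 : seq I := [seq inr (l, b) | l <- pmap insub s, b <- [:: true; false]].
exists (undup (s1 ++ s2)); rewrite undup_uniq; split=> // i.
rewrite mem_undup mem_cat; case: i => [l|[l b]]; apply/orP.
  by left; apply: map_f; rewrite mem_pmap_sub sP.
right; apply/allpairsP; exists (l, b); rewrite mem_pmap_sub sP; split=> //.
by rewrite !inE; case: b.
Qed.

Lemma sharp_rep_basic_set : basic_set sharp_rep /\ semisimple_ring (hecke_fixed q n).
Proof.
have [s [us mem_s]] := sharp_index_enum; split.
  exact: (mxunit_basic_set sharp_coord_linear sharp_coord_expand sharp_coord_vec
    sharp_unit_vec sharp_unit_other sharp_rep_faithful sharp_basis_inhabited us mem_s).
exact: (mxunit_semisimple sharp_coord_linear sharp_coord_expand sharp_coord_vec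
  sharp_unit_vec sharp_unit_other sharp_rep_faithful us mem_s).
Qed.
End SharpFamilyUnits.

Lemma sharp_rep_swap (K : fieldType) (q : K) (n : nat) (l : bipart n)
    (q_neq0 : q != 0) (q_exp1 : forall k : int, k != 0 -> q ^ k != 1)
    (q_expN1 : forall k : int, q ^ k != -1) :
  requiv (res_sharp (hecke_rep (seminormal_eqs (bipart_swap l) q_neq0 q_exp1 q_expN1)))
         (res_sharp (hecke_rep (seminormal_eqs l q_neq0 q_exp1 q_expN1))).
Proof.
have E : l = bipart_swap (bipart_swap l) by rewrite bipart_swapK.
exists (sigma K (bipart_swap l) l) => [|h v].
  exists (sigma K l (bipart_swap l)) => v; last exact: sigmaK.
  by have := sigmaK v; rewrite -E.
rewrite !RE -(sigma_act q_neq0 q_exp1 q_expN1 _ _ E).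
by have := hecke_fixedP h; rewrite inE => /eqP ->.
Qed.

Lemma exists_swap_choice n : exists L : {pred bipart n}, swap_choice L.
Proof.
exists (fun l : bipart n => (choice.pickle l < choice.pickle (bipart_swap l))%N) => l.
rewrite !unfold_in bipart_swapK.
case: eqP => [->|ne]; first by rewrite ltnn.
case: ltngtP => // /(pcan_inj choice.pickleK) E; by case: ne.
Qed.

Theorem theorem6p8 (n : nat) (n_ge2 : (2 <= n)%N)
    (K1bar : closedFieldType) (iota : {rmorphism K1 -> K1bar})
    (algebraic_iota : integralRange iota) :
  (forall l : bipart n,
     requiv (seminormal_sharp idfun (bipart_swap l)) (seminormal_sharp idfun l))
  /\
  exists Vp Vm : forall l : bipart n, subrep (seminormal_sharp iota l),
  [/\ forall l : bipart n, bipart_swap l = l ->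
        [/\ direct_sum_decomp (Vp l) (Vm l),
            ~ requiv (rep_of_sub (Vp l)) (rep_of_sub (Vm l)),
            (rdeg (rep_of_sub (Vp l)) * 2 = rdeg (seminormal_sharp iota l))%N
          & (rdeg (rep_of_sub (Vm l)) * 2 = rdeg (seminormal_sharp iota l))%N],
      forall L : {pred bipart n}, swap_choice L ->
        basic_set (@sharp_family _ iota n L Vp Vm)
    & semisimple_ring (hecke_fixed (iota qvar) n)].
Proof.
split=> [l|]; first exact: sharp_rep_swap.
have n0 : (0 < n)%N := ltnW n_ge2.
pose q0 := iota_q_neq0 iota; pose q1 := iota_q_exp1 iota; pose qN1 := iota_q_expN1 iota.
(* Inequivalence of the halves and semisimplicity come without a given [L]; both are read off the
   family of one particular choice. *)
have [L0 L0P] := exists_swap_choice n.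
have [bs0 ss] := sharp_rep_basic_set q0 q1 qN1 n0 L0P.
exists (sharp_half q0 q1 qN1 true), (sharp_half q0 q1 qN1 false); split=> // [l E|L LP].
  split; [exact: sharp_half_direct| |exact: rdeg_sharp_half|exact: rdeg_sharp_half].
  move=> eq; have [_ inj _] := bs0; pose l' : {l : bipart n | bipart_swap l == l} := exist _ l (introT eqP E).
  by have := inj (inr (l', true)) (inr (l', false)) eq.
by have [bs _] := sharp_rep_basic_set q0 q1 qN1 n0 LP.
Qed.
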